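(* Let $(\mathbb{C},\boxtimes,I)$ be a symmetric normal oplax monoidal closed double category such that: (I) $\mathbb{C}$ is fibrant; (II) for each object $A$, the category $\mathrm{Mnd}_A(\mathbb{C})$ has finite coproducts; (III) $\mathbb{C}_0$ has equalisers; (IV) $\mathbb{C}$ has 1-tabulators. Then the category $\mathrm{Mnd}(\mathbb{C})$ of monads and monad maps in $\mathbb{C}$ admits the structure of a symmetric monoidal closed category, with tensor product given by the non-commuting tensor product $\mathbin{\Box}$ of monads, and with unit object the discrete monad $\Delta_I$ on the unit object $I$ of $\mathbb{C}$.
   Context: Double categories. A (pseudo) double category $\mathbb{C}$ has a category $\mathbb{C}_0$ (objects and vertical maps), a category $\mathbb{C}_1$ (horizontal maps and 2-morphisms), source and target functors $\mathfrak{s},\mathfrak{t}\colon\mathbb{C}_1\to\mathbb{C}_0$, and functors $\circ\colon\mathbb{C}_1\times_{\mathbb{C}_0}\mathbb{C}_1\to\mathbb{C}_1$ and $\mathrm{id}\colon\mathbb{C}_0\to\mathbb{C}_1$, associative and unital up to coherent natural globular isomorphism (coherence cells are suppressed). Write $x\colon A\nrightarrow B$ for a horizontal map with $\mathfrak{s}(x)=A$, $\mathfrak{t}(x)=B$, and $y\circ x\colon A\nrightarrow C$ for its composite with $y\colon B\nrightarrow C$. A 2-morphism $\alpha\colon x\to y$ lies over the pair of vertical maps $(\mathfrak{s}(\alpha),\mathfrak{t}(\alpha))$, and over $f$ if both equal $f$; it is globular if both are identities. $\mathbb{C}[A,B]$ is the category of horizontal maps $A\nrightarrow B$ and globular 2-morphisms.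 $\mathbb{C}$ is fibrant if $(\mathfrak{s},\mathfrak{t})\colon\mathbb{C}_1\to\mathbb{C}_0\times\mathbb{C}_0$ is a Grothendieck fibration. $\mathbb{C}$ has 1-tabulators if $\mathrm{id}\colon\mathbb{C}_0\to\mathbb{C}_1$ has a right adjoint. Monads. $\mathrm{End}(\mathbb{C})$ has objects pairs $(A,x\colon A\nrightarrow A)$ and maps $(f,\phi)\colon(A,x)\to(B,y)$ with $f\colon A\to B$ vertical and $\phi\colon x\to y$ a 2-morphism over $f$. A monad $(A,a)$ is an object of $\mathrm{End}(\mathbb{C})$ with globular $\mu\colon a\circ a\to a$, $\eta\colon\mathrm{id}_A\to a$ satisfying associativity and unit laws; a monad map is a map $(f,\phi)$ of $\mathrm{End}(\mathbb{C})$ with $\phi\mu=\mu(\phi\circ\phi)$ and $\phi\eta=\eta\,\mathrm{id}_f$. These form $\mathrm{Mnd}(\mathbb{C})$. $\mathrm{End}_A(\mathbb{C})=\mathbb{C}[A,A]$ and $\mathrm{Mnd}_A(\mathbb{C})$ are the fibres over $A$ of the forgetful functors to $\mathbb{C}_0$. The discrete monad on $A$ is $\Delta_A=(A,\mathrm{id}_A)$. Oplax monoidal structure. An oplax monoidal structure $(\boxtimes,I)$ on $\mathbb{C}$ consists of oplax double functors $\boxtimes\colon\mathbb{C}\times\mathbb{C}\to\mathbb{C}$ and $I\colon\mathbf{1}\to\mathbb{C}$ with invertible vertical transformations for associativity and units satisfying the usual coherence axioms. Explicitly: monoidal structures $(\boxtimes,I_0)$ on $\mathbb{C}_0$ and $(\boxtimes,I_1)$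 on $\mathbb{C}_1$ with $\mathfrak{s},\mathfrak{t}$ strict monoidal, and globular 2-morphisms $\xi\colon(y_1\circ x_1)\boxtimes(y_2\circ x_2)\to(y_1\boxtimes y_2)\circ(x_1\boxtimes x_2)$, $\upsilon\colon\mathrm{id}_{A_1}\boxtimes\mathrm{id}_{A_2}\to\mathrm{id}_{A_1\boxtimes A_2}$, $\delta\colon I_1\to I_1\circ I_1$, $\iota\colon I_1\to\mathrm{id}_{I_0}$ making $\boxtimes$ and $I$ oplax double functors and the associativity and unit constraints vertical transformations. It is normal if $\upsilon,\delta,\iota$ are invertible and $\xi$ is invertible whenever $x_1=y_1=\mathrm{id}_{A_1}$ or $x_2=y_2=\mathrm{id}_{A_2}$. It is symmetric if $\mathbb{C}_0$ and $\mathbb{C}_1$ are symmetric monoidal, $\mathfrak{s},\mathfrak{t}$ preserve the symmetries strictly, and the symmetries are compatible with $\xi$ and $\upsilon$ (i.e. form a vertical transformation). It is closed if there are right adjoints $(-)\boxtimes B\dashv\langle B,-\rangle_0$ on $\mathbb{C}_0$ and $(-)\boxtimes y\dashv\langle y,-\rangle_1$ on $\mathbb{C}_1$ such that $\mathfrak{s},\mathfrak{t}$ strictly preserve the internal homs and the evaluation maps. Non-commuting tensor product. By normality, for monads $(A,a),(B,b)$ the pairs $(A,a)\boxtimes\Delta_B=(A\boxtimes B,a\boxtimes\mathrm{id}_B)$ and $\Delta_A\boxtimes(B,b)=(A\boxtimes B,\mathrm{id}_A\boxtimes b)$ are monads (with multiplications and units built from those of $a$, $b$ using $\xi^{-1}$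 and $\upsilon^{-1}$). The non-commuting tensor product $(A,a)\mathbin{\Box}(B,b)=(A\boxtimes B,a\mathbin{\Box}b)$ is the coproduct of $(A,a)\boxtimes\Delta_B$ and $\Delta_A\boxtimes(B,b)$ in $\mathrm{Mnd}_{A\boxtimes B}(\mathbb{C})$. *)

(* Defs.v *)
From mathcomp Require Import all_boot.
From Stdlib Require Import ProofIrrelevance.

Set Implicit Arguments.
Unset Strict Implicit.
Unset Printing Implicit Defensive.

Declare Scope dbl_scope.
Local Open Scope dbl_scope.

Record Category := MkCategory {
  Ob :> Type;
  Hom : Ob -> Ob -> Type;
  idm : forall A, Hom A A;
  cmp : forall A B C, Hom B C -> Hom A B -> Hom A C;
  cmp1m : forall A B (f : Hom A B), cmp (idm B) f = f;
  cmpm1 : forall A B (f : Hom A B), cmp f (idm A) = f;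
  cmpA : forall A B C D (h : Hom C D) (g : Hom B C) (f : Hom A B),
    cmp h (cmp g f) = cmp (cmp h g) f }.

Arguments Hom {c} _ _.
Arguments idm {c} A.
Arguments cmp {c A B C} _ _.
Notation "g ∘ f" := (cmp g f) (at level 40, left associativity) : dbl_scope.

Record IsIso (C : Category) (A B : C) (f : Hom A B) := MkIsIso {
  inv : Hom B A;
  inv_cmp : inv ∘ f = idm A;
  cmp_inv : f ∘ inv = idm B }.

Record Functor (C D : Category) := MkFunctor {
  fob :> C -> D;
  fmap : forall A B, Hom A B -> Hom (fob A) (fob B);
  fmap1 : forall A, fmap (idm A) = idm (fob A);
  fmapM : forall A B E (g : Hom B E) (f : Hom A B),
    fmap (g ∘ f) = fmap g ∘ fmap f }.

Section ProductCategory.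
Variables C D : Category.
Definition prod_hom (X Y : C * D) : Type := (Hom X.1 Y.1 * Hom X.2 Y.2)%type.
Definition prod_idm (X : C * D) : prod_hom X X := (idm X.1, idm X.2).
Definition prod_cmp (X Y Z : C * D) (g : prod_hom Y Z) (f : prod_hom X Y) :
  prod_hom X Z := (g.1 ∘ f.1, g.2 ∘ f.2).

Definition prod_cat : Category.
Proof.
refine (@MkCategory (C * D) prod_hom prod_idm prod_cmp _ _ _).
- by move=> A B [f g]; rewrite /prod_cmp /= !cmp1m.
- by move=> A B [f g]; rewrite /prod_cmp /= !cmpm1.
- by move=> A B E F h g f; rewrite /prod_cmp /= !cmpA.
Defined.
End ProductCategory.

Record RightAdjoint (C D : Category) (F : Functor C D) (G : D -> C)
    (eps : forall d, Hom (F (G d)) d) := MkRightAdjoint {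
  gmap : forall d d', Hom d d' -> Hom (G d) (G d');
  gmap1 : forall d, gmap (idm d) = idm (G d);
  gmapM : forall d d' d'' (g : Hom d' d'') (f : Hom d d'),
    gmap (g ∘ f) = gmap g ∘ gmap f;
  unit_adj : forall c, Hom c (G (F c));
  unit_nat : forall c c' (f : Hom c c'),
    unit_adj c' ∘ f = gmap (fmap F f) ∘ unit_adj c;
  counit_nat : forall d d' (g : Hom d d'),
    eps d' ∘ fmap F (gmap g) = g ∘ eps d;
  triangle_left : forall c, eps (F c) ∘ fmap F (unit_adj c) = idm (F c);
  triangle_right : forall d, gmap (eps d) ∘ unit_adj (G d) = idm (G d) }.

Definition has_right_adjoint (C D : Category) (F : Functor C D) : Prop :=
  exists (G : D -> C) (eps : forall d, Hom (F (G d)) d),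
    inhabited (RightAdjoint eps).

Definition has_equalisers (C : Category) : Prop :=
  forall (A B : C) (f g : Hom A B), exists (E : C) (e : Hom E A),
    f ∘ e = g ∘ e /\
    forall (Z : C) (z : Hom Z A), f ∘ z = g ∘ z -> exists! h, e ∘ h = z.

Record Coproduct (C : Category) (I : Type) (X : I -> C) := MkCoproduct {
  cop : C;
  inj : forall i, Hom (X i) cop;
  cop_universal : forall (Z : C) (f : forall i, Hom (X i) Z),
    exists! h : Hom cop Z, forall i, h ∘ inj i = f i }.

(* Finite coproducts are chosen, so as to have the coproduct as an operation. *)
Definition FiniteCoproducts (C : Category) : Type :=
  forall (I : finType) (X : I -> C), Coproduct X.

Definition is_cartesian (E B : Category) (P : Functor E B) (e' e : E)
    (phi : Hom e' e) : Prop :=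
  forall (e'' : E) (psi : Hom e'' e) (g : Hom (P e'') (P e')),
    fmap P phi ∘ g = fmap P psi ->
    exists! chi : Hom e'' e', phi ∘ chi = psi /\ fmap P chi = g.

(* The equality of dependent pairs says [P e' = b] and [fmap P phi = f]. *)
Definition is_fibration (E B : Category) (P : Functor E B) : Prop :=
  forall (e : E) (b : B) (f : Hom b (P e)),
    exists (e' : E) (phi : Hom e' e),
      existT (fun b' => Hom b' (P e)) (P e') (fmap P phi) = existT _ b f /\
      is_cartesian P phi.

(* The data and the laws of a monoidal structure are separated, so that one can
   speak of a structure with prescribed tensor product and unit. *)
Record Tensor (C : Category) := MkTensor {
  tob : C -> C -> C;
  tmap : forall A A' B B', Hom A A' -> Hom B B' -> Hom (tob A B) (tob A' B');
  tunit : C }.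

Arguments tmap {C} t {A A' B B'} _ _.

Record Constraints (C : Category) (T : Tensor C) := MkConstraints {
  tassoc : forall A B E, Hom (tob T (tob T A B) E) (tob T A (tob T B E));
  tlunit : forall A, Hom (tob T (tunit T) A) A;
  trunit : forall A, Hom (tob T A (tunit T)) A }.

Record MonoidalLaws (C : Category) (T : Tensor C) (K : Constraints T) := {
  tmap1 : forall A B, tmap T (idm A) (idm B) = idm (tob T A B);
  tmapM : forall A A' A'' B B' B'' (g : Hom A' A'') (f : Hom A A')
      (k : Hom B' B'') (h : Hom B B'),
    tmap T (g ∘ f) (k ∘ h) = tmap T g k ∘ tmap T f h;
  tassoc_iso : forall A B E, IsIso (tassoc K A B E);
  tassoc_nat : forall A A' B B' E E' (f : Hom A A') (g : Hom B B')
      (h : Hom E E'),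
    tassoc K A' B' E' ∘ tmap T (tmap T f g) h =
    tmap T f (tmap T g h) ∘ tassoc K A B E;
  tlunit_iso : forall A, IsIso (tlunit K A);
  tlunit_nat : forall A A' (f : Hom A A'),
    tlunit K A' ∘ tmap T (idm (tunit T)) f = f ∘ tlunit K A;
  trunit_iso : forall A, IsIso (trunit K A);
  trunit_nat : forall A A' (f : Hom A A'),
    trunit K A' ∘ tmap T f (idm (tunit T)) = f ∘ trunit K A;
  tpentagon : forall A B E F,
    tassoc K A B (tob T E F) ∘ tassoc K (tob T A B) E F =
    tmap T (idm A) (tassoc K B E F) ∘ tassoc K A (tob T B E) F
      ∘ tmap T (tassoc K A B E) (idm F);
  ttriangle : forall A B,
    tmap T (idm A) (tlunit K B) ∘ tassoc K A (tunit T) B =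
    tmap T (trunit K A) (idm B) }.

Definition Braiding (C : Category) (T : Tensor C) : Type :=
  forall A B, Hom (tob T A B) (tob T B A).

Record SymmetryLaws (C : Category) (T : Tensor C) (K : Constraints T)
    (s : Braiding T) := {
  braid_nat : forall A A' B B' (f : Hom A A') (g : Hom B B'),
    s A' B' ∘ tmap T f g = tmap T g f ∘ s A B;
  braid_inv : forall A B, s B A ∘ s A B = idm (tob T A B);
  braid_hexagon : forall A B E,
    tassoc K B E A ∘ s A (tob T B E) ∘ tassoc K A B E =
    tmap T (idm B) (s A E) ∘ tassoc K B A E ∘ tmap T (s A B) (idm E) }.

Definition tensr (C : Category) (T : Tensor C) (K : Constraints T)
  (L : MonoidalLaws K) (B : C) : Functor C C.
Proof.
refine (@MkFunctor C C (fun A => tob T A B) (fun _ _ f => tmap T f (idm B)) _ _).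
- by move=> A; apply: tmap1 L _ _.
- by move=> A A' A'' g f; rewrite -(tmapM L) cmp1m.
Defined.

Record SymmetricMonoidalClosed (C : Category) (T : Tensor C) := {
  smc_constraints : Constraints T;
  smc_laws : MonoidalLaws smc_constraints;
  smc_braid : Braiding T;
  smc_symmetry : SymmetryLaws smc_constraints smc_braid;
  smc_hom : C -> C -> C;
  smc_ev : forall B A, Hom (tob T (smc_hom B A) B) A;
  smc_adj : forall B, @RightAdjoint _ _ (tensr smc_laws B) (smc_hom B) (smc_ev B) }.

(* The category C_1, with its functors (s,t) to C_0 x C_0, is presented
   fibrewise: horizontal maps are indexed by their source and target, and
   2-morphisms by their source and target vertical maps.  In this way source and
   target are strictly preserved, as they should be, by all the operations. *)
Record CellData := MkCellData {
  vert :> Category;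
  hmap : vert -> vert -> Type;
  cell : forall A B A' B' : vert,
    Hom A A' -> Hom B B' -> hmap A B -> hmap A' B' -> Type;
  vid : forall A B (x : hmap A B), cell (idm A) (idm B) x x;
  vcmp : forall A B A' B' A'' B'' (f' : Hom A' A'') (g' : Hom B' B'')
      (f : Hom A A') (g : Hom B B') (x : hmap A B) (y : hmap A' B')
      (z : hmap A'' B''),
    cell f' g' y z -> cell f g x y -> cell (f' ∘ f) (g' ∘ g) x z }.

Arguments hmap {c} _ _.
Arguments cell {c A B A' B'} _ _ _ _.
Arguments vid {c A B} x.
Notation "b • a" := (vcmp b a) (at level 40, left associativity) : dbl_scope.

#[local] Set Primitive Projections.

Record square (V : CellData) (A B A' B' : V) (x : hmap A B) (y : hmap A' B') :=
  Sq { lft : Hom A A'; rgt : Hom B B'; sqc : cell lft rgt x y }.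

Record hob (V : CellData) :=
  HOb { src : V; tgt : V; hm : hmap src tgt }.

#[local] Unset Primitive Projections.

Arguments Sq {V A B A' B' x y lft rgt} sqc.
Arguments HOb {V src tgt} hm.

(* Equality of 2-morphisms, i.e. of maps of C_1; the source and target vertical
   maps are part of a 2-morphism, and only need to be provably equal. *)
Notation "a ≡ b" := (Sq a = Sq b) (at level 70, no associativity) : dbl_scope.

Record CellCategory := MkCellCategory {
  cdata :> CellData;
  vcmp1m : forall (A B A' B' : cdata) (f : Hom A A') (g : Hom B B')
      (x : hmap A B) (y : hmap A' B') (a : cell f g x y), vid y • a ≡ a;
  vcmpm1 : forall (A B A' B' : cdata) (f : Hom A A') (g : Hom B B')
      (x : hmap A B) (y : hmap A' B') (a : cell f g x y), a • vid x ≡ a;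
  vcmpA : forall (A B A' B' A'' B'' E F : cdata) (f'' : Hom A'' E)
      (g'' : Hom B'' F) (f' : Hom A' A'') (g' : Hom B' B'') (f : Hom A A')
      (g : Hom B B') (x : hmap A B) (y : hmap A' B') (z : hmap A'' B'')
      (w : hmap E F) (c : cell f'' g'' z w) (b : cell f' g' y z)
      (a : cell f g x y), c • (b • a) ≡ c • b • a }.

Section TotalCategory.
Variable V : CellCategory.

Definition sq_id (X : hob V) : square (hm X) (hm X) := Sq (vid (hm X)).
Definition sq_cmp (A B A' B' A'' B'' : V) (x : hmap A B) (y : hmap A' B')
  (z : hmap A'' B'') (T : square y z) (S : square x y) : square x z :=
  Sq (sqc T • sqc S).

(* The category C_1 of horizontal maps and 2-morphisms. *)
Definition hcat : Category.
Proof.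
refine (@MkCategory (hob V) (fun X Y => square (hm X) (hm Y)) sq_id
  (fun X Y Z T S => sq_cmp T S) _ _ _).
- by move=> X Y S; apply: vcmp1m.
- by move=> X Y S; apply: vcmpm1.
- by move=> X Y Z W U T S; apply: vcmpA.
Defined.

Definition src_tgt : Functor hcat (prod_cat V V).
Proof.
by refine (@MkFunctor hcat (prod_cat V V) (fun X => (src X, tgt X))
  (fun X Y S => (lft S, rgt S)) _ _).
Defined.

Lemma Sq_inj (A B A' B' : V) (f : Hom A A') (g : Hom B B')
  (x : hmap A B) (y : hmap A' B') (a b : cell f g x y) : a ≡ b -> a = b.
Proof.
move=> e.
pose P (S : square x y) := { p : f = lft S & { q : g = rgt S |
  sqc S = ecast g' (cell (lft S) g' x y) q (ecast f' (cell f' g x y) p a) } }.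
have : P (Sq b) by rewrite -e; exists erefl; exists erefl.
by move=> [/= p [q]]; rewrite (proof_irrelevance _ p erefl)
  (proof_irrelevance _ q erefl).
Qed.

Definition cast_cell (A B A' B' : V) (x : hmap A B) (y : hmap A' B')
  (f f' : Hom A A') (g g' : Hom B B') (p : f = f') (q : g = g')
  (a : cell f g x y) : cell f' g' x y :=
  ecast g' (cell f' g' x y) q (ecast f' (cell f' g x y) p a).

Lemma cast_cellE (A B A' B' : V) (x : hmap A B) (y : hmap A' B')
  (f f' : Hom A A') (g g' : Hom B B') (p : f = f') (q : g = g')
  (a : cell f g x y) : cast_cell p q a ≡ a.
Proof. by case: _ / p; case: _ / q. Qed.

Definition glob (A B : V) (x y : hmap A B) : Type := cell (idm A) (idm B) x y.

Definition gcmp (A B : V) (x y z : hmap A B) (b : glob y z) (a : glob x y) :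
  glob x z := cast_cell (cmp1m _) (cmp1m _) (b • a).

(* The category C[A,B] of horizontal maps from A to B and globular 2-morphisms. *)
Definition gcat (A B : V) : Category.
Proof.
refine (@MkCategory (hmap A B) (@glob A B) (fun x => vid x) (@gcmp A B) _ _ _).
- by move=> x y a; apply: Sq_inj; rewrite cast_cellE vcmp1m.
- by move=> x y a; apply: Sq_inj; rewrite cast_cellE vcmpm1.
- move=> x y z w c b a; apply: Sq_inj; rewrite !cast_cellE.
  rewrite -[LHS]/(sq_cmp (Sq c) (Sq (gcmp b a))).
  rewrite -[RHS]/(sq_cmp (Sq (gcmp c b)) (Sq a)) !cast_cellE.
  exact: vcmpA.
Defined.

Definition GlobIso (A B : V) (x y : hmap A B) (a : glob x y) : Type :=
  @IsIso (gcat A B) x y a.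

End TotalCategory.

Record DoubleCategory := MkDoubleCategory {
  ccat :> CellCategory;
  hid : forall A : ccat, hmap A A;
  chid : forall (A B : ccat) (f : Hom A B), cell f f (hid A) (hid B);
  hcmp : forall A B E : ccat, hmap B E -> hmap A B -> hmap A E;
  chcmp : forall (A B E A' B' E' : ccat) (f : Hom A A') (g : Hom B B')
      (h : Hom E E') (y : hmap B E) (y' : hmap B' E') (x : hmap A B)
      (x' : hmap A' B'),
    cell g h y y' -> cell f g x x' -> cell f h (hcmp y x) (hcmp y' x');
  chid1 : forall A : ccat, chid (idm A) = vid (hid A);
  chidM : forall (A B E : ccat) (g : Hom B E) (f : Hom A B),
    chid (g ∘ f) = chid g • chid f;
  chcmp1 : forall (A B E : ccat) (y : hmap B E) (x : hmap A B),
    chcmp (vid y) (vid x) = vid (hcmp y x);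
  chcmpM : forall (A B E A' B' E' A'' B'' E'' : ccat)
      (f : Hom A A') (g : Hom B B') (h : Hom E E')
      (f' : Hom A' A'') (g' : Hom B' B'') (h' : Hom E' E'')
      (y : hmap B E) (y' : hmap B' E') (y'' : hmap B'' E'')
      (x : hmap A B) (x' : hmap A' B') (x'' : hmap A'' B'')
      (b' : cell g' h' y' y'') (b : cell g h y y')
      (a' : cell f' g' x' x'') (a : cell f g x x'),
    chcmp (b' • b) (a' • a) = chcmp b' a' • chcmp b a;
  hassoc : forall (A B E F : ccat) (z : hmap E F) (y : hmap B E) (x : hmap A B),
    glob (hcmp (hcmp z y) x) (hcmp z (hcmp y x));
  hassoc_iso : forall (A B E F : ccat) (z : hmap E F) (y : hmap B E)
      (x : hmap A B), GlobIso (hassoc z y x);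
  hassoc_nat : forall (A B E F A' B' E' F' : ccat)
      (f : Hom A A') (g : Hom B B') (h : Hom E E') (k : Hom F F')
      (z : hmap E F) (z' : hmap E' F') (y : hmap B E) (y' : hmap B' E')
      (x : hmap A B) (x' : hmap A' B')
      (c : cell h k z z') (b : cell g h y y') (a : cell f g x x'),
    hassoc z' y' x' • chcmp (chcmp c b) a ≡ chcmp c (chcmp b a) • hassoc z y x;
  hlunit : forall (A B : ccat) (x : hmap A B), glob (hcmp (hid B) x) x;
  hlunit_iso : forall (A B : ccat) (x : hmap A B), GlobIso (hlunit x);
  hlunit_nat : forall (A B A' B' : ccat) (f : Hom A A') (g : Hom B B')
      (x : hmap A B) (x' : hmap A' B') (a : cell f g x x'),
    hlunit x' • chcmp (chid g) a ≡ a • hlunit x;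
  hrunit : forall (A B : ccat) (x : hmap A B), glob (hcmp x (hid A)) x;
  hrunit_iso : forall (A B : ccat) (x : hmap A B), GlobIso (hrunit x);
  hrunit_nat : forall (A B A' B' : ccat) (f : Hom A A') (g : Hom B B')
      (x : hmap A B) (x' : hmap A' B') (a : cell f g x x'),
    hrunit x' • chcmp a (chid f) ≡ a • hrunit x;
  hpentagon : forall (A B E F G : ccat) (w : hmap F G) (z : hmap E F)
      (y : hmap B E) (x : hmap A B),
    hassoc w z (hcmp y x) • hassoc (hcmp w z) y x ≡
    chcmp (vid w) (hassoc z y x) • hassoc w (hcmp z y) x
      • chcmp (hassoc w z y) (vid x);
  htriangle : forall (A B E : ccat) (y : hmap B E) (x : hmap A B),
    chcmp (vid y) (hlunit x) • hassoc y (hid B) x ≡ chcmp (hrunit y) (vid x) }.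

Arguments hid {d} A.
Arguments chid {d A B} f.
Notation "y ⊙ x" := (hcmp y x) (at level 40, left associativity) : dbl_scope.
Notation "b ⋆ a" := (chcmp b a) (at level 40, left associativity) : dbl_scope.

Definition id_functor (D : DoubleCategory) : Functor D (hcat D).
Proof.
refine (@MkFunctor D (hcat D) (fun A => HOb (hid A)) (fun A B f => Sq (chid f)) _ _).
- by move=> A; rewrite chid1.
- by move=> A B E g f; rewrite chidM.
Defined.

Definition is_fibrant (D : DoubleCategory) : Prop := is_fibration (src_tgt D).

Definition has_1_tabulators (D : DoubleCategory) : Prop :=
  has_right_adjoint (id_functor D).

Record DoubleTensor (D : DoubleCategory) := MkDoubleTensor {
  ten0 : Tensor D;
  hten : forall A B A' B' : D,
    hmap A B -> hmap A' B' -> hmap (tob ten0 A A') (tob ten0 B B');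
  cten : forall (A B A' B' E F E' F' : D) (f : Hom A A') (g : Hom B B')
      (h : Hom E E') (k : Hom F F') (x : hmap A B) (x' : hmap A' B')
      (y : hmap E F) (y' : hmap E' F'),
    cell f g x x' -> cell h k y y' ->
    cell (tmap ten0 f h) (tmap ten0 g k) (hten x y) (hten x' y');
  hunit : hmap (tunit ten0) (tunit ten0) }.

Arguments hten {D d A B A' B'} _ _.
Arguments cten {D d A B A' B' E F E' F' f g h k x x' y y'} _ _.
Arguments hunit {D} d.
Notation "x ⊠ y" := (hten x y) (at level 38, left associativity) : dbl_scope.
Notation "a ⊠c b" := (cten a b) (at level 38, left associativity) : dbl_scope.

Definition ten1 (D : DoubleCategory) (T : DoubleTensor D) : Tensor (hcat D) :=
  @MkTensor (hcat D)
    (fun X Y => HOb (hm X ⊠ hm Y : @hmap D (tob (ten0 T) _ _) (tob (ten0 T) _ _)))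
    (fun _ _ _ _ S R => Sq (sqc S ⊠c sqc R))
    (HOb (hunit T)).

Record DoubleConstraints (D : DoubleCategory) (T : DoubleTensor D) :=
  MkDoubleConstraints {
  con0 : Constraints (ten0 T);
  cassoc : forall (A B E A' B' E' : D) (x : hmap A A') (y : hmap B B')
      (z : hmap E E'),
    cell (tassoc con0 A B E) (tassoc con0 A' B' E') (x ⊠ y ⊠ z) (x ⊠ (y ⊠ z));
  clunit : forall (A A' : D) (x : hmap A A'),
    cell (tlunit con0 A) (tlunit con0 A') (hunit T ⊠ x) x;
  crunit : forall (A A' : D) (x : hmap A A'),
    cell (trunit con0 A) (trunit con0 A') (x ⊠ hunit T) x }.

Definition con1 (D : DoubleCategory) (T : DoubleTensor D)
    (K : DoubleConstraints T) : Constraints (ten1 T) :=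
  @MkConstraints (hcat D) (ten1 T)
    (fun X Y Z => Sq (cassoc K (hm X) (hm Y) (hm Z)))
    (fun X => Sq (clunit K (hm X)))
    (fun X => Sq (crunit K (hm X))).

(* The axioms xi_* and ups_nat say that ⊠ is an oplax double functor, the axioms
   dlt_* that I is one, and the axioms cassoc_*, clunit_* and crunit_* that the
   constraints are vertical transformations, their naturality and invertibility
   being part of laws0 and laws1. *)
Record OplaxMonoidal (D : DoubleCategory) := MkOplaxMonoidal {
  dten :> DoubleTensor D;
  dcon : DoubleConstraints dten;
  laws0 : MonoidalLaws (con0 dcon);
  laws1 : MonoidalLaws (con1 dcon);
  xi : forall (A1 B1 E1 A2 B2 E2 : D) (y1 : hmap B1 E1) (x1 : hmap A1 B1)
      (y2 : hmap B2 E2) (x2 : hmap A2 B2),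
    @glob D (tob (ten0 dten) A1 A2) (tob (ten0 dten) E1 E2)
      ((y1 ⊙ x1) ⊠ (y2 ⊙ x2)) ((y1 ⊠ y2) ⊙ (x1 ⊠ x2));
  ups : forall A1 A2 : D,
    @glob D (tob (ten0 dten) A1 A2) (tob (ten0 dten) A1 A2)
      (hid A1 ⊠ hid A2) (hid (tob (ten0 dten) A1 A2));
  dlt : glob (hunit dten) (hunit dten ⊙ hunit dten);
  iot : glob (hunit dten) (hid (tunit (ten0 dten)));
  xi_nat : forall (A1 B1 E1 A2 B2 E2 A1' B1' E1' A2' B2' E2' : D)
      (f1 : Hom A1 A1') (g1 : Hom B1 B1') (h1 : Hom E1 E1')
      (f2 : Hom A2 A2') (g2 : Hom B2 B2') (h2 : Hom E2 E2')
      (y1 : hmap B1 E1) (y1' : hmap B1' E1') (x1 : hmap A1 B1)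
      (x1' : hmap A1' B1') (y2 : hmap B2 E2) (y2' : hmap B2' E2')
      (x2 : hmap A2 B2) (x2' : hmap A2' B2')
      (b1 : cell g1 h1 y1 y1') (a1 : cell f1 g1 x1 x1')
      (b2 : cell g2 h2 y2 y2') (a2 : cell f2 g2 x2 x2'),
    xi y1' x1' y2' x2' • ((b1 ⋆ a1) ⊠c (b2 ⋆ a2)) ≡
    ((b1 ⊠c b2) ⋆ (a1 ⊠c a2)) • xi y1 x1 y2 x2;
  ups_nat : forall (A1 A2 A1' A2' : D) (f1 : Hom A1 A1') (f2 : Hom A2 A2'),
    ups A1' A2' • (chid f1 ⊠c chid f2) ≡
    chid (tmap (ten0 dten) f1 f2) • ups A1 A2;
  xi_assoc : forall (A1 B1 E1 F1 A2 B2 E2 F2 : D)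
      (z1 : hmap E1 F1) (y1 : hmap B1 E1) (x1 : hmap A1 B1)
      (z2 : hmap E2 F2) (y2 : hmap B2 E2) (x2 : hmap A2 B2),
    hassoc (z1 ⊠ z2) (y1 ⊠ y2) (x1 ⊠ x2)
      • (xi z1 y1 z2 y2 ⋆ vid (x1 ⊠ x2)) • xi (z1 ⊙ y1) x1 (z2 ⊙ y2) x2 ≡
    (vid (z1 ⊠ z2) ⋆ xi y1 x1 y2 x2) • xi z1 (y1 ⊙ x1) z2 (y2 ⊙ x2)
      • (hassoc z1 y1 x1 ⊠c hassoc z2 y2 x2);
  xi_lunit : forall (A1 B1 A2 B2 : D) (x1 : hmap A1 B1) (x2 : hmap A2 B2),
    hlunit (x1 ⊠ x2) • (ups B1 B2 ⋆ vid (x1 ⊠ x2)) • xi (hid B1) x1 (hid B2) x2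
    ≡ hlunit x1 ⊠c hlunit x2;
  xi_runit : forall (A1 B1 A2 B2 : D) (x1 : hmap A1 B1) (x2 : hmap A2 B2),
    hrunit (x1 ⊠ x2) • (vid (x1 ⊠ x2) ⋆ ups A1 A2) • xi x1 (hid A1) x2 (hid A2)
    ≡ hrunit x1 ⊠c hrunit x2;
  dlt_assoc :
    hassoc (hunit dten) (hunit dten) (hunit dten)
      • (dlt ⋆ vid (hunit dten)) • dlt ≡ (vid (hunit dten) ⋆ dlt) • dlt;
  dlt_lunit :
    hlunit (hunit dten) • (iot ⋆ vid (hunit dten)) • dlt ≡ vid (hunit dten);
  dlt_runit :
    hrunit (hunit dten) • (vid (hunit dten) ⋆ iot) • dlt ≡ vid (hunit dten);
  cassoc_xi : forall (A1 B1 E1 A2 B2 E2 A3 B3 E3 : D)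
      (y1 : hmap B1 E1) (x1 : hmap A1 B1) (y2 : hmap B2 E2) (x2 : hmap A2 B2)
      (y3 : hmap B3 E3) (x3 : hmap A3 B3),
    (cassoc dcon y1 y2 y3 ⋆ cassoc dcon x1 x2 x3)
      • xi (y1 ⊠ y2) (x1 ⊠ x2) y3 x3 • (xi y1 x1 y2 x2 ⊠c vid (y3 ⊙ x3)) ≡
    xi y1 x1 (y2 ⊠ y3) (x2 ⊠ x3) • (vid (y1 ⊙ x1) ⊠c xi y2 x2 y3 x3)
      • cassoc dcon (y1 ⊙ x1) (y2 ⊙ x2) (y3 ⊙ x3);
  cassoc_ups : forall A1 A2 A3 : D,
    chid (tassoc (con0 dcon) A1 A2 A3) • ups (tob (ten0 dten) A1 A2) A3
      • (ups A1 A2 ⊠c vid (hid A3)) ≡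
    ups A1 (tob (ten0 dten) A2 A3) • (vid (hid A1) ⊠c ups A2 A3)
      • cassoc dcon (hid A1) (hid A2) (hid A3);
  clunit_xi : forall (A B E : D) (y : hmap B E) (x : hmap A B),
    (clunit dcon y ⋆ clunit dcon x) • xi (hunit dten) (hunit dten) y x
      • (dlt ⊠c vid (y ⊙ x)) ≡ clunit dcon (y ⊙ x);
  clunit_ups : forall A : D,
    chid (tlunit (con0 dcon) A) • ups (tunit (ten0 dten)) A
      • (iot ⊠c vid (hid A)) ≡ clunit dcon (hid A);
  crunit_xi : forall (A B E : D) (y : hmap B E) (x : hmap A B),
    (crunit dcon y ⋆ crunit dcon x) • xi y x (hunit dten) (hunit dten)
      • (vid (y ⊙ x) ⊠c dlt) ≡ crunit dcon (y ⊙ x);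
  crunit_ups : forall A : D,
    chid (trunit (con0 dcon) A) • ups A (tunit (ten0 dten))
      • (vid (hid A) ⊠c iot) ≡ crunit dcon (hid A) }.

Notation "A ⊠0[ M ] B" := (tob (ten0 (dten M)) A B)
  (at level 38, left associativity, format "A  ⊠0[ M ]  B") : dbl_scope.

Record Normal (D : DoubleCategory) (M : OplaxMonoidal D) := MkNormal {
  ups_iso : forall A1 A2 : D, GlobIso (ups M A1 A2);
  dlt_iso : GlobIso (dlt M);
  iot_iso : GlobIso (iot M);
  xi_iso_l : forall (A B2 E2 A2 : D) (y2 : hmap B2 E2) (x2 : hmap A2 B2),
    GlobIso (xi M (hid A) (hid A) y2 x2);
  xi_iso_r : forall (A1 B1 E1 A : D) (y1 : hmap B1 E1) (x1 : hmap A1 B1),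
    GlobIso (xi M y1 x1 (hid A) (hid A)) }.

Record Symmetric (D : DoubleCategory) (M : OplaxMonoidal D) := MkSymmetric {
  braid0 : Braiding (ten0 M);
  sym0 : SymmetryLaws (con0 (dcon M)) braid0;
  braid1 : forall (A A' B B' : D) (x : hmap A A') (y : hmap B B'),
    cell (braid0 A B) (braid0 A' B') (x ⊠ y) (y ⊠ x);
  sym1 : @SymmetryLaws (hcat D) (ten1 M) (con1 (dcon M))
    (fun X Y => Sq (braid1 (hm X) (hm Y)));
  braid_xi : forall (A1 B1 E1 A2 B2 E2 : D) (y1 : hmap B1 E1) (x1 : hmap A1 B1)
      (y2 : hmap B2 E2) (x2 : hmap A2 B2),
    (braid1 y1 y2 ⋆ braid1 x1 x2) • xi M y1 x1 y2 x2 ≡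
    xi M y2 x2 y1 x1 • braid1 (y1 ⊙ x1) (y2 ⊙ x2);
  braid_ups : forall A B : D,
    chid (braid0 A B) • ups M A B ≡ ups M B A • braid1 (hid A) (hid B) }.

Record Closed (D : DoubleCategory) (M : OplaxMonoidal D) := MkClosed {
  hom0 : D -> D -> D;
  ev0 : forall B E : D, Hom (hom0 B E ⊠0[M] B) E;
  adj0 : forall B : D,
    @RightAdjoint _ _ (tensr (laws0 M) B) (hom0 B) (ev0 B);
  hom1 : forall B B' E E' : D,
    hmap B B' -> hmap E E' -> hmap (hom0 B E) (hom0 B' E');
  ev1 : forall (B B' E E' : D) (y : hmap B B') (z : hmap E E'),
    cell (ev0 B E) (ev0 B' E') (hom1 y z ⊠ y) z;
  adj1 : forall Y : hcat D,
    @RightAdjoint (hcat D) (hcat D) (tensr (laws1 M) Y)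
      (fun Z => HOb (hom1 (hm Y) (hm Z)))
      (fun Z => Sq (ev1 (hm Y) (hm Z))) }.

Record MonadOn (D : DoubleCategory) (A : D) := MkMonadOn {
  mloop :> hmap A A;
  mmu : glob (mloop ⊙ mloop) mloop;
  meta : glob (hid A) mloop;
  m_assoc : mmu • (mmu ⋆ vid mloop) ≡
    mmu • (vid mloop ⋆ mmu) • hassoc mloop mloop mloop;
  m_unitl : mmu • (meta ⋆ vid mloop) ≡ hlunit mloop;
  m_unitr : mmu • (vid mloop ⋆ meta) ≡ hrunit mloop }.

Record Monad (D : DoubleCategory) := MkMonad {
  mbase : D;
  mstr :> MonadOn mbase }.

Arguments MkMonad {D mbase} mstr.

Record MonadMap (D : DoubleCategory) (X Y : Monad D) := MkMonadMap {
  vmap : Hom (mbase X) (mbase Y);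
  mcell : cell vmap vmap (mloop X) (mloop Y);
  mcell_mu : mcell • mmu X ≡ mmu Y • (mcell ⋆ mcell);
  mcell_eta : mcell • meta X ≡ meta Y • chid vmap }.

Section MonadCategory.
Variable D : DoubleCategory.

Lemma sqE (A B A' B' A'' B'' : D) (x : hmap A B) (y : hmap A' B')
  (z : hmap A'' B'') (f' : Hom A' A'') (g' : Hom B' B'') (f : Hom A A')
  (g : Hom B B') (b : cell f' g' y z) (a : cell f g x y) :
  Sq (b • a) = sq_cmp (Sq b) (Sq a).
Proof. by []. Qed.

Lemma MonadMap_inj (X Y : Monad D) (F G : MonadMap X Y) :
  mcell F ≡ mcell G -> F = G.
Proof.
case: F => f a am ae; case: G => g b bm be /= e.
have efg : f = g by rewrite -[f]/(lft (Sq a)) e.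
case: _ / efg in b bm be e *.
case: _ / (Sq_inj e) in bm be *.
by rewrite (proof_irrelevance _ am bm) (proof_irrelevance _ ae be).
Qed.

Definition mnd_id (X : Monad D) : MonadMap X X.
Proof.
refine (@MkMonadMap D X X (idm _) (vid _) _ _).
- by rewrite chcmp1 vcmp1m vcmpm1.
- by rewrite chid1 vcmp1m vcmpm1.
Defined.

Definition mnd_cmp (X Y Z : Monad D) (G : MonadMap Y Z) (F : MonadMap X Y) :
  MonadMap X Z.
Proof.
refine (@MkMonadMap D X Z (vmap G ∘ vmap F) (mcell G • mcell F) _ _).
- rewrite -vcmpA sqE mcell_mu -sqE vcmpA sqE mcell_mu -sqE chcmpM.
  by rewrite -vcmpA.
- rewrite -vcmpA sqE mcell_eta -sqE vcmpA sqE mcell_eta -sqE chidM.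
  by rewrite -vcmpA.
Defined.

Definition Mnd : Category.
Proof.
refine (@MkCategory (Monad D) (@MonadMap D) mnd_id mnd_cmp _ _ _).
- by move=> X Y F; apply: MonadMap_inj; apply: vcmp1m.
- by move=> X Y F; apply: MonadMap_inj; apply: vcmpm1.
- by move=> X Y Z W H G F; apply: MonadMap_inj; apply: vcmpA.
Defined.

(* The fibre over A of the forgetful functor Mnd -> C_0. *)
Definition mnd_fib_hom (A : D) (a b : MonadOn A) : Type :=
  {F : MonadMap (MkMonad a) (MkMonad b) | vmap F = idm A}.

Definition mnd_fib_id (A : D) (a : MonadOn A) : mnd_fib_hom a a :=
  exist _ (mnd_id (MkMonad a)) erefl.

Definition mnd_fib_cmp (A : D) (a b c : MonadOn A) (G : mnd_fib_hom b c)
  (F : mnd_fib_hom a b) : mnd_fib_hom a c.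
Proof.
exists (mnd_cmp (sval G) (sval F)).
by rewrite /= (svalP G) (svalP F); apply: cmp1m.
Defined.

Lemma mnd_fib_inj (A : D) (a b : MonadOn A) (F G : mnd_fib_hom a b) :
  sval F = sval G -> F = G.
Proof.
case: F G => F p [G q] /= e; case: _ / e in q *.
by rewrite (proof_irrelevance _ p q).
Qed.

Definition MndOn (A : D) : Category.
Proof.
refine (@MkCategory (MonadOn A) (@mnd_fib_hom A) (@mnd_fib_id A)
  (@mnd_fib_cmp A) _ _ _).
- by move=> a b F; apply/mnd_fib_inj/(cmp1m (c := Mnd)).
- by move=> a b F; apply/mnd_fib_inj/(cmpm1 (c := Mnd)).
- by move=> a b c d H G F; apply/mnd_fib_inj/(cmpA (c := Mnd)).
Defined.

End MonadCategory.

Section GlobularCalculus.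
Variable D : DoubleCategory.
Local Notation "b ∙ a" := (gcmp b a) (at level 40, left associativity).

Lemma gcmpE (A B : D) (x y z : hmap A B) (b : glob y z) (a : glob x y) :
  Sq (b ∙ a) = sq_cmp (Sq b) (Sq a).
Proof. exact: cast_cellE. Qed.

Lemma gcmpA (A B : D) (x y z w : hmap A B) (c : glob z w) (b : glob y z)
  (a : glob x y) : c ∙ (b ∙ a) = c ∙ b ∙ a.
Proof. exact (@cmpA (gcat A B) x y z w c b a). Qed.

Lemma gcmp1m (A B : D) (x y : hmap A B) (a : glob x y) :
  gcmp (vid y : glob y y) a = a.
Proof. exact (@cmp1m (gcat A B) x y a). Qed.

Lemma gcmpm1 (A B : D) (x y : hmap A B) (a : glob x y) :
  gcmp a (vid x : glob x x) = a.
Proof. exact (@cmpm1 (gcat A B) x y a). Qed.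

Definition gh (A B E : D) (y y' : hmap B E) (x x' : hmap A B)
  (b : glob y y') (a : glob x x') : glob (y ⊙ x) (y' ⊙ x') := b ⋆ a.

Definition g1 (A B : D) (x : hmap A B) : glob x x := vid x.

Lemma chcmp_cast (A B E A' B' E' : D) (y : hmap B E) (y' : hmap B' E')
  (x : hmap A B) (x' : hmap A' B') (f f' : Hom A A') (g g' : Hom B B')
  (h h' : Hom E E') (p : f = f') (q : g = g') (r : h = h')
  (b : cell g h y y') (a : cell f g x x') :
  cast_cell q r b ⋆ cast_cell p q a ≡ b ⋆ a.
Proof. by case: _ / p; case: _ / q; case: _ / r. Qed.

Lemma ghM (A B E : D) (y y' y'' : hmap B E) (x x' x'' : hmap A B)
  (b' : glob y' y'') (b : glob y y') (a' : glob x' x'') (a : glob x x') :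
  gh (b' ∙ b) (a' ∙ a) = gh b' a' ∙ gh b a.
Proof.
apply: Sq_inj; rewrite gcmpE -[RHS]sqE -chcmpM; exact: chcmp_cast.
Qed.

Lemma gh1 (A B E : D) (y : hmap B E) (x : hmap A B) :
  gh (g1 y) (g1 x) = g1 (y ⊙ x).
Proof. exact: chcmp1. Qed.

Lemma gassoc_nat (A B E F : D) (z z' : hmap E F) (y y' : hmap B E)
  (x x' : hmap A B) (c : glob z z') (b : glob y y') (a : glob x x') :
  gcmp (hassoc z' y' x') (gh (gh c b) a) = gh c (gh b a) ∙ hassoc z y x.
Proof. apply: Sq_inj; rewrite !gcmpE; exact: hassoc_nat. Qed.

Lemma glunit_nat (A B : D) (x x' : hmap A B) (a : glob x x') :
  gcmp (hlunit x') (gh (g1 (hid B)) a) = a ∙ hlunit x.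
Proof.
apply: Sq_inj; rewrite !gcmpE /gh /g1 -chid1; exact: hlunit_nat.
Qed.

Lemma grunit_nat (A B : D) (x x' : hmap A B) (a : glob x x') :
  gcmp (hrunit x') (gh a (g1 (hid A))) = a ∙ hrunit x.
Proof.
apply: Sq_inj; rewrite !gcmpE /gh /g1 -chid1; exact: hrunit_nat.
Qed.

Lemma gpentagon (A B E F G : D) (w : hmap F G) (z : hmap E F)
  (y : hmap B E) (x : hmap A B) :
  gcmp (hassoc w z (hcmp y x)) (hassoc (hcmp w z) y x) =
  gh (g1 w) (hassoc z y x) ∙ hassoc w (hcmp z y) x
    ∙ gh (hassoc w z y) (g1 x).
Proof. apply: Sq_inj; rewrite !gcmpE; exact: hpentagon. Qed.

Lemma gtriangle (A B E : D) (y : hmap B E) (x : hmap A B) :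
  gcmp (gh (g1 y) (hlunit x)) (hassoc y (hid B) x) = gh (hrunit y) (g1 x).
Proof. apply: Sq_inj; rewrite !gcmpE; exact: htriangle. Qed.

Lemma giso_epi (A B : D) (x y z : hmap A B) (a : glob x y) (b c : glob y z) :
  GlobIso a -> b ∙ a = c ∙ a -> b = c.
Proof.
move=> [i _ /= ai] e; rewrite -(gcmpm1 b) -(gcmpm1 c).
by rewrite /= in ai; rewrite -ai !gcmpA e.
Qed.

Lemma giso_mono (A B : D) (x y z : hmap A B) (a : glob y z) (b c : glob x y) :
  GlobIso a -> a ∙ b = a ∙ c -> b = c.
Proof.
move=> [i /= ia _] e; rewrite -(gcmp1m b) -(gcmp1m c).
by rewrite -ia -!gcmpA e.
Qed.

Definition ginv (A B : D) (x y : hmap A B) (a : glob x y) (i : GlobIso a) :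
  glob y x := inv i.

Lemma ginvK (A B : D) (x y : hmap A B) (a : glob x y) (i : GlobIso a) :
  ginv i ∙ a = g1 x.
Proof. exact: inv_cmp i. Qed.

Lemma gKinv (A B : D) (x y : hmap A B) (a : glob x y) (i : GlobIso a) :
  a ∙ ginv i = g1 y.
Proof. exact: cmp_inv i. Qed.

Lemma gh_iso (A B E : D) (y y' : hmap B E) (x x' : hmap A B)
  (b : glob y y') (a : glob x x') : GlobIso b -> GlobIso a -> GlobIso (gh b a).
Proof.
move=> [i /= ib bi] [j /= ja aj]; exists (gh i j) => /=.
- by rewrite -ghM ib ja; apply: gh1.
- by rewrite -ghM bi aj; apply: gh1.
Qed.

Lemma g1_iso (A B : D) (x : hmap A B) : GlobIso (g1 x).
Proof. by exists (g1 x); apply: gcmp1m. Qed.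

Lemma gcmp_iso (A B : D) (x y z : hmap A B) (b : glob y z) (a : glob x y) :
  GlobIso b -> GlobIso a -> GlobIso (b ∙ a).
Proof.
move=> [i /= ib bi] [j /= ja aj]; exists (gcmp (j : glob y x) i) => /=.
- by rewrite gcmpA -(gcmpA _ i) ib gcmpm1.
- by rewrite gcmpA -(gcmpA _ a) aj gcmpm1.
Qed.

Lemma ghid_inj (A B : D) (x x' : hmap A B) (a b : glob x x') :
  gh (g1 (hid B)) a = gh (g1 (hid B)) b -> a = b.
Proof.
move=> e; apply: (giso_epi (hlunit_iso x)).
by rewrite -!glunit_nat e.
Qed.

Lemma ghid_injr (A B : D) (x x' : hmap A B) (a b : glob x x') :
  gh a (g1 (hid A)) = gh b (g1 (hid A)) -> a = b.
Proof.
move=> e; apply: (giso_epi (hrunit_iso x)).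
by rewrite -!grunit_nat e.
Qed.

Lemma ghMr (A B E : D) (y : hmap B E) (x x' x'' : hmap A B)
  (a' : glob x' x'') (a : glob x x') :
  gh (g1 y) (a' ∙ a) = gh (g1 y) a' ∙ gh (g1 y) a.
Proof. by rewrite -ghM gcmp1m. Qed.

Lemma ghMl (A B E : D) (y y' y'' : hmap B E) (x : hmap A B)
  (b' : glob y' y'') (b : glob y y') :
  gh (b' ∙ b) (g1 x) = gh b' (g1 x) ∙ gh b (g1 x).
Proof. by rewrite -ghM gcmp1m. Qed.

Lemma hlunit_comp (A B E : D) (y : hmap B E) (x : hmap A B) :
  gcmp (hlunit (y ⊙ x)) (hassoc (hid E) y x) = gh (hlunit y) (g1 x).
Proof.
apply: ghid_inj; rewrite ghMr.
apply: (giso_epi (hassoc_iso (hid E) (hid E ⊙ y) x)).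
apply: (giso_epi (gh_iso (hassoc_iso (hid E) (hid E) y) (g1_iso x))).
rewrite -!gcmpA (gcmpA (gh (g1 _) (hassoc _ _ _))) -gpentagon.
rewrite !gcmpA gtriangle -gh1 -!gassoc_nat -gcmpA.
by rewrite -ghMl gtriangle.
Qed.

Lemma hlunit_hid (A : D) : hlunit (hid A) = hrunit (hid A).
Proof.
apply: ghid_injr; rewrite -gtriangle -hlunit_comp; congr gcmp.
by apply: (giso_mono (hlunit_iso (hid A))); rewrite glunit_nat.
Qed.

Definition monad_of_glob (A : D) (a : hmap A A) (mu : glob (a ⊙ a) a)
  (eta : glob (hid A) a)
  (assoc : mu ∙ gh mu (g1 a) = mu ∙ gh (g1 a) mu ∙ hassoc a a a)
  (unitl : mu ∙ gh eta (g1 a) = hlunit a)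
  (unitr : mu ∙ gh (g1 a) eta = hrunit a) : MonadOn A.
Proof.
refine (@MkMonadOn D A a mu eta _ _ _).
- by move: (congr1 Sq assoc); rewrite !gcmpE.
- by move: (congr1 Sq unitl); rewrite !gcmpE.
- by move: (congr1 Sq unitr); rewrite !gcmpE.
Defined.

Lemma gm_assoc (A : D) (a : MonadOn A) :
  mmu a ∙ gh (mmu a) (g1 a) = mmu a ∙ gh (g1 a) (mmu a) ∙ hassoc a a a.
Proof. by apply: Sq_inj; rewrite !gcmpE; apply: m_assoc. Qed.

Lemma gm_unitl (A : D) (a : MonadOn A) :
  mmu a ∙ gh (meta a) (g1 a) = hlunit a.
Proof. by apply: Sq_inj; rewrite !gcmpE; apply: m_unitl. Qed.

Lemma gm_unitr (A : D) (a : MonadOn A) :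
  mmu a ∙ gh (g1 a) (meta a) = hrunit a.
Proof. by apply: Sq_inj; rewrite !gcmpE; apply: m_unitr. Qed.

Definition discrete_on (A : D) : MonadOn A.
Proof.
refine (@monad_of_glob A (hid A) (hlunit (hid A)) (vid (hid A)) _ _ _).
- by rewrite -gcmpA gtriangle hlunit_hid.
- by rewrite gh1 gcmpm1.
- by rewrite gh1 gcmpm1 hlunit_hid.
Defined.

Definition discrete (A : D) : Monad D := MkMonad (discrete_on A).

Definition discrete_map (A B : D) (f : Hom A B) :
  MonadMap (discrete A) (discrete B).
Proof.
refine (@MkMonadMap D (discrete A) (discrete B) f (chid f) _ _).
- by rewrite /= hlunit_nat.
- by rewrite /= vcmp1m vcmpm1.
Defined.

End GlobularCalculus.

Section MonadTensor.
Variables (D : DoubleCategory) (M : OplaxMonoidal D).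
Local Notation "b ∙ a" := (gcmp b a) (at level 40, left associativity).

Lemma tmap1M (A B : D) : tmap (ten0 M) (idm A) (idm B) = idm (A ⊠0[M] B).
Proof. exact: tmap1 (laws0 M) _ _. Qed.

Definition gten (A B A' B' : D) (x y : hmap A B) (x' y' : hmap A' B')
  (a : glob x y) (a' : glob x' y') :
  @glob D (A ⊠0[M] A') (B ⊠0[M] B') (x ⊠ x') (y ⊠ y') :=
  cast_cell (tmap1M A A') (tmap1M B B') (a ⊠c a').

Lemma gtenE (A B A' B' : D) (x y : hmap A B) (x' y' : hmap A' B')
  (a : glob x y) (a' : glob x' y') : Sq (gten a a') = Sq (a ⊠c a').
Proof. exact: cast_cellE. Qed.

Lemma cten_eq (A B A' B' E F E' F' : D) (x : hmap A B) (x' : hmap A' B')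
  (y : hmap E F) (y' : hmap E' F') (f f1 : Hom A A') (g g1 : Hom B B')
  (h h1 : Hom E E') (k k1 : Hom F F')
  (a : cell f g x x') (a1 : cell f1 g1 x x')
  (b : cell h k y y') (b1 : cell h1 k1 y y') :
  a ≡ a1 -> b ≡ b1 -> @cten D M _ _ _ _ _ _ _ _ _ _ _ _ _ _ _ _ a b ≡ a1 ⊠c b1.
Proof.
move=> p q.
by rewrite -[LHS]/(Sq (sqc (Sq a) ⊠c sqc (Sq b))) p q.
Qed.

Lemma ctenM (A B A' B' A'' B'' E F E' F' E'' F'' : D)
  (f' : Hom A' A'') (g' : Hom B' B'') (f : Hom A A') (g : Hom B B')
  (h' : Hom E' E'') (k' : Hom F' F'') (h : Hom E E') (k : Hom F F')
  (x : hmap A B) (x' : hmap A' B') (x'' : hmap A'' B'')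
  (y : hmap E F) (y' : hmap E' F') (y'' : hmap E'' F'')
  (a' : cell f' g' x' x'') (a : cell f g x x')
  (b' : cell h' k' y' y'') (b : cell h k y y') :
  @cten D M _ _ _ _ _ _ _ _ _ _ _ _ _ _ _ _ (a' • a) (b' • b) ≡
  (a' ⊠c b') • (a ⊠c b).
Proof.
exact: (@tmapM _ _ _ (laws1 M) (HOb x) (HOb x') (HOb x'') (HOb y) (HOb y')
  (HOb y'') (Sq a') (Sq a) (Sq b') (Sq b)).
Qed.

Lemma gtenM (A B A' B' : D) (x y z : hmap A B) (x' y' z' : hmap A' B')
  (b : glob y z) (a : glob x y) (b' : glob y' z') (a' : glob x' y') :
  gten (b ∙ a) (b' ∙ a') = gten b b' ∙ gten a a'.
Proof.
apply: Sq_inj; rewrite gcmpE !gtenE -sqE -ctenM.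
by apply: cten_eq; apply: gcmpE.
Qed.

Lemma gten1 (A B A' B' : D) (x : hmap A B) (x' : hmap A' B') :
  gten (g1 x) (g1 x') = g1 (x ⊠ x').
Proof.
apply: Sq_inj; rewrite gtenE.
exact: (@tmap1 _ _ _ (laws1 M) (HOb x) (HOb x')).
Qed.

Lemma gten_iso (A B A' B' : D) (x y : hmap A B) (x' y' : hmap A' B')
  (a : glob x y) (a' : glob x' y') :
  GlobIso a -> GlobIso a' -> GlobIso (gten a a').
Proof.
move=> [i /= ia ai] [j /= ja aj]; exists (gten i j) => /=.
- by rewrite -gtenM ia ja; apply: gten1.
- by rewrite -gtenM ai aj; apply: gten1.
Qed.

Lemma gxi_nat (A1 B1 E1 A2 B2 E2 : D)
  (y1 y1' : hmap B1 E1) (x1 x1' : hmap A1 B1)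
  (y2 y2' : hmap B2 E2) (x2 x2' : hmap A2 B2)
  (b1 : glob y1 y1') (a1 : glob x1 x1') (b2 : glob y2 y2') (a2 : glob x2 x2') :
  gcmp (xi M y1' x1' y2' x2') (gten (gh b1 a1) (gh b2 a2)) =
  gcmp (gh (gten b1 b2) (gten a1 a2)) (xi M y1 x1 y2 x2).
Proof.
apply: Sq_inj; rewrite !gcmpE gtenE -sqE xi_nat sqE; congr sq_cmp.
by symmetry; apply: chcmp_cast.
Qed.

Lemma gxi_assoc (A1 B1 E1 F1 A2 B2 E2 F2 : D)
  (z1 : hmap E1 F1) (y1 : hmap B1 E1) (x1 : hmap A1 B1)
  (z2 : hmap E2 F2) (y2 : hmap B2 E2) (x2 : hmap A2 B2) :
  gcmp (hassoc (z1 ⊠ z2) (y1 ⊠ y2) (x1 ⊠ x2))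
    (gh (xi M z1 y1 z2 y2) (g1 (x1 ⊠ x2))) ∙ xi M (z1 ⊙ y1) x1 (z2 ⊙ y2) x2 =
  gcmp (gh (g1 (z1 ⊠ z2)) (xi M y1 x1 y2 x2))
    (xi M z1 (y1 ⊙ x1) z2 (y2 ⊙ x2))
    ∙ gten (hassoc z1 y1 x1) (hassoc z2 y2 x2).
Proof. apply: Sq_inj; rewrite !gcmpE gtenE; exact: xi_assoc. Qed.

Lemma gxi_lunit (A1 B1 A2 B2 : D) (x1 : hmap A1 B1) (x2 : hmap A2 B2) :
  gcmp (hlunit (x1 ⊠ x2)) (gh (ups M B1 B2) (g1 (x1 ⊠ x2)))
    ∙ xi M (hid B1) x1 (hid B2) x2 = gten (hlunit x1) (hlunit x2).
Proof. apply: Sq_inj; rewrite !gcmpE gtenE; exact: xi_lunit. Qed.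

Lemma gxi_runit (A1 B1 A2 B2 : D) (x1 : hmap A1 B1) (x2 : hmap A2 B2) :
  gcmp (hrunit (x1 ⊠ x2)) (gh (g1 (x1 ⊠ x2)) (ups M A1 A2))
    ∙ xi M x1 (hid A1) x2 (hid A2) = gten (hrunit x1) (hrunit x2).
Proof. apply: Sq_inj; rewrite !gcmpE gtenE; exact: xi_runit. Qed.

(* The components of xi and upsilon that have to be invertible for a ⊠ b to be a
   monad; of these only the first two enter the monad structure. *)
Record Interchanging (A B : D) (a : MonadOn A) (b : MonadOn B) := {
  ich_xi : GlobIso (xi M a a b b);
  ich_ups : GlobIso (ups M A B);
  ich_xi3 : GlobIso (xi M (a ⊙ a) a (b ⊙ b) b);
  ich_xil : GlobIso (xi M (hid A) a (hid B) b);
  ich_xir : GlobIso (xi M a (hid A) b (hid B)) }.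

Definition ten_mu (A B : D) (a : MonadOn A) (b : MonadOn B)
  (H : Interchanging a b) :
  @glob D (A ⊠0[M] B) (A ⊠0[M] B) ((a ⊠ b) ⊙ (a ⊠ b)) (a ⊠ b) :=
  gcmp (gten (mmu a) (mmu b)) (ginv (ich_xi H)).

Definition ten_eta (A B : D) (a : MonadOn A) (b : MonadOn B)
  (H : Interchanging a b) :
  @glob D (A ⊠0[M] B) (A ⊠0[M] B) (hid (A ⊠0[M] B)) (a ⊠ b) :=
  gcmp (gten (meta a) (meta b)) (ginv (ich_ups H)).

Lemma ten_muK (A B : D) (a : MonadOn A) (b : MonadOn B)
  (H : Interchanging a b) : gcmp (ten_mu H) (xi M a a b b) = gten (mmu a) (mmu b).
Proof.
by rewrite /ten_mu -gcmpA ginvK gcmpm1.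
Qed.

Lemma ten_etaK (A B : D) (a : MonadOn A) (b : MonadOn B)
  (H : Interchanging a b) : gcmp (ten_eta H) (ups M A B) = gten (meta a) (meta b).
Proof.
by rewrite /ten_eta -gcmpA ginvK gcmpm1.
Qed.

Lemma ten_mu_xi (A B : D) (a : MonadOn A) (b : MonadOn B)
  (H : Interchanging a b) (y x : hmap A A) (y' x' : hmap B B)
  (c : glob y a) (d : glob x a) (c' : glob y' b) (d' : glob x' b) :
  gcmp (gcmp (ten_mu H) (gh (gten c c') (gten d d'))) (xi M y x y' x') =
  gten (gcmp (mmu a) (gh c d)) (gcmp (mmu b) (gh c' d')).
Proof. by rewrite -gcmpA -gxi_nat gcmpA ten_muK -gtenM. Qed.

Definition ten_on (A B : D) (a : MonadOn A) (b : MonadOn B)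
  (H : Interchanging a b) : MonadOn (A ⊠0[M] B).
Proof.
refine (@monad_of_glob D (A ⊠0[M] B) (a ⊠ b) (ten_mu H) (ten_eta H) _ _ _).
- apply: (giso_epi (gh_iso (ich_xi H) (g1_iso (a ⊠ b)))).
  apply: (giso_epi (ich_xi3 H)).
  rewrite -(gcmpA (ten_mu H)) -ghMl ten_muK -gten1 ten_mu_xi !gm_assoc.
  rewrite gten1 -!gcmpA (gcmpA (hassoc _ _ _)) gxi_assoc !gcmpA.
  rewrite -(gcmpA (ten_mu H)) -ghMr ten_muK -gten1 ten_mu_xi.
  by rewrite -gtenM.
- apply: (giso_epi (gh_iso (ich_ups H) (g1_iso (a ⊠ b)))).
  apply: (giso_epi (ich_xil H)).
  rewrite gxi_lunit -(gcmpA (ten_mu H)) -ghMl ten_etaK -gten1 ten_mu_xi.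
  by rewrite !gm_unitl.
- apply: (giso_epi (gh_iso (g1_iso (a ⊠ b)) (ich_ups H))).
  apply: (giso_epi (ich_xir H)).
  rewrite gxi_runit -(gcmpA (ten_mu H)) -ghMr ten_etaK -gten1 ten_mu_xi.
  by rewrite !gm_unitr.
Defined.

Lemma sq_epi (A B A' B' : D) (x y : hmap A B) (z : hmap A' B')
  (a : glob x y) (S T : square y z) :
  GlobIso a -> sq_cmp S (Sq a) = sq_cmp T (Sq a) -> S = T.
Proof.
move=> [i _ /= ai] e.
rewrite -[S](@cmpm1 (hcat D) (HOb y) (HOb z)).
rewrite -[T](@cmpm1 (hcat D) (HOb y) (HOb z)).
have -> : idm (HOb y : hcat D) = sq_cmp (Sq a) (Sq i) :> square y y.
  by rewrite -gcmpE /= ai.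
have /= A1 := @cmpA (hcat D) (HOb y) (HOb x) (HOb y) (HOb z).
by rewrite !A1 e.
Qed.

Lemma ten_muKS (A B : D) (a : MonadOn A) (b : MonadOn B)
  (H : Interchanging a b) :
  mmu (ten_on H) • xi M a a b b ≡ mmu a ⊠c mmu b.
Proof. by rewrite -gtenE -(ten_muK H) gcmpE. Qed.

Lemma ten_etaKS (A B : D) (a : MonadOn A) (b : MonadOn B)
  (H : Interchanging a b) :
  meta (ten_on H) • ups M A B ≡ meta a ⊠c meta b.
Proof. by rewrite -gtenE -(ten_etaK H) gcmpE. Qed.

Definition ten_map (X X' Y Y' : Monad D) (H : Interchanging X Y)
  (H' : Interchanging X' Y') (F : MonadMap X X') (G : MonadMap Y Y') :
  MonadMap (MkMonad (ten_on H)) (MkMonad (ten_on H')).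
Proof.
refine (@MkMonadMap D (MkMonad (ten_on H)) (MkMonad (ten_on H'))
  (tmap (ten0 M) (vmap F) (vmap G)) (mcell F ⊠c mcell G) _ _).
- apply: (sq_epi (ich_xi H)); rewrite -!sqE -!vcmpA.
  rewrite sqE ten_muKS [RHS]sqE -xi_nat -!sqE vcmpA [RHS]sqE ten_muKS.
  by rewrite -!sqE -!ctenM; apply: cten_eq; apply: mcell_mu.
- apply: (sq_epi (ich_ups H)); rewrite -!sqE -!vcmpA.
  rewrite sqE ten_etaKS [RHS]sqE -ups_nat -!sqE vcmpA [RHS]sqE ten_etaKS.
  by rewrite -!sqE -!ctenM; apply: cten_eq; apply: mcell_eta.
Defined.

Variable N : Normal M.

Lemma giso_conj (A B : D) (x y x' y' : hmap A B) (a : glob x y) (b : glob x' y')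
  (u : glob x x') (v : glob y y') :
  b ∙ u = v ∙ a -> GlobIso a -> GlobIso u -> GlobIso v -> GlobIso b.
Proof.
move=> e ia iu iv.
have -> : b = v ∙ a ∙ ginv iu.
  by rewrite -e -gcmpA gKinv gcmpm1.
apply: gcmp_iso; first exact: gcmp_iso.
by exists u; [apply: (cmp_inv iu) | apply: (inv_cmp iu)].
Qed.

Lemma interchanging_r (A B : D) (a : MonadOn A) :
  Interchanging a (discrete_on B).
Proof.
have i1 (E F : D) (x : hmap E F) := g1_iso x.
split; [exact: xi_iso_r N _ _ _ _ _ _ | exact: ups_iso N _ _ | |
  exact: xi_iso_r N _ _ _ _ _ _ | exact: xi_iso_r N _ _ _ _ _ _].
have il : GlobIso (ginv (hlunit_iso (hid B))).
  by exists (hlunit (hid B)); [apply: gKinv | apply: ginvK].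
apply: (giso_conj
  (gxi_nat (g1 (a ⊙ a)) (g1 a) (ginv (hlunit_iso (hid B))) (g1 (hid B)))).
- exact: xi_iso_r N _ _ _ _ _ _.
- by apply: gten_iso; apply: gh_iso.
- by apply: gh_iso; apply: gten_iso.
Defined.

Lemma interchanging_l (A B : D) (b : MonadOn B) :
  Interchanging (discrete_on A) b.
Proof.
have i1 (E F : D) (x : hmap E F) := g1_iso x.
split; [exact: xi_iso_l N _ _ _ _ _ _ | exact: ups_iso N _ _ | |
  exact: xi_iso_l N _ _ _ _ _ _ | exact: xi_iso_l N _ _ _ _ _ _].
have il : GlobIso (ginv (hlunit_iso (hid A))).
  by exists (hlunit (hid A)); [apply: gKinv | apply: ginvK].
apply: (giso_conj
  (gxi_nat (ginv (hlunit_iso (hid A))) (g1 (hid A)) (g1 (b ⊙ b)) (g1 b))).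
- exact: xi_iso_l N _ _ _ _ _ _.
- by apply: gten_iso; apply: gh_iso.
- by apply: gh_iso; apply: gten_iso.
Defined.

End MonadTensor.

Section NonCommutingTensor.
Variables (D : DoubleCategory) (M : OplaxMonoidal D) (N : Normal M).

Definition box_disc (X : Monad D) (B : D) : Monad D :=
  MkMonad (ten_on (interchanging_r N B X)).

Definition disc_box (A : D) (Y : Monad D) : Monad D :=
  MkMonad (ten_on (interchanging_l N A Y)).

Definition box_disc_map (X X' : Monad D) (B B' : D) (F : MonadMap X X')
  (g : Hom B B') : MonadMap (box_disc X B) (box_disc X' B') :=
  ten_map (Y := discrete B) (Y' := discrete B')
    (interchanging_r N B X) (interchanging_r N B' X') F (discrete_map g).

Definition disc_box_map (A A' : D) (Y Y' : Monad D) (f : Hom A A')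
  (G : MonadMap Y Y') : MonadMap (disc_box A Y) (disc_box A' Y') :=
  ten_map (X := discrete A) (X' := discrete A')
    (interchanging_l N A Y) (interchanging_l N A' Y') (discrete_map f) G.

Variable P : forall A : D, FiniteCoproducts (MndOn A).

Definition nc_summand (X Y : Monad D) (i : bool) :
  MndOn (mbase X ⊠0[M] mbase Y) :=
  if i then mstr (box_disc X (mbase Y)) else mstr (disc_box (mbase X) Y).

Definition nc_coproduct (X Y : Monad D) : Coproduct (nc_summand X Y) :=
  P (nc_summand X Y).

Definition nc_tensor (X Y : Monad D) : Monad D := MkMonad (cop (nc_coproduct X Y)).

Definition nc_inl (X Y : Monad D) :
  MonadMap (box_disc X (mbase Y)) (nc_tensor X Y) :=
  sval (inj (nc_coproduct X Y) true).

Definition nc_inr (X Y : Monad D) :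
  MonadMap (disc_box (mbase X) Y) (nc_tensor X Y) :=
  sval (inj (nc_coproduct X Y) false).

(* The action of the tensor product on monad maps (f, phi) and (g, psi) is the
   map over f ⊠ g induced on coproducts; in the presence of cartesian lifts this
   determines it uniquely. *)
Definition is_nc_action (T : forall X X' Y Y' : Mnd D,
    Hom X X' -> Hom Y Y' -> @Hom (Mnd D) (nc_tensor X Y) (nc_tensor X' Y')) :
    Prop :=
  forall (X X' Y Y' : Mnd D) (F : Hom X X') (G : Hom Y Y'),
    @cmp (Mnd D) _ _ _ (T X X' Y Y' F G) (nc_inl X Y) =
      @cmp (Mnd D) _ _ _ (nc_inl X' Y') (box_disc_map F (vmap G)) /\
    @cmp (Mnd D) _ _ _ (T X X' Y Y' F G) (nc_inr X Y) =
      @cmp (Mnd D) _ _ _ (nc_inr X' Y') (disc_box_map (vmap F) G).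

End NonCommutingTensor.

(* Main.v *)
(** A monad map X □ Y → Z over f amounts to monad maps X ⊠ Δ_B → Z and
    Δ_A ⊠ Y → Z over f: cartesian lifts of monads reduce this to the universal
    property of the coproduct in the fibre. Since - ⊠ id_B is, by normality, a
    pseudo double functor with a right adjoint, - ⊠ Δ_B has a right adjoint on
    monads, and so preserves this presentation. Hence maps out of (X □ Y) □ Z are
    given by three components, on (X ⊠ Δ_B) ⊠ Δ_C, (Δ_A ⊠ Y) ⊠ Δ_C and
    (Δ_A ⊠ Δ_B) ⊠ Z, and likewise for more factors. On each component the
    constraints of □ restrict to those of ⊠ on C_1, whence the coherence axioms.

    For closedness, tabulators and equalisers represent A ↦ {monad maps
    Δ_A ⊠ Y → Z} by an object E over the internal hom ⟨B, C⟩ of the bases, and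
    the internal hom of Y and Z is the restriction of the monad ⟨Δ_B, Z⟩ along
    E → ⟨B, C⟩. *)

(* The universal property of [□] applies only to pairs of maps with equal vertical parts, so every
   gluing below must show that its pieces lie over one vertical map; this is read off by taking
   boundaries in C_1. Equations are compared in C_1 because the loop of an iterated tensor product
   with discrete monads is literally a tensor product there, so the monoidal laws of C_1 apply to it
   at once. Two mismatches recur. [Δ_A ⊠ Δ_B] is only isomorphic, through [υ], to the discrete monad
   on [A ⊠ B], which is why [υ] enters the components of triple tensor products; and the unit [I_1]
   of C_1 differs by [ι] from the loop [id_I] of [Δ_I]. Cartesian lifts of monads and homs out of
   discrete monads come from one construction: given an oplax endofunctor [T], a universal cell
   [T h → z] transports a monad structure from [z] to [h]. Working with oplax rather than pseudo
   functors keeps inverses of [ξ] out of it; normality then identifies the maps so obtained with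
   monad maps out of [X ⊠ Δ_B]. *)
From mathcomp Require Import all_boot.
From Stdlib Require Import ProofIrrelevance IndefiniteDescription.
Require Import Defs.

Set Implicit Arguments.
Unset Strict Implicit.
Unset Printing Implicit Defensive.

Local Open Scope dbl_scope.

(** * Adjunctions, isomorphisms and tensor products *)

Section Adjunctions.
Variables (C D : Category) (F : Functor C D).

(** The form in which adjunctions are used: one object [d] at a time, as a universal arrow. The
    given right adjoints are read in this form, and the internal homs are built in it. *)
Definition has_counit (d : D) (g : C) (e : Hom (F g) d) : Prop :=
  forall c (f : Hom (F c) d), exists! h : Hom c g, e ∘ fmap F h = f.

Lemma adjoint_counit (G : D -> C) (eps : forall d, Hom (F (G d)) d)
  (R : RightAdjoint eps) (d : D) : has_counit (eps d).
Proof.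
move=> c f; exists (gmap R f ∘ unit_adj R c); split.
  by rewrite fmapM cmpA counit_nat -cmpA triangle_left cmpm1.
move=> h <-; rewrite gmapM -cmpA -unit_nat cmpA triangle_right.
by rewrite cmp1m.
Qed.

Definition universal_map (d : D) (g : C) (e : Hom (F g) d) (u : has_counit e)
  (c : C) (f : Hom (F c) d) : Hom c g :=
  sval (constructive_indefinite_description _ (u c f)).

Lemma universal_mapK (d : D) (g : C) (e : Hom (F g) d) (u : has_counit e)
  (c : C) (f : Hom (F c) d) : e ∘ fmap F (universal_map u f) = f.
Proof.
by rewrite /universal_map; case: constructive_indefinite_description => h [].
Qed.

Lemma counit_inj (d : D) (g : C) (e : Hom (F g) d) (c : C) (h k : Hom c g) :
  has_counit e -> e ∘ fmap F h = e ∘ fmap F k -> h = k.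
Proof. by move=> u; case: (u c (e ∘ fmap F k)) => l [_ l_uniq] /l_uniq <-;
  apply: l_uniq. Qed.

Lemma counit_adjoint (G : D -> C) (eps : forall d, Hom (F (G d)) d) :
  (forall d, has_counit (eps d)) -> RightAdjoint eps.
Proof.
move=> u.
pose gm d d' (f : Hom d d') := universal_map (u d') (f ∘ eps d).
have gmE d d' (f : Hom d d') : eps d' ∘ fmap F (gm _ _ f) = f ∘ eps d.
  exact: universal_mapK.
pose un c := universal_map (u (F c)) (idm (F c)).
have unE c : eps (F c) ∘ fmap F (un c) = idm (F c) by apply: universal_mapK.
apply: (@MkRightAdjoint C D F G eps gm _ _ un) => //.
- by move=> d; apply: (counit_inj (u d)); rewrite gmE fmap1 cmp1m cmpm1.
- move=> d d' d'' g f; apply: (counit_inj (u d'')).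
  by rewrite fmapM cmpA !gmE -!cmpA gmE.
- move=> c c' f; apply: (counit_inj (u (F c'))).
  by rewrite !fmapM !cmpA unE gmE -cmpA unE cmp1m cmpm1.
- move=> d; apply: (counit_inj (u d)).
  by rewrite fmapM cmpA gmE fmap1 -cmpA unE.
Qed.

End Adjunctions.

Lemma iso_epi (C : Category) (A B E : C) (f : Hom A B) (g h : Hom B E) :
  IsIso f -> g ∘ f = h ∘ f -> g = h.
Proof.
move=> [i _ fi] e; rewrite -[g]cmpm1 -[h]cmpm1 -fi !cmpA.
by rewrite e.
Qed.

Lemma iso_mono (C : Category) (A B E : C) (f : Hom B E) (g h : Hom A B) :
  IsIso f -> f ∘ g = f ∘ h -> g = h.
Proof. by move=> [i fi _] e; rewrite -[g]cmp1m -[h]cmp1m -fi -!cmpA e. Qed.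

Lemma iso_cmp (C : Category) (A B E : C) (g : Hom B E) (f : Hom A B) :
  IsIso g -> IsIso f -> IsIso (g ∘ f).
Proof.
move=> [i gi ig] [j fj jf]; exists (j ∘ i).
  by rewrite cmpA -(cmpA j) gi cmpm1.
by rewrite cmpA -(cmpA g) jf cmpm1.
Qed.

Lemma iso_cancel_r (C : Category) (A B E : C) (g : Hom B E) (f : Hom A B)
  (h : Hom A E) : g ∘ f = h -> IsIso f -> IsIso h -> IsIso g.
Proof.
move=> gfh [j fj jf] [i hi ih].
have -> : g = h ∘ j by rewrite -gfh -cmpA jf cmpm1.
by apply: iso_cmp; [exists i | exists f].
Qed.

Lemma iso_idm (C : Category) (A : C) : IsIso (idm A).
Proof. by exists (idm A); rewrite cmp1m. Qed.

Section MonoidalGeneralities.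
Variables (C : Category) (T : Tensor C) (K : Constraints T)
  (L : MonoidalLaws K).
Local Notation "A ⊗ B" := (tob T A B) (at level 38, left associativity).
Local Notation "f ⊗m g" := (tmap T f g) (at level 38, left associativity).

Lemma tmap_iso (A A' B B' : C) (f : Hom A A') (g : Hom B B') :
  IsIso f -> IsIso g -> IsIso (f ⊗m g).
Proof.
move=> [i fi ji] [j fj jj]; exists (i ⊗m j).
  by rewrite -(tmapM L) fi fj (tmap1 L).
by rewrite -(tmapM L) ji jj (tmap1 L).
Qed.

Lemma tmapE (A A' B B' : C) (f : Hom A A') (g : Hom B B') :
  f ⊗m g = (f ⊗m idm B') ∘ (idm A ⊗m g).
Proof. by rewrite -(tmapM L) cmp1m cmpm1. Qed.

Lemma tmapMl (A A' A'' B : C) (g : Hom A' A'') (f : Hom A A') :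
  (g ∘ f) ⊗m idm B = (g ⊗m idm B) ∘ (f ⊗m idm B).
Proof. by rewrite -(tmapM L) cmp1m. Qed.

Lemma tmapMr (A B B' B'' : C) (g : Hom B' B'') (f : Hom B B') :
  idm A ⊗m (g ∘ f) = (idm A ⊗m g) ∘ (idm A ⊗m f).
Proof. by rewrite -(tmapM L) cmp1m. Qed.

(* Associators of a tensor product are compared with those of T along maps j
   out of T-products; on these the pentagon holds because it does in T. *)
Lemma pentagon_on (p q r s PQ QR RS PQ_R P_QR QR_S Q_RS X1 X2 X3 X4 X5 : C)
  (jpq : Hom (p ⊗ q) PQ) (jqr : Hom (q ⊗ r) QR) (jrs : Hom (r ⊗ s) RS)
  (j1 : Hom (PQ ⊗ r) PQ_R) (j2 : Hom (p ⊗ QR) P_QR)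
  (j3 : Hom (QR ⊗ s) QR_S) (j4 : Hom (q ⊗ RS) Q_RS)
  (k1 : Hom (PQ_R ⊗ s) X1) (k2 : Hom (P_QR ⊗ s) X2) (k3 : Hom (p ⊗ QR_S) X3)
  (k4 : Hom (p ⊗ Q_RS) X4) (k5 : Hom (PQ ⊗ RS) X5)
  (a1 : Hom PQ_R P_QR) (a4 : Hom QR_S Q_RS) (A1 : Hom X1 X5) (A2 : Hom X5 X4)
  (A3 : Hom X2 X3) (b : Hom X1 X2) (c : Hom X3 X4) :
  a1 ∘ (j1 ∘ (jpq ⊗m idm r)) = j2 ∘ (idm p ⊗m jqr) ∘ tassoc K p q r ->
  a4 ∘ (j3 ∘ (jqr ⊗m idm s)) = j4 ∘ (idm q ⊗m jrs) ∘ tassoc K q r s ->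
  A1 ∘ (k1 ∘ (j1 ⊗m idm s)) = k5 ∘ (idm PQ ⊗m jrs) ∘ tassoc K PQ r s ->
  A2 ∘ (k5 ∘ (jpq ⊗m idm RS)) = k4 ∘ (idm p ⊗m j4) ∘ tassoc K p q RS ->
  A3 ∘ (k2 ∘ (j2 ⊗m idm s)) = k3 ∘ (idm p ⊗m j3) ∘ tassoc K p QR s ->
  b ∘ k1 = k2 ∘ (a1 ⊗m idm s) -> c ∘ k3 = k4 ∘ (idm p ⊗m a4) ->
  A2 ∘ A1 ∘ (k1 ∘ ((j1 ∘ (jpq ⊗m idm r)) ⊗m idm s)) =
  c ∘ A3 ∘ b ∘ (k1 ∘ ((j1 ∘ (jpq ⊗m idm r)) ⊗m idm s)).
Proof.
move=> ea1 ea4 eA1 eA2 eA3 eb ec.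
transitivity (k4 ∘ (idm p ⊗m (j4 ∘ (idm q ⊗m jrs))) ∘ tassoc K p q (r ⊗ s)
    ∘ tassoc K (p ⊗ q) r s).
  rewrite tmapMl !cmpA -(cmpA A2 A1) -(cmpA A2 _ (j1 ⊗m _)) -(cmpA A1 k1) eA1.
  rewrite -(cmpA A2) -(cmpA _ (tassoc _ _ _ _)) (tassoc_nat L) (tmap1 L).
  rewrite !cmpA -(cmpA (A2 ∘ k5)) -(tmapM L) cmp1m cmpm1 (tmapE jpq) !cmpA.
  rewrite -(cmpA A2 k5) eA2 -!cmpA; congr (_ ∘ _).
  rewrite tmapMr -!cmpA; congr (_ ∘ _).
  by rewrite !cmpA -(tmap1 L) (tassoc_nat L).
transitivity (k4 ∘ (idm p ⊗m (a4 ∘ (j3 ∘ (jqr ⊗m idm s))))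
    ∘ tassoc K p (q ⊗ r) s ∘ (tassoc K p q r ⊗m idm s)).
  rewrite ea4 !tmapMr -!cmpA; do 3!congr (_ ∘ _).
  by rewrite cmpA (tpentagon L).
rewrite -!cmpA (cmpA b) eb !cmpA -(cmpA (c ∘ A3 ∘ k2)) -(tmapM L) cmp1m ea1.
rewrite !tmapMl !cmpA -(cmpA (c ∘ A3)) -(cmpA c A3) eA3 !cmpA ec.
by rewrite -(cmpA _ (tassoc K p QR s)) (tassoc_nat L) !tmapMr !cmpA.
Qed.

(** Naturality of an associator on one component. The objects and the maps [j] stay free so that one
    computation serves all three components of a triple tensor product. *)
Lemma assoc_nat_on (p q r p' q' r' PQ QR PQ' QR' X1 X2 X1' X2' : C)
  (f : Hom p p') (g : Hom q q') (h : Hom r r')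
  (jpq : Hom (p ⊗ q) PQ) (jqr : Hom (q ⊗ r) QR)
  (j1 : Hom (PQ ⊗ r) X1) (j2 : Hom (p ⊗ QR) X2)
  (jpq' : Hom (p' ⊗ q') PQ') (jqr' : Hom (q' ⊗ r') QR')
  (j1' : Hom (PQ' ⊗ r') X1') (j2' : Hom (p' ⊗ QR') X2')
  (a : Hom X1 X2) (a' : Hom X1' X2') (F12 : Hom PQ PQ') (F23 : Hom QR QR')
  (F1 : Hom X1 X1') (F2 : Hom X2 X2') :
  a ∘ (j1 ∘ (jpq ⊗m idm r)) = j2 ∘ (idm p ⊗m jqr) ∘ tassoc K p q r ->
  a' ∘ (j1' ∘ (jpq' ⊗m idm r')) = j2' ∘ (idm p' ⊗m jqr') ∘ tassoc K p' q' r' ->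
  F12 ∘ jpq = jpq' ∘ (f ⊗m g) -> F1 ∘ j1 = j1' ∘ (F12 ⊗m h) ->
  F23 ∘ jqr = jqr' ∘ (g ⊗m h) -> F2 ∘ j2 = j2' ∘ (f ⊗m F23) ->
  a' ∘ F1 ∘ (j1 ∘ (jpq ⊗m idm r)) = F2 ∘ a ∘ (j1 ∘ (jpq ⊗m idm r)).
Proof.
move=> ea ea' e12 e1 e23 e2; rewrite -(cmpA F2) ea !cmpA e2.
rewrite -(cmpA j2') -(tmapM L) cmpm1 e23 -(cmpA a') e1.
rewrite -!cmpA -(tmapM L) e12 cmpm1 -[h]cmp1m (tmapM L) cmp1m.
rewrite (cmpA j1') (cmpA a') ea' -!cmpA (tassoc_nat L).
by rewrite (cmpA (idm p' ⊗m _)) -(tmapM L) cmp1m.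
Qed.

(** The map [u] compares the unit of [T] with the object [i] that occurs as a factor, [I_1] and
    [id_I] in the application; after precomposition with it the triangle of [T] is available. *)
Lemma triangle_on (p i q PI IQ PQ X1 X2 : C) (u : Hom (tunit T) i)
  (jpi : Hom (p ⊗ i) PI) (jiq : Hom (i ⊗ q) IQ) (j : Hom (p ⊗ q) PQ)
  (j1 : Hom (PI ⊗ q) X1) (j2 : Hom (p ⊗ IQ) X2) (a : Hom X1 X2)
  (r : Hom PI p) (l : Hom IQ q) (R : Hom X1 PQ) (S : Hom X2 PQ) :
  a ∘ (j1 ∘ (jpi ⊗m idm q)) = j2 ∘ (idm p ⊗m jiq) ∘ tassoc K p i q ->
  r ∘ (jpi ∘ (idm p ⊗m u)) = trunit K p ->
  l ∘ (jiq ∘ (u ⊗m idm q)) = tlunit K q ->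
  R ∘ j1 = j ∘ (r ⊗m idm q) -> S ∘ j2 = j ∘ (idm p ⊗m l) ->
  S ∘ a ∘ (j1 ∘ ((jpi ∘ (idm p ⊗m u)) ⊗m idm q)) =
  R ∘ (j1 ∘ ((jpi ∘ (idm p ⊗m u)) ⊗m idm q)).
Proof.
move=> ea er el eR eS.
rewrite (cmpA R) eR -(cmpA j) -tmapMl er -(ttriangle L).
rewrite tmapMl (cmpA j1) (cmpA _ _ (_ ⊗m _ ⊗m _)) -(cmpA S) ea.
rewrite !cmpA eS -!cmpA (tassoc_nat L); congr (_ ∘ _).
by rewrite !cmpA -!tmapMr -cmpA el.
Qed.

Lemma assoc_mult (p q r p2 q2 r2 PQ2 QR2 L2 R2 : C)
  (mp : Hom p2 p) (mq : Hom q2 q) (mr : Hom r2 r)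
  (xpq : Hom (p2 ⊗ q2) PQ2) (xqr : Hom (q2 ⊗ r2) QR2)
  (mpq : Hom PQ2 (p ⊗ q)) (mqr : Hom QR2 (q ⊗ r))
  (x1 : Hom (PQ2 ⊗ r2) L2) (x2 : Hom (p2 ⊗ QR2) R2)
  (m2 : Hom R2 (p ⊗ (q ⊗ r))) (aa : Hom L2 R2) :
  mpq ∘ xpq = mp ⊗m mq -> mqr ∘ xqr = mq ⊗m mr -> m2 ∘ x2 = mp ⊗m mqr ->
  aa ∘ x1 ∘ (xpq ⊗m idm r2) = x2 ∘ (idm p2 ⊗m xqr) ∘ tassoc K p2 q2 r2 ->
  IsIso xpq -> tassoc K p q r ∘ (mpq ⊗m mr) = m2 ∘ (aa ∘ x1).
Proof.
move=> epq eqr e2 ea xpq_iso.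
apply: (iso_epi (tmap_iso xpq_iso (iso_idm r2))).
rewrite -!cmpA (cmpA aa) ea -(tmapM L) cmpm1 epq (tassoc_nat L).
by rewrite !cmpA e2 -(tmapM L) cmpm1 eqr.
Qed.

Lemma lunit_mult (p p2 i i2 : C) (u : Hom (tunit T) i) (w : Hom (tunit T) i2)
  (mi : Hom i2 i) (mp : Hom p2 p) (l : Hom (i ⊗ p) p) (y : Hom (i2 ⊗ p2) p2) :
  l ∘ (u ⊗m idm p) = tlunit K p -> mi ∘ w = u ->
  y ∘ (w ⊗m idm p2) = tlunit K p2 -> IsIso w -> l ∘ (mi ⊗m mp) = mp ∘ y.
Proof.
move=> el ew ey w_iso.
apply: (iso_epi (tmap_iso w_iso (iso_idm p2))).
rewrite -!cmpA ey -(tmapM L) ew cmpm1 -(tlunit_nat L) -el -cmpA -(tmapM L).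
by rewrite cmpm1 cmp1m.
Qed.

Lemma runit_mult (p p2 i i2 : C) (u : Hom (tunit T) i) (w : Hom (tunit T) i2)
  (mi : Hom i2 i) (mp : Hom p2 p) (r : Hom (p ⊗ i) p) (y : Hom (p2 ⊗ i2) p2) :
  r ∘ (idm p ⊗m u) = trunit K p -> mi ∘ w = u ->
  y ∘ (idm p2 ⊗m w) = trunit K p2 -> IsIso w -> r ∘ (mp ⊗m mi) = mp ∘ y.
Proof.
move=> er ew ey w_iso.
apply: (iso_epi (tmap_iso (iso_idm p2) w_iso)).
rewrite -!cmpA ey -(tmapM L) ew cmpm1 -(trunit_nat L) -er -cmpA -(tmapM L).
by rewrite cmpm1 cmp1m.
Qed.

(** Here [l] stands for the inverse unitor [id_B → id_B ∘ id_B] and [x] for [ξ]. This lemma and the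
    next two are the naturality, associativity and unit laws of their composite, which is how
    [- ⊠ id_B] compares composites. *)
Lemma comul_nat (p p' q q2 X X' : C) (l : Hom q q2) (x : Hom (p ⊗ q2) X)
  (x' : Hom (p' ⊗ q2) X') (f : Hom p p') (g : Hom X X') :
  x' ∘ (f ⊗m idm q2) = g ∘ x ->
  x' ∘ (idm p' ⊗m l) ∘ (f ⊗m idm q) = g ∘ (x ∘ (idm p ⊗m l)).
Proof.
by move=> e; rewrite cmpA -e -!cmpA -!(tmapM L) !cmp1m !cmpm1.
Qed.

Lemma comul_assoc (p1 p2 q q2 q3l q3r R1 R2 R1' R2' S1 S2 : C)
  (h : Hom p1 p2) (l : Hom q q2) (l1 : Hom q2 q3l) (l2 : Hom q2 q3r)
  (hq : Hom q3l q3r) (u : Hom (p1 ⊗ q2) R1) (u' : Hom (p1 ⊗ q3l) R2)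
  (s1 : Hom R1 R2) (w : Hom (p2 ⊗ q2) R1') (w' : Hom (p2 ⊗ q3r) R2')
  (s2 : Hom R1' R2') (c1 : Hom R2 S1) (c2 : Hom R2' S2) (H : Hom S1 S2) :
  hq ∘ (l1 ∘ l) = l2 ∘ l -> u' ∘ (idm p1 ⊗m l1) = s1 ∘ u ->
  w' ∘ (idm p2 ⊗m l2) = s2 ∘ w -> H ∘ c1 ∘ u' = c2 ∘ w' ∘ (h ⊗m hq) ->
  H ∘ (c1 ∘ s1 ∘ (u ∘ (idm p1 ⊗m l))) =
  c2 ∘ s2 ∘ (w ∘ (idm p2 ⊗m l)) ∘ (h ⊗m idm q).
Proof.
move=> el eu ew e.
rewrite -(cmpA c1) (cmpA s1) -eu -(cmpA c2) (cmpA s2) -ew !cmpA e.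
rewrite -!cmpA -!(tmapM L) !cmp1m !cmpm1 el.
by [].
Qed.

Lemma comul_unit (p p' q q2 X : C) (l : Hom q q2) (k : Hom q2 q)
  (h : Hom p p') (x : Hom (p ⊗ q2) X) (y : Hom X (p' ⊗ q)) :
  y ∘ x = h ⊗m k -> k ∘ l = idm q -> y ∘ (x ∘ (idm p ⊗m l)) = h ⊗m idm q.
Proof. by move=> e el; rewrite cmpA e -(tmapM L) el cmpm1. Qed.

(** The multiplication [k] of a discrete monad is invertible, so in a multiplicativity law it can be
    moved to the other side, where its inverse [l] becomes part of the comparison of composites. *)
Lemma counit_transfer (p2 p q2 q X Y Z : C) (m : Hom p2 p) (k : Hom q2 q)
  (l : Hom q q2) (a : Hom (p ⊗ q) Z) (x : Hom (p2 ⊗ q2) X) (s : Hom X Y)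
  (r : Hom Y Z) :
  k ∘ l = idm q -> l ∘ k = idm q2 ->
  (a ∘ (m ⊗m k) = r ∘ (s ∘ x)) <->
  (a ∘ (m ⊗m idm q) = r ∘ (s ∘ (x ∘ (idm p2 ⊗m l)))).
Proof.
move=> kl lk; split=> e.
  by rewrite 2!cmpA -(cmpA r) -e -cmpA -(tmapM L) kl cmpm1.
transitivity (a ∘ (m ⊗m idm q) ∘ (idm p2 ⊗m k)).
  by rewrite -cmpA -(tmapM L) cmp1m cmpm1.
by rewrite e -!cmpA -(tmapM L) cmp1m lk (tmap1 L) cmpm1.
Qed.

Lemma counit_transfer_l (p2 p q2 q X Y Z : C) (m : Hom p2 p) (k : Hom q2 q)
  (l : Hom q q2) (a : Hom (q ⊗ p) Z) (x : Hom (q2 ⊗ p2) X) (s : Hom X Y)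
  (r : Hom Y Z) :
  k ∘ l = idm q -> l ∘ k = idm q2 ->
  (a ∘ (k ⊗m m) = r ∘ (s ∘ x)) <->
  (a ∘ (idm q ⊗m m) = r ∘ (s ∘ (x ∘ (l ⊗m idm p2)))).
Proof.
move=> kl lk; split=> e.
  by rewrite 2!cmpA -(cmpA r) -e -cmpA -(tmapM L) kl cmpm1.
transitivity (a ∘ (idm q ⊗m m) ∘ (k ⊗m idm p2)).
  by rewrite -cmpA -(tmapM L) cmp1m cmpm1.
by rewrite e -!cmpA -(tmapM L) cmp1m lk (tmap1 L) cmpm1.
Qed.

Variables (s : Braiding T) (LS : SymmetryLaws K s).

Lemma braid_mult (p q p2 q2 PQ2 QP2 : C) (mp : Hom p2 p) (mq : Hom q2 q)
  (x : Hom (p2 ⊗ q2) PQ2) (x' : Hom (q2 ⊗ p2) QP2) (m' : Hom QP2 (q ⊗ p))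
  (bb : Hom PQ2 QP2) :
  m' ∘ x' = mq ⊗m mp -> bb ∘ x = x' ∘ s p2 q2 ->
  s p q ∘ (mp ⊗m mq) = m' ∘ (bb ∘ x).
Proof. by move=> e eb; rewrite eb cmpA e (braid_nat LS). Qed.

Lemma hexagon_on (p q r PQ QR RP QP PR X1 X2 X3 X4 X5 X6 : C)
  (jpq : Hom (p ⊗ q) PQ) (jqr : Hom (q ⊗ r) QR) (jrp : Hom (r ⊗ p) RP)
  (jqp : Hom (q ⊗ p) QP) (jpr : Hom (p ⊗ r) PR)
  (j1 : Hom (PQ ⊗ r) X1) (j2 : Hom (p ⊗ QR) X2) (j3 : Hom (QR ⊗ p) X3)
  (j4 : Hom (q ⊗ RP) X4) (j5 : Hom (QP ⊗ r) X5) (j6 : Hom (q ⊗ PR) X6)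
  (a1 : Hom X1 X2) (b1 : Hom X2 X3) (a2 : Hom X3 X4) (b2 : Hom PQ QP)
  (B2 : Hom X1 X5) (a3 : Hom X5 X6) (b3 : Hom PR RP) (B3 : Hom X6 X4) :
  a1 ∘ (j1 ∘ (jpq ⊗m idm r)) = j2 ∘ (idm p ⊗m jqr) ∘ tassoc K p q r ->
  b1 ∘ j2 = j3 ∘ s p QR ->
  a2 ∘ (j3 ∘ (jqr ⊗m idm p)) = j4 ∘ (idm q ⊗m jrp) ∘ tassoc K q r p ->
  b2 ∘ jpq = jqp ∘ s p q -> B2 ∘ j1 = j5 ∘ (b2 ⊗m idm r) ->
  a3 ∘ (j5 ∘ (jqp ⊗m idm r)) = j6 ∘ (idm q ⊗m jpr) ∘ tassoc K q p r ->
  b3 ∘ jpr = jrp ∘ s p r -> B3 ∘ j6 = j4 ∘ (idm q ⊗m b3) ->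
  a2 ∘ b1 ∘ a1 ∘ (j1 ∘ (jpq ⊗m idm r)) = B3 ∘ a3 ∘ B2 ∘ (j1 ∘ (jpq ⊗m idm r)).
Proof.
move=> ea1 eb1 ea2 eb2 eB2 ea3 eb3 eB3.
transitivity (j4 ∘ (idm q ⊗m jrp) ∘
   (tassoc K q r p ∘ s p (q ⊗ r) ∘ tassoc K p q r)).
  rewrite -(cmpA (a2 ∘ b1)) ea1 !cmpA -(cmpA a2 b1) eb1 !cmpA.
  by rewrite -(cmpA _ (s _ _)) (braid_nat LS) !cmpA -(cmpA a2) ea2 ?cmpA.
rewrite (braid_hexagon LS) -(cmpA _ B2) (cmpA B2) eB2 -(cmpA j5) -tmapMl eb2.
rewrite tmapMl (cmpA j5) !cmpA -(cmpA (B3 ∘ a3)) -(cmpA B3 a3) ea3 !cmpA eB3.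
rewrite -!(cmpA j4) -!tmapMr eb3.
by rewrite !cmpA.
Qed.

End MonoidalGeneralities.

(** * Squares and monad maps *)

Section Squares.
Variable D : DoubleCategory.
Local Notation disc A := (HOb (hid A) : hcat D).
Local Notation loop X := (HOb (mloop X) : hcat D).

(** A 2-morphism seen as a map of C_1: equations between cells whose boundaries agree only provably
    become equations in a category. *)
Definition sq (A B A' B' : D) (f : Hom A A') (g : Hom B B') (x : hmap A B)
  (y : hmap A' B') (a : cell f g x y) : @Hom (hcat D) (HOb x) (HOb y) := Sq a.

Lemma sq_cmpE (A B A' B' A'' B'' : D) (x : hmap A B) (y : hmap A' B')
  (z : hmap A'' B'') (f' : Hom A' A'') (g' : Hom B' B'') (f : Hom A A')
  (g : Hom B B') (b : cell f' g' y z) (a : cell f g x y) :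
  sq (b • a) = sq b ∘ sq a.
Proof. by []. Qed.

Lemma sq_gcmp (A B : D) (x y z : hmap A B) (b : glob y z) (a : glob x y) :
  sq (gcmp b a) = sq b ∘ sq a.
Proof. exact: gcmpE. Qed.

Lemma sq_iso (A B : D) (x y : hmap A B) (a : glob x y) :
  GlobIso a -> IsIso (sq a).
Proof.
move=> [i ia ai]; exists (sq (i : glob y x)).
  by rewrite -sq_gcmp; congr (Sq _); apply: ia.
by rewrite -sq_gcmp; congr (Sq _); apply: ai.
Qed.

(** Replaces rewriting under [⋆], which the boundaries in the types obstruct: an equation in C_1
    also identifies the boundaries, and once these are eliminated the cells are equal. *)
Lemma sq_hcmp (A B E A' B' E' : D) (y : hmap B E) (y' : hmap B' E')
  (x : hmap A B) (x' : hmap A' B') (f f1 : Hom A A') (g g1 : Hom B B')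
  (h h1 : Hom E E') (b : cell g h y y') (a : cell f g x x')
  (b1 : cell g1 h1 y y') (a1 : cell f1 g1 x x') :
  sq b = sq b1 -> sq a = sq a1 -> sq (b ⋆ a) = sq (b1 ⋆ a1).
Proof.
move=> eb ea.
have eg : g = g1 by rewrite -[g]/(lft (sq b)) eb.
have eh : h = h1 by rewrite -[h]/(rgt (sq b)) eb.
have ef : f = f1 by rewrite -[f]/(lft (sq a)) ea.
case: _ / eg in b1 a1 eb ea *; case: _ / eh in b1 eb *; case: _ / ef in a1 ea *.
by rewrite (Sq_inj eb) (Sq_inj ea).
Qed.

Lemma sq_hcmpM (A B E A' B' E' A'' B'' E'' : D)
      (f : Hom A A') (g : Hom B B') (h : Hom E E')
      (f' : Hom A' A'') (g' : Hom B' B'') (h' : Hom E' E'')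
      (y : hmap B E) (y' : hmap B' E') (y'' : hmap B'' E'')
      (x : hmap A B) (x' : hmap A' B') (x'' : hmap A'' B'')
      (b' : cell g' h' y' y'') (b : cell g h y y')
      (a' : cell f' g' x' x'') (a : cell f g x x') :
  sq ((b' • b) ⋆ (a' • a)) = sq (b' ⋆ a') ∘ sq (b ⋆ a).
Proof. by rewrite chcmpM. Qed.

Lemma sq_vid (A B : D) (x : hmap A B) : sq (vid x) = idm (HOb x : hcat D).
Proof. by []. Qed.

(** Monad maps require one vertical map on both sides; this supplies it when the two boundaries are
    provably equal. *)
Lemma sq_diagonal (A A' : D) (x : hmap A A) (y : hmap A' A')
  (S : @Hom (hcat D) (HOb x) (HOb y)) :
  lft S = rgt S -> exists (f : Hom A A') (a : cell f f x y), sq a = S.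
Proof. by case: S => f g a /= e; case: _ / e in a *; exists f, a. Qed.

Definition chid_sq (A B : D) (f : Hom A B) :
  @Hom (hcat D) (disc A) (disc B) := Sq (chid f).

Lemma chid_sq1 (A : D) : chid_sq (idm A) = idm (disc A).
Proof. by rewrite /chid_sq chid1. Qed.

Lemma chid_sqM (A B C : D) (g : Hom B C) (f : Hom A B) :
  chid_sq (g ∘ f) = chid_sq g ∘ chid_sq f.
Proof. by rewrite /chid_sq chidM. Qed.

Definition mon_mul (X : Monad D) : @Hom (hcat D) (HOb (mloop X ⊙ mloop X))
  (loop X) :=
  Sq (mmu X).

Definition mon_one (X : Monad D) : @Hom (hcat D) (disc (mbase X)) (loop X) :=
  Sq (meta X).

Lemma mon_assoc (X : Monad D) :
  mon_mul X ∘ sq (mmu X ⋆ vid X) =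
  mon_mul X ∘ (sq (vid X ⋆ mmu X) ∘ sq (hassoc X X X)).
Proof. by rewrite cmpA; exact: m_assoc. Qed.

Lemma mon_unitl (X : Monad D) :
  mon_mul X ∘ sq (meta X ⋆ vid X) = sq (hlunit X).
Proof. exact: m_unitl. Qed.

Lemma mon_unitr (X : Monad D) :
  mon_mul X ∘ sq (vid X ⋆ meta X) = sq (hrunit X).
Proof. exact: m_unitr. Qed.

Lemma sq_hassoc_nat (A B E F A' B' E' F' : D)
      (f : Hom A A') (g : Hom B B') (h : Hom E E') (k : Hom F F')
      (z : hmap E F) (z' : hmap E' F') (y : hmap B E) (y' : hmap B' E')
      (x : hmap A B) (x' : hmap A' B')
      (c : cell h k z z') (b : cell g h y y') (a : cell f g x x') :
  sq (hassoc z' y' x') ∘ sq ((c ⋆ b) ⋆ a) =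
  sq (c ⋆ (b ⋆ a)) ∘ sq (hassoc z y x).
Proof. exact: hassoc_nat. Qed.

Lemma sq_hlunit_nat (A B A' B' : D) (f : Hom A A') (g : Hom B B')
      (x : hmap A B) (x' : hmap A' B') (a : cell f g x x') :
  sq (hlunit x') ∘ sq (chid g ⋆ a) = sq a ∘ sq (hlunit x).
Proof. exact: hlunit_nat. Qed.

Lemma sq_hrunit_nat (A B A' B' : D) (f : Hom A A') (g : Hom B B')
      (x : hmap A B) (x' : hmap A' B') (a : cell f g x x') :
  sq (hrunit x') ∘ sq (a ⋆ chid f) = sq a ∘ sq (hrunit x).
Proof. exact: hrunit_nat. Qed.

Definition mmap (X Y : Monad D) (F : MonadMap X Y) :
  @Hom (hcat D) (loop X) (loop Y) := Sq (mcell F).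

Lemma mmap_inj (X Y : Monad D) (F G : @Hom (Mnd D) X Y) : mmap F = mmap G -> F =
  G.
Proof. exact: MonadMap_inj. Qed.

Lemma mmapM (X Y Z : Mnd D) (G : Hom Y Z) (F : Hom X Y) :
  mmap (G ∘ F) = mmap G ∘ mmap F.
Proof. by []. Qed.

Lemma mmap1 (X : Mnd D) : mmap (idm X) = idm (loop X).
Proof. by []. Qed.

Lemma mmap_eta (X Y : Mnd D) (F : Hom X Y) :
  mmap F ∘ mon_one X = mon_one Y ∘ chid_sq (vmap F).
Proof. exact: mcell_eta. Qed.

Lemma mmap_mu (X Y : Mnd D) (F : Hom X Y) :
  mmap F ∘ mon_mul X = mon_mul Y ∘ sq (mcell F ⋆ mcell F).
Proof. exact: mcell_mu. Qed.

Definition mk_mmap (X Y : Monad D) (f : Hom (mbase X) (mbase Y))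
  (a : cell f f (mloop X) (mloop Y))
  (mu : sq a ∘ mon_mul X = mon_mul Y ∘ sq (a ⋆ a))
  (eta : sq a ∘ mon_one X = mon_one Y ∘ chid_sq f) : MonadMap X Y :=
  MkMonadMap mu eta.

(** Both boundaries of the inverse square invert [vmap F], hence coincide, and its compatibility
    with the monad structures may be tested after the monomorphism [mmap F]. *)
Lemma mnd_iso (X Y : Mnd D) (F : Hom X Y) : IsIso (mmap F) -> IsIso F.
Proof.
move=> [S SF FS].
(* [IsIso] is data, whereas the common boundary of the inverse is obtained only as an existence
   statement; hence the choice. *)
suff /constructive_indefinite_description [G [GF FG]] :
  exists G : Hom Y X, G ∘ F = idm X /\ F ∘ G = idm Y by exists G.
have [g [b bS]] : exists g b, @sq _ _ _ _ g g _ _ b = S.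
  apply: sq_diagonal.
  have l := congr1 (@lft _ _ _ _ _ _ _) SF.
  have r := congr1 (@rgt _ _ _ _ _ _ _) FS.
  rewrite /= in l r.
  by rewrite -[lft S]cmpm1 -r cmpA l cmp1m.
have mono T (S1 S2 : Hom T (loop X)) :
  mmap F ∘ S1 = mmap F ∘ S2 -> S1 = S2.
  by apply: iso_mono; exists S.
have FbE : sq (mcell F • b) = idm _ by rewrite sq_cmpE bS.
have mu : sq b ∘ mon_mul Y = mon_mul X ∘ sq (b ⋆ b).
  apply: mono; rewrite bS cmpA FS cmp1m cmpA mmap_mu -cmpA.
  rewrite -sq_hcmpM (sq_hcmp (b1 := vid _) (a1 := vid _) FbE FbE) chcmp1.
  by rewrite sq_vid cmpm1.
have eta : sq b ∘ mon_one Y = mon_one X ∘ chid_sq g.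
  apply: mono; rewrite bS cmpA FS cmp1m cmpA mmap_eta -cmpA.
  rewrite -chid_sqM.
  have -> : vmap F ∘ g = idm _.
    by move: (congr1 (@lft _ _ _ _ _ _ _) FbE).
  by rewrite chid_sq1 cmpm1.
have GE : mmap (mk_mmap mu eta) = S by exact: bS.
by exists (mk_mmap mu eta); split; apply: mmap_inj; rewrite mmapM mmap1 GE.
Qed.

End Squares.

Arguments sq {D A B A' B' f g x y} a.

(** * Monads created along oplax endofunctors *)

Section OplaxEndo.
Variable D : DoubleCategory.
Local Notation disc A := (HOb (hid A) : hcat D).
Local Notation loop X := (HOb (mloop X) : hcat D).
Local Notation "X ~> Y" := (@Hom (hcat D) X Y) (at level 70).

(** There are two instances: the identity, for cartesian lifts of monads, and [- ⊠ id_B], for homs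
    out of a discrete monad. *)
Record OplaxEndofunctor := {
  overt :> Functor D D;
  ohmap : forall A B : D, hmap A B -> hmap (overt A) (overt B);
  ocell : forall (A B A' B' : D) (f : Hom A A') (g : Hom B B')
      (x : hmap A B) (y : hmap A' B'),
    cell f g x y -> cell (fmap overt f) (fmap overt g) (ohmap x) (ohmap y);
  ocell1 : forall (A B : D) (x : hmap A B),
    sq (ocell (vid x)) = sq (vid (ohmap x));
  ocellM : forall (A B A' B' A'' B'' : D) (f' : Hom A' A'') (g' : Hom B' B'')
      (f : Hom A A') (g : Hom B B') (x : hmap A B) (y : hmap A' B')
      (z : hmap A'' B'') (b : cell f' g' y z) (a : cell f g x y),
    sq (ocell (b • a)) = sq (ocell b) ∘ sq (ocell a);
  ocmp : forall (A B E : D) (y : hmap B E) (x : hmap A B),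
    glob (ohmap (y ⊙ x)) (ohmap y ⊙ ohmap x);
  ocmp_nat : forall (A B E A' B' E' : D) (f : Hom A A') (g : Hom B B')
      (h : Hom E E') (y : hmap B E) (y' : hmap B' E') (x : hmap A B)
      (x' : hmap A' B') (b : cell g h y y') (a : cell f g x x'),
    sq (ocmp y' x') ∘ sq (ocell (b ⋆ a)) =
    sq (ocell b ⋆ ocell a) ∘ sq (ocmp y x);
  ounit : forall A : D, glob (ohmap (hid A)) (hid (overt A));
  ounit_nat : forall (A A' : D) (f : Hom A A'),
    sq (ounit A') ∘ sq (ocell (chid f)) = chid_sq (fmap overt f) ∘ sq (ounit A);
  ocmp_assoc : forall (A B E F : D) (z : hmap E F) (y : hmap B E)
      (x : hmap A B),
    sq (hassoc (ohmap z) (ohmap y) (ohmap x))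
      ∘ (sq (ocmp z y ⋆ vid (ohmap x)) ∘ sq (ocmp (z ⊙ y) x)) =
    sq (vid (ohmap z) ⋆ ocmp y x) ∘ sq (ocmp z (y ⊙ x))
      ∘ sq (ocell (hassoc z y x));
  ocmp_lunit : forall (A B : D) (x : hmap A B),
    sq (hlunit (ohmap x)) ∘ (sq (ounit B ⋆ vid (ohmap x))
      ∘ sq (ocmp (hid B) x)) = sq (ocell (hlunit x));
  ocmp_runit : forall (A B : D) (x : hmap A B),
    sq (hrunit (ohmap x)) ∘ (sq (vid (ohmap x) ⋆ ounit A)
      ∘ sq (ocmp x (hid A))) = sq (ocell (hrunit x)) }.

Section Creation.
Variable T : OplaxEndofunctor.

(* Maps of monads from T x to z; when T preserves composition, these are the
   monad maps out of the image of x under T. *)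
Definition is_omap (X Z : Monad D) (f : Hom (T (mbase X)) (mbase Z))
    (a : cell f f (ohmap T X) Z) : Prop :=
  sq a ∘ sq (ocell T (mmu X)) = mon_mul Z ∘ (sq (a ⋆ a) ∘ sq (ocmp T X X)) /\
  sq a ∘ sq (ocell T (meta X)) =
    mon_one Z ∘ (chid_sq f ∘ sq (ounit T (mbase X))).

(** For the identity endofunctor this says that [e] is cartesian over [(p, p)]; for [- ⊠ id_B] it
    says that [e] is an evaluation, relative to vertical maps into [H]. *)
Definition is_universal (H C : D) (p : Hom (T H) C) (h : hmap H H)
    (z : hmap C C) (e : cell p p (ohmap T h) z) : Prop :=
  forall (A A' : D) (x : hmap A A') (u : Hom A H) (v : Hom A' H)
    (a : cell (p ∘ fmap T u) (p ∘ fmap T v) (ohmap T x) z),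
  exists! r : cell u v x h, sq e ∘ sq (ocell T r) = sq a.

Lemma universal_cell (H C : D) (p : Hom (T H) C) (h : hmap H H)
  (z : hmap C C) (e : cell p p (ohmap T h) z) (A A' : D) (x : hmap A A')
  (u : Hom A H) (v : Hom A' H) (S : HOb (ohmap T x) ~> HOb z) :
  is_universal e -> lft S = p ∘ fmap T u -> rgt S = p ∘ fmap T v ->
  exists c : cell u v x h, sq e ∘ sq (ocell T c) = S.
Proof.
case: S => l r a un /= el er; case: _ / (esym el) in a *.
case: _ / (esym er) in a *.
by have [c [ec _]] := un _ _ _ _ _ a; exists c.
Qed.

Lemma universal_inj (H C : D) (p : Hom (T H) C) (h : hmap H H)
  (z : hmap C C) (e : cell p p (ohmap T h) z) (A A' : D) (x : hmap A A')
  (u u' : Hom A H) (v v' : Hom A' H) (r : cell u v x h) (r' : cell u' v' x h) :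
  is_universal e -> u = u' -> v = v' ->
  sq e ∘ sq (ocell T r) = sq e ∘ sq (ocell T r') -> sq r = sq r'.
Proof.
move=> un eu ev; case: _ / eu in r' *; case: _ / ev in r' * => er.
have [s [_ s_uniq]] := un _ _ x u v (e • ocell T r').
by rewrite -(s_uniq r er) -(s_uniq r').
Qed.

Section CreatedMonad.
Variables (Z : Monad D) (H : D) (p : Hom (T H) (mbase Z)) (h : hmap H H).
Variables (e : cell p p (ohmap T h) Z) (un : is_universal e).

(** The right-hand side is a cell out of [T (h ⊙ h)] because the comparison of [T] points towards
    [T h ⊙ T h]: oplaxness is the direction that creation of monads calls for. *)
Lemma created_mul_exists :
  exists mu : glob (h ⊙ h) h,
  sq e ∘ sq (ocell T mu) = mon_mul Z ∘ (sq (e ⋆ e) ∘ sq (ocmp T h h)).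
Proof.
apply: universal_cell => //=; by rewrite fmap1 cmp1m.
Qed.

Lemma created_one_exists :
  exists eta : glob (hid H) h,
  sq e ∘ sq (ocell T eta) = mon_one Z ∘ (chid_sq p ∘ sq (ounit T H)).
Proof. apply: universal_cell => //=; by rewrite fmap1 cmp1m. Qed.

Variables (mu : glob (h ⊙ h) h) (eta : glob (hid H) h).
Hypothesis muE :
  sq e ∘ sq (ocell T mu) = mon_mul Z ∘ (sq (e ⋆ e) ∘ sq (ocmp T h h)).
Hypothesis etaE :
  sq e ∘ sq (ocell T eta) = mon_one Z ∘ (chid_sq p ∘ sq (ounit T H)).

(** Computes a product formed with [mu] after evaluation by [e]. Together with [universal_inj] it
    reduces each law of the created monad to the same law of [Z]. *)
Lemma created_mulM (A B E : D) (u : Hom A H) (v : Hom B H) (w : Hom E H)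
  (y : hmap B E) (x : hmap A B) (b : cell v w y h) (a : cell u v x h) :
  sq e ∘ sq (ocell T (mu • (b ⋆ a))) =
  mon_mul Z ∘ (sq ((e • ocell T b) ⋆ (e • ocell T a)) ∘ sq (ocmp T y x)).
Proof.
rewrite ocellM cmpA muE -!cmpA ocmp_nat.
by rewrite sq_hcmpM !cmpA.
Qed.

Lemma created_vid :
  sq (e • ocell T (vid h)) = sq (vid (mloop Z) • (e • vid (ohmap T h))).
Proof.
rewrite [RHS]sq_cmpE sq_vid cmp1m !sq_cmpE ocell1.
by rewrite cmpm1.
Qed.

Lemma created_assoc : mu • (mu ⋆ vid h) ≡ mu • (vid h ⋆ mu) • hassoc h h h.
Proof.
have e2 : sq (e • ocell T mu) = sq (mmu Z • ((e ⋆ e) • ocmp T h h)).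
  exact: muE.
apply: (universal_inj un); rewrite ?cmp1m //.
rewrite [in RHS]ocellM (cmpA (sq e)) !created_mulM.
rewrite (sq_hcmp e2 created_vid) (sq_hcmp created_vid e2) !sq_hcmpM.
rewrite -!cmpA (cmpA (sq (vid _ ⋆ ocmp _ _ _))) -ocmp_assoc.
rewrite (cmpA (sq (e ⋆ (e ⋆ e)))) -sq_hassoc_nat !cmpA mon_assoc.
by rewrite !cmpA.
Qed.

Lemma created_lunit : mu • (eta ⋆ vid h) ≡ hlunit h.
Proof.
have e2 : sq (e • ocell T eta) = sq (meta Z • (chid p • ounit T H)).
  exact: etaE.
apply: (universal_inj un); rewrite ?cmp1m // created_mulM.
rewrite (sq_hcmp e2 created_vid) !sq_hcmpM !cmpA mon_unitl sq_hlunit_nat.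
by rewrite -!cmpA ocmp_lunit.
Qed.

Lemma created_runit : mu • (vid h ⋆ eta) ≡ hrunit h.
Proof.
have e2 : sq (e • ocell T eta) = sq (meta Z • (chid p • ounit T H)).
  exact: etaE.
apply: (universal_inj un); rewrite ?cmp1m // created_mulM.
rewrite (sq_hcmp created_vid e2) !sq_hcmpM !cmpA mon_unitr sq_hrunit_nat.
by rewrite -!cmpA ocmp_runit.
Qed.

Definition created : MonadOn H :=
  MkMonadOn created_assoc created_lunit created_runit.

Lemma created_is_omap : @is_omap (MkMonad created) Z p e.
Proof. by []. Qed.

Lemma created_universal (X : Monad D) (u : Hom (mbase X) H)
  (a : cell (p ∘ fmap T u) (p ∘ fmap T u) (ohmap T X) Z) :
  is_omap a -> exists! G : MonadMap X (MkMonad created),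
    vmap G = u /\ sq e ∘ sq (ocell T (mcell G)) = sq a.
Proof.
move=> [a_mu a_eta]; have [r [re _]] := un a.
have r_mu : r • mmu X ≡ mu • (r ⋆ r).
  apply: (universal_inj un); rewrite ?cmp1m ?cmpm1 // created_mulM.
  by rewrite (sq_hcmp re re) ocellM cmpA re a_mu.
have r_eta : r • meta X ≡ eta • chid u.
  apply: (universal_inj un); rewrite ?cmp1m ?cmpm1 // !ocellM !cmpA re a_eta
    etaE.
  by rewrite -!cmpA ounit_nat !cmpA -(cmpA _ (chid_sq p)) -chid_sqM.
exists (@MkMonadMap D X (MkMonad created) u r r_mu r_eta); split=> //.
move=> G [Gu Ge]; apply: mmap_inj; apply: (universal_inj un) => //.
by rewrite re Ge.
Qed.

End CreatedMonad.
Lemma created_exists (Z : Monad D) (H : D) (p : Hom (T H) (mbase Z))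
  (h : hmap H H) (e : cell p p (ohmap T h) Z) : is_universal e ->
  exists (m : MonadOn H) (e' : cell p p (ohmap T m) Z),
    @is_omap (MkMonad m) Z p e' /\
    forall (X : Monad D) (u : Hom (mbase X) H)
      (a : cell (p ∘ fmap T u) (p ∘ fmap T u) (ohmap T X) Z),
    is_omap a -> exists! G : MonadMap X (MkMonad m),
      vmap G = u /\ sq e' ∘ sq (ocell T (mcell G)) = sq a.
Proof.
move=> un; have [mu muE] := created_mul_exists un.
have [eta etaE] := created_one_exists un.
exists (created un muE etaE), e; split; first exact: created_is_omap.
exact: created_universal.
Qed.

End Creation.

(** Its comparisons are identities, so that for it [is_omap] is the definition of a monad map. *)
Definition id_endo : OplaxEndofunctor.
Proof.
refine (@Build_OplaxEndofunctor
  (@MkFunctor D D (fun A => A) (fun _ _ f => f) (fun _ => erefl)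
     (fun _ _ _ _ _ => erefl))
  (fun _ _ x => x) (fun _ _ _ _ _ _ _ _ a => a) _ _
  (fun _ _ _ y x => vid (y ⊙ x)) _ (fun A => vid (hid A)) _ _ _ _) => //.
- by move=> *; rewrite sq_vid; refine (etrans (cmp1m _) (esym (cmpm1 _))).
- by move=> *; rewrite sq_vid; refine (etrans (cmp1m _) (esym (cmpm1 _))).
- move=> A B E F z y x; rewrite !chcmp1 !sq_vid !cmpm1.
  by rewrite !cmp1m.
- by move=> A B x; rewrite chcmp1 !sq_vid !cmpm1.
- by move=> A B x; rewrite chcmp1 !sq_vid !cmpm1.
Defined.

(** * Cartesian lifts of monads *)

Hypothesis fibrant : is_fibrant D.

(** Fibrancy places the lift over [(f, g)] only through an equality of dependent pairs. That
    equality is eliminated here once and for all, so that the lift has the prescribed boundary. *)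
Lemma cell_lift (A A' C C' : D) (y : hmap C C') (f : Hom A C) (g : Hom A' C') :
  exists (x : hmap A A') (p : cell f g x y),
  forall (B B' : D) (w : hmap B B') (u : Hom B A) (v : Hom B' A')
    (a : cell (f ∘ u) (g ∘ v) w y),
  exists! r : cell u v w x, sq p ∘ sq r = sq a.
Proof.
have [[s t x] [p [e p_cart]]] :=
  @fibrant (HOb y : hcat D) (A, A') ((f, g) : @Hom (prod_cat D D) (A, A')
    (C, C')).
have [es et] := congr1 (@projT1 _ _) e; rewrite /= in es et.
case: _ / es in f e *; case: _ / et in g e *.
have [ef eg] := ProofIrrelevanceTheory.EqdepTheory.inj_pair2 _ _ _ _ _ e.
case: p ef eg {e} p_cart => l r p /= ef eg; case: _ / ef; case: _ / eg =>
  p_cart.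
exists x, p => B B' w u v a.
have [[u' v' c] [[/= ec [eu ev]] c_uniq]] :=
  p_cart (HOb w) (Sq a) ((u, v) : @Hom (prod_cat D D) (_, _) (_, _)) erefl.
case: _ / eu in a ec c_uniq *; case: _ / ev in a ec c_uniq *.
exists c; split=> // c' ec'; apply: Sq_inj.
exact: (c_uniq (Sq c')).
Qed.

(** Creation along [id_endo] puts a monad structure on the cartesian lift of the loop of [Z]; thus
    the forgetful functor from monads to C_0 is again a fibration. *)
Lemma monad_lift (Z : Monad D) (A : D) (f : Hom A (mbase Z)) :
  exists (m : MonadOn A) (F : MonadMap (MkMonad m) Z), vmap F = f /\
  forall (X : Monad D) (u : Hom (mbase X) A) (G : MonadMap X Z),
    vmap G = f ∘ u -> exists! H : MonadMap X (MkMonad m),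
      vmap H = u /\ @cmp (Mnd D) _ _ _ F H = G.
Proof.
have [x [p p_univ]] := cell_lift (mloop Z) f f.
have [m [e [[e_mu e_eta] m_univ]]] :=
  @created_exists id_endo Z A f x p p_univ.
have F_mu : sq e ∘ mon_mul (MkMonad m) = mon_mul Z ∘ sq (e ⋆ e).
  by move: e_mu; rewrite cmpm1.
have F_eta : sq e ∘ mon_one (MkMonad m) = mon_one Z ∘ chid_sq f.
  by move: e_eta; rewrite cmpm1.
exists m, (mk_mmap F_mu F_eta); split=> // X u G Gu.
case: G Gu => g G G_mu G_eta /= Gu; case: _ / (esym Gu) in G G_mu G_eta *.
have G_omap : @is_omap id_endo X Z (f ∘ u) G.
  by split; [rewrite [sq (ocmp _ _ _)]sq_vid cmpm1
            | rewrite [sq (ounit _ _)]sq_vid cmpm1].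
have [H [[Hu He] H_uniq]] := m_univ X u G G_omap.
exists H; split; first by split=> //; apply: mmap_inj.
move=> H' [H'u H'e]; apply: H_uniq; split=> //.
exact: (congr1 (@mmap D _ _) H'e).
Qed.

End OplaxEndo.

(** Each [F i] factors through the cartesian lift of [Z] along [f] by a map in the fibre over [A],
    where the coproduct lives. *)
Lemma fibre_coproduct (D : DoubleCategory) (fibrant : is_fibrant D) (A : D)
  (I : Type) (X : I -> MndOn A) (C : Coproduct X) (Z : Monad D)
  (f : Hom A (mbase Z)) (F : forall i, @Hom (Mnd D) (MkMonad (X i)) Z) :
  (forall i, vmap (F i) = f) ->
  exists! H : @Hom (Mnd D) (MkMonad (cop C)) Z,
    vmap H = f /\ forall i, H ∘ sval (inj C i) = F i.
Proof.
move=> Ff; have [m [L [Lv L_univ]]] := monad_lift fibrant f.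
have L_univ1 (W : MonadOn A) (G : @Hom (Mnd D) (MkMonad W) Z) : vmap G = f ->
    exists! H : mnd_fib_hom W m, @cmp (Mnd D) _ _ _ L (sval H) = G.
  move=> Gf; have [|H [[Hv HE] H_uniq]] := L_univ (MkMonad W) (idm A) G.
    by rewrite cmpm1.
  exists (exist _ H Hv); split=> // -[H' H'v] H'E.
  by apply: mnd_fib_inj; apply: H_uniq; split.
pose F' i := constructive_indefinite_description _ (L_univ1 _ _ (Ff i)).
have F'E i : @cmp (Mnd D) _ _ _ L (sval (sval (F' i))) = F i.
  by case: (F' i) => ? [].
have F'_uniq i (H : mnd_fib_hom (X i) m) :
    @cmp (Mnd D) _ _ _ L (sval H) = F i -> sval (F' i) = H.
  by case: (F' i) => ? [_ /=]; apply.
have [h [hE h_uniq]] := cop_universal C (fun i => sval (F' i)).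
exists (@cmp (Mnd D) _ _ _ L (sval h)); split.
  split; first by rewrite /= Lv (svalP h) cmpm1.
  by move=> i; rewrite -cmpA -F'E -hE.
move=> H [Hf HE].
have [h' [h'E _]] := L_univ1 _ _ Hf.
rewrite -h'E (h_uniq h') // => i; apply/esym/F'_uniq.
by rewrite -HE -h'E -cmpA.
Qed.

(** * Monad maps out of tensor products *)

Section MonoidalClosedDoubleCategory.
Variables (D : DoubleCategory) (M : OplaxMonoidal D) (N : Normal M).
Variables (S : Symmetric M) (K : Closed M) (fibrant : is_fibrant D).
Variable P : forall A : D, FiniteCoproducts (MndOn A).
Variables (equalisers : has_equalisers D) (tabulators : has_1_tabulators D).
Local Notation T1 := (ten1 M).
Local Notation "X ⊗ Y" := (tob T1 X Y) (at level 38, left associativity).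
Local Notation "f ⊗m g" := (tmap T1 f g) (at level 38, left associativity).
Local Notation α := (tassoc (con1 (dcon M))).
Local Notation α0 := (tassoc (con0 (dcon M))).
Local Notation I0 := (tunit (ten0 M)).
Local Notation ΔI := (discrete I0).
Local Notation disc A := (HOb (hid A) : hcat D).
Local Notation loop X := (HOb (mloop X) : hcat D).
Local Notation "X ~> Y" := (@Hom (hcat D) X Y) (at level 70).
Local Notation "X → Y" := (@Hom (Mnd D) X Y) (at level 70).
Local Notation "X · B" := (box_disc N X B) (at level 37, left associativity).
Local Notation "X □ Y" := (nc_tensor N P X Y) (at level 37, left associativity).

(** The cells of the oplax structure are restated as maps of C_1 with their domains displayed as
    values of [ten1], so that the monoidal laws of C_1 can be rewritten with. *)
Definition xi_sq (A1 B1 E1 A2 B2 E2 : D) (y1 : hmap B1 E1) (x1 : hmap A1 B1)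
  (y2 : hmap B2 E2) (x2 : hmap A2 B2) :
  HOb (y1 ⊙ x1) ⊗ HOb (y2 ⊙ x2) ~> HOb ((y1 ⊠ y2) ⊙ (x1 ⊠ x2)) :=
  Sq (xi M y1 x1 y2 x2).

Definition ups_sq (A B : D) : disc A ⊗ disc B ~> disc (A ⊠0[M] B) :=
  Sq (ups M A B).

Definition ten_sq (A B A' B' E F : D) (f : Hom (A ⊠0[M] A') E)
  (g : Hom (B ⊠0[M] B') F) (x : hmap A B) (x' : hmap A' B') (y : hmap E F)
  (a : cell f g (x ⊠ x') y) : HOb x ⊗ HOb x' ~> HOb y := Sq a.

Lemma sq_xi_nat (A1 B1 E1 A2 B2 E2 A1' B1' E1' A2' B2' E2' : D)
      (f1 : Hom A1 A1') (g1 : Hom B1 B1') (h1 : Hom E1 E1')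
      (f2 : Hom A2 A2') (g2 : Hom B2 B2') (h2 : Hom E2 E2')
      (y1 : hmap B1 E1) (y1' : hmap B1' E1') (x1 : hmap A1 B1)
      (x1' : hmap A1' B1') (y2 : hmap B2 E2) (y2' : hmap B2' E2')
      (x2 : hmap A2 B2) (x2' : hmap A2' B2')
      (b1 : cell g1 h1 y1 y1') (a1 : cell f1 g1 x1 x1')
      (b2 : cell g2 h2 y2 y2') (a2 : cell f2 g2 x2 x2') :
  xi_sq y1' x1' y2' x2' ∘ (sq (b1 ⋆ a1) ⊗m sq (b2 ⋆ a2)) =
  sq ((b1 ⊠c b2) ⋆ (a1 ⊠c a2)) ∘ xi_sq y1 x1 y2 x2.
Proof. exact: xi_nat. Qed.

Lemma ups_sq_nat (A1 A2 A1' A2' : D) (f1 : Hom A1 A1') (f2 : Hom A2 A2') :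
  ups_sq A1' A2' ∘ (chid_sq f1 ⊗m chid_sq f2) =
  chid_sq (tmap (ten0 M) f1 f2) ∘ ups_sq A1 A2.
Proof. exact: ups_nat. Qed.

Lemma sq_assoc_xi (A1 B1 E1 A2 B2 E2 A3 B3 E3 : D)
      (y1 : hmap B1 E1) (x1 : hmap A1 B1) (y2 : hmap B2 E2) (x2 : hmap A2 B2)
      (y3 : hmap B3 E3) (x3 : hmap A3 B3) :
  sq (cassoc (dcon M) y1 y2 y3 ⋆ cassoc (dcon M) x1 x2 x3)
    ∘ xi_sq (y1 ⊠ y2) (x1 ⊠ x2) y3 x3 ∘ (xi_sq y1 x1 y2 x2 ⊗m idm _) =
  xi_sq y1 x1 (y2 ⊠ y3) (x2 ⊠ x3) ∘ (idm _ ⊗m xi_sq y2 x2 y3 x3)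
    ∘ α (HOb (y1 ⊙ x1)) (HOb (y2 ⊙ x2)) (HOb (y3 ⊙ x3)).
Proof. exact: cassoc_xi. Qed.

Lemma sq_assoc_ups (A1 A2 A3 : D) :
  chid_sq (tassoc (con0 (dcon M)) A1 A2 A3)
    ∘ (ups_sq (tob (ten0 M) A1 A2) A3 ∘ (ups_sq A1 A2 ⊗m idm _)) =
  ups_sq A1 (tob (ten0 M) A2 A3) ∘ (idm _ ⊗m ups_sq A2 A3)
    ∘ α (disc A1) (disc A2) (disc A3).
Proof. by rewrite cmpA; apply: cassoc_ups. Qed.

(** * Maps out of a tensor product of two monads; the constraints of [⊠] as monad maps *)

Section TensorOn.
Variables (X Y : Monad D) (H : Interchanging M X Y).

Definition ten_mon : Mnd D := MkMonad (ten_on H).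

Definition ten_mul : HOb ((X ⊠ Y) ⊙ (X ⊠ Y)) ~> loop X ⊗ loop Y :=
  mon_mul (ten_mon).

Definition ten_one : disc (mbase X ⊠0[M] mbase Y) ~> loop X ⊗ loop Y :=
  mon_one (ten_mon).

Lemma ten_mulK : ten_mul ∘ xi_sq X X Y Y = mon_mul X ⊗m mon_mul Y.
Proof. exact: ten_muKS. Qed.

Lemma ten_oneK : ten_one ∘ ups_sq (mbase X) (mbase Y) = mon_one X ⊗m mon_one Y.
Proof. exact: ten_etaKS. Qed.

(** Since [ξ] and [υ] are invertible at [X] and [Y], the two laws may be tested after them, where
    the structure of the tensor product is expressed by those of [X] and [Y]. *)
Definition ten_on_map (W : Monad D)
  (f : Hom (mbase X ⊠0[M] mbase Y) (mbase W))
  (a : cell f f (mloop X ⊠ mloop Y) (mloop W)) :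
  ten_sq a ∘ (mon_mul X ⊗m mon_mul Y) = mon_mul W
    ∘ (sq (a ⋆ a) ∘ xi_sq X X Y Y) ->
  ten_sq a ∘ (mon_one X ⊗m mon_one Y) =
    mon_one W ∘ (chid_sq f ∘ ups_sq (mbase X) (mbase Y)) ->
  @Hom (Mnd D) ten_mon W.
Proof.
move=> mu eta; apply: (@mk_mmap D ten_mon W f a).
- apply: (iso_epi (sq_iso (ich_xi H))).
  move: mu; rewrite -ten_mulK cmpA => mu; refine (etrans mu _).
  by rewrite cmpA.
- apply: (iso_epi (sq_iso (ich_ups H))).
  move: eta; rewrite -ten_oneK cmpA => eta; refine (etrans eta _).
  by rewrite cmpA.
Defined.

End TensorOn.

(** The interchange hypotheses are parameters because the map is used with two discrete factors in
    each of the three possible positions. *)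
Definition assoc_map (X Y Z : Monad D) (HXY : Interchanging M X Y)
  (H1 : Interchanging M (ten_on HXY) Z) (HYZ : Interchanging M Y Z)
  (H2 : Interchanging M X (ten_on HYZ)) :
  @Hom (Mnd D) (@ten_mon (ten_mon HXY) Z H1) (@ten_mon X (ten_mon HYZ) H2).
Proof.
apply: (@ten_on_map (ten_mon HXY) Z H1 (@ten_mon X (ten_mon HYZ) H2)
  (tassoc (con0 (dcon M)) _ _ _) (cassoc (dcon M) _ _ _)).
- refine (assoc_mult (laws1 M) (ten_mulK HXY) (ten_mulK HYZ)
    (ten_mulK (X := X) (Y := ten_mon HYZ) H2) _ _);
      last exact: sq_iso (ich_xi HXY).
  exact: sq_assoc_xi.
- refine (assoc_mult (laws1 M) (ten_oneK HXY) (ten_oneK HYZ)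
    (ten_oneK (X := X) (Y := ten_mon HYZ) H2) _ _);
      last exact: sq_iso (ich_ups HXY).
  by rewrite -cmpA; exact: sq_assoc_ups.
Defined.

Definition braid_map (X Y : Monad D)
  (H : Interchanging M X Y) (H' : Interchanging M Y X) :
  @Hom (Mnd D) (ten_mon H) (ten_mon H').
Proof.
apply: (@ten_on_map X Y H (ten_mon H') (braid0 S _ _) (braid1 S _ _)).
- refine (braid_mult (sym1 S) (ten_mulK H') _); exact: braid_xi.
- refine (braid_mult (sym1 S) (ten_oneK H') _); exact: braid_ups.
Defined.

(** The multiplication of a discrete monad is a unitor, so that [υ] is multiplicative by the left
    unit law relating [ξ] and [υ]. *)
Definition ups_map (A B : D)
  (H : Interchanging M (discrete A) (discrete B)) :
  @Hom (Mnd D) (ten_mon H) (discrete (A ⊠0[M] B)).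
Proof.
apply: (@ten_on_map _ _ H (discrete (A ⊠0[M] B)) (idm _) (ups M A B)).
- have -> : sq (ups M A B ⋆ ups M A B) =
      sq (chid (idm _) ⋆ ups M A B) ∘ sq (ups M A B ⋆ vid (hid A ⊠ hid B)).
    rewrite chid1 -sq_hcmpM; apply: sq_hcmp; symmetry; first exact: vcmp1m.
    exact: vcmpm1.
  have e1 : sq (hlunit (hid (A ⊠0[M] B))) ∘ sq (chid (idm _) ⋆ ups M A B) =
      ups_sq A B ∘ sq (hlunit (hid A ⊠ hid B)).
    exact: hlunit_nat.
  rewrite -[in RHS]cmpA (cmpA (mon_mul _)).
  refine (etrans _ (esym (congr1 (fun g => g ∘ _) e1))).
  rewrite -cmpA; congr (_ ∘ _); rewrite cmpA; refine (esym _); exact: xi_lunit.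
- refine (etrans (congr1 _ (tmap1 (laws1 M) (disc A) (disc B))) _).
  by rewrite chid_sq1 cmpm1 cmp1m; refine (esym _);
    apply: (cmp1m (c := hcat D)).
Defined.

(** Invertibility of [ξ] is transported by naturality. Normality speaks of identity loops only, and
    [Δ_B ⊠ Δ_C] is merely isomorphic to a discrete monad. *)
Lemma interchanging_iso (A B : D) (a a' : MonadOn A) (b b' : MonadOn B)
  (u : glob a a') (v : glob b b') :
  GlobIso u -> GlobIso v -> Interchanging M a' b' -> Interchanging M a b.
Proof.
move=> iu iv H.
have [iu' iv'] : (GlobIso (ginv iu) * GlobIso (ginv iv))%type.
  by split; [exists u; [apply: gKinv | apply: ginvK]
           | exists v; [apply: gKinv | apply: ginvK]].
have i1 (E F : D) (x : hmap E F) := g1_iso x.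
have transport (y1 y1' x1 x1' : hmap A A) (y2 y2' x2 x2' : hmap B B)
  (b1 : glob y1 y1') (a1 : glob x1 x1') (b2 : glob y2 y2') (a2 : glob x2 x2') :
  GlobIso b1 -> GlobIso a1 -> GlobIso b2 -> GlobIso a2 ->
  GlobIso (xi M y1 x1 y2 x2) -> GlobIso (xi M y1' x1' y2' x2').
  move=> ib1 ia1 ib2 ia2 ix; apply: (giso_conj (gxi_nat M b1 a1 b2 a2) ix).
  - by apply: gten_iso; apply: gh_iso.
  - by apply: gh_iso; apply: gten_iso.
split; last 2 first.
- exact: (transport _ _ _ _ _ _ _ _ (g1 _) (ginv iu) (g1 _) (ginv iv)
    (i1 _ _ _) iu' (i1 _ _ _) iv' (ich_xil H)).
- exact: (transport _ _ _ _ _ _ _ _ (ginv iu) (g1 _) (ginv iv) (g1 _)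
    iu' (i1 _ _ _) iv' (i1 _ _ _) (ich_xir H)).
- exact: (transport _ _ _ _ _ _ _ _ (ginv iu) (ginv iu) (ginv iv) (ginv iv)
    iu' iu' iv' iv' (ich_xi H)).
- exact: ich_ups H.
exact: (transport _ _ _ _ _ _ _ _ (gh (ginv iu) (ginv iu)) (ginv iu)
  (gh (ginv iv) (ginv iv)) (ginv iv) (gh_iso iu' iu') iu' (gh_iso iv' iv') iv'
  (ich_xi3 H)).
Qed.

Definition iot_sq : tunit T1 ~> disc I0 := Sq (iot M).

Definition iot_inv : disc I0 ~> tunit T1 := sq (ginv (iot_iso N)).

Lemma iot_invK : iot_inv ∘ iot_sq = idm (tunit T1).
Proof. by rewrite -sq_gcmp ginvK. Qed.

Lemma iot_sq_iso : IsIso iot_sq.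
Proof. exact: sq_iso (iot_iso N). Qed.

(** Plays for [id_I ∘ id_I] the role that [iot_sq] plays for [id_I]; the unit law of [δ] relates the
    two. *)
Definition dlt_iot : tunit T1 ~> HOb (discrete I0 ⊙ discrete I0) :=
  @cmp (hcat D) (HOb (hunit M)) (HOb (hunit M ⊙ hunit M)) _
    (sq (iot M ⋆ iot M)) (sq (dlt M)).

Lemma dlt_iot_iso : IsIso dlt_iot.
Proof.
have := gcmp_iso (gh_iso (iot_iso N) (iot_iso N)) (dlt_iso N).
by move/sq_iso; rewrite sq_gcmp.
Qed.

Lemma mul_dlt_iot : mon_mul (discrete I0) ∘ dlt_iot = iot_sq.
Proof.
rewrite /dlt_iot; have -> : sq (iot M ⋆ iot M) =
    sq (chid (idm _) ⋆ iot M) ∘ sq (iot M ⋆ vid (hunit M)).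
  rewrite chid1 -sq_hcmpM; apply: sq_hcmp; symmetry; first exact: vcmp1m.
  exact: vcmpm1.
have e1 : sq (hlunit (hid I0)) ∘ sq (chid (idm _) ⋆ iot M) =
    sq (iot M) ∘ sq (hlunit (hunit M)) by exact: hlunit_nat.
rewrite !cmpA; refine (etrans (congr1 (fun g => g ∘ _ ∘ _) e1) _).
rewrite -!cmpA (cmpA (sq (hlunit _))).
refine (etrans (congr1 (cmp _) (dlt_lunit M : _ = idm (HOb (hunit M) : hcat D)))
  _).
exact: cmpm1.
Qed.

(** The unit constraint of C_1 has [I_1] as a factor while [Δ_I] has loop [id_I]; the inverse of [ι]
    bridges the gap. *)
Definition lunit_cell (X : Monad D) := clunit (dcon M) X •
  ((ginv (iot_iso N) : glob _ _) ⊠c vid (mloop X)).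

Lemma lunit_cellK (X : Monad D) :
  ten_sq (lunit_cell X) ∘ (iot_sq ⊗m idm (loop X)) =
    tlunit (con1 (dcon M)) (loop X).
Proof.
have -> : ten_sq (lunit_cell X) = tlunit (con1 (dcon M)) _
  ∘ (iot_inv ⊗m idm (loop X)) by [].
by rewrite -cmpA -(tmapM (laws1 M)) cmp1m iot_invK (tmap1 (laws1 M)) cmpm1.
Qed.

Definition lunit_map (X : Monad D) (H : Interchanging M (discrete I0) X) :
  @Hom (Mnd D) (ten_mon H) X.
Proof.
apply: (@ten_on_map _ _ H X _ (lunit_cell X)).
- refine (lunit_mult (laws1 M) (mon_mul X) (lunit_cellK X) mul_dlt_iot _
    dlt_iot_iso).
  have -> : dlt_iot ⊗m idm (HOb (X ⊙ X) : hcat D) =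
    (sq (iot M ⋆ iot M) ⊗m sq (vid (mloop X) ⋆ vid (mloop X)))
    ∘ (sq (dlt M) ⊗m idm _).
    by rewrite -(tmapM (laws1 M)) cmpm1 chcmp1.
  rewrite -cmpA (cmpA (xi_sq _ _ _ _)) sq_xi_nat !cmpA -sq_hcmpM.
  rewrite (sq_hcmp (b1 := clunit (dcon M) X) (a1 := clunit (dcon M) X));
    try exact: lunit_cellK.
  exact: clunit_xi.
- refine (lunit_mult (laws1 M) (mon_one X) (lunit_cellK X) (cmp1m iot_sq) _
    iot_sq_iso).
  rewrite (tmap1 (laws0 M)) cmpm1 -cmpA cmpA; exact: clunit_ups.
Defined.

Definition runit_cell (X : Monad D) := crunit (dcon M) X •
  (vid (mloop X) ⊠c (ginv (iot_iso N) : glob _ _)).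

Lemma runit_cellK (X : Monad D) :
  ten_sq (runit_cell X) ∘ (idm (loop X) ⊗m iot_sq) =
    trunit (con1 (dcon M)) (loop X).
Proof.
have -> : ten_sq (runit_cell X) = trunit (con1 (dcon M)) _
  ∘ (idm (loop X) ⊗m iot_inv) by [].
by rewrite -cmpA -(tmapM (laws1 M)) cmp1m iot_invK (tmap1 (laws1 M)) cmpm1.
Qed.

Definition runit_map (X : Monad D) (H : Interchanging M X (discrete I0)) :
  @Hom (Mnd D) (ten_mon H) X.
Proof.
apply: (@ten_on_map _ _ H X _ (runit_cell X)).
- refine (runit_mult (laws1 M) (mon_mul X) (runit_cellK X) mul_dlt_iot _
    dlt_iot_iso).
  have -> : idm (HOb (X ⊙ X) : hcat D) ⊗m dlt_iot =
    (sq (vid (mloop X) ⋆ vid (mloop X)) ⊗m sq (iot M ⋆ iot M))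
    ∘ (idm _ ⊗m sq (dlt M)).
    by rewrite -(tmapM (laws1 M)) cmpm1 chcmp1.
  rewrite -cmpA (cmpA (xi_sq _ _ _ _)) sq_xi_nat !cmpA -sq_hcmpM.
  rewrite (sq_hcmp (b1 := crunit (dcon M) X) (a1 := crunit (dcon M) X));
    try exact: runit_cellK.
  exact: crunit_xi.
- refine (runit_mult (laws1 M) (mon_one X) (runit_cellK X) (cmp1m iot_sq) _
    iot_sq_iso).
  rewrite (tmap1 (laws0 M)) cmpm1 -cmpA cmpA; exact: crunit_ups.
Defined.

Lemma hom0_universal (A B C : D) (f : Hom (A ⊠0[M] B) C) :
  exists! g : Hom A (hom0 K B C), ev0 K B C ∘ tmap (ten0 M) g (idm B) = f.
Proof. exact: (adjoint_counit (adj0 K B) f). Qed.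

Lemma hom0_inj (A B C : D) (f g : Hom A (hom0 K B C)) :
  ev0 K B C ∘ tmap (ten0 M) f (idm B) = ev0 K B C ∘ tmap (ten0 M) g (idm B) ->
  f = g.
Proof. exact: (counit_inj (adjoint_counit (adj0 K B) (d := C))). Qed.

Definition ev_sq (B B' C C' : D) (y : hmap B B') (z : hmap C C') :
  HOb (hom1 K y z) ⊗ HOb y ~> HOb z := ten_sq (ev1 K y z).

Lemma hom1_universal (A A' B B' C C' : D) (x : hmap A A') (y : hmap B B')
  (z : hmap C C') (F : HOb x ⊗ HOb y ~> HOb z) :
  exists! R : HOb x ~> HOb (hom1 K y z), ev_sq y z ∘ (R ⊗m idm _) = F.
Proof.
exact: (adjoint_counit (adj1 K (HOb y)) (d := HOb z) (c := HOb x) F).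
Qed.

(** * The oplax endofunctor [- ⊠ id_B] and homs out of a discrete monad *)

Section Endo.
Variable B : D.
Local Notation i := (hid B).
Local Notation li := (ginv (hlunit_iso i)).

(** The inverse unitor splits [id_B] into [id_B ∘ id_B], so that [ξ] applies in its given
    direction. *)
Definition ten_ocmp (A C E : D) (y : hmap C E) (x : hmap A C) :
  @glob D (A ⊠0[M] B) (E ⊠0[M] B) ((y ⊙ x) ⊠ i) ((y ⊠ i) ⊙ (x ⊠ i)) :=
  gcmp (xi M y x i i) (gten M (g1 (y ⊙ x)) li).

Lemma ten_ocmpE (A C E : D) (y : hmap C E) (x : hmap A C) :
  sq (ten_ocmp y x) = xi_sq y x i i ∘ (idm (HOb (y ⊙ x) : hcat D) ⊗m sq li).
Proof. by rewrite sq_gcmp; congr (_ ∘ _); apply: gtenE. Qed.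

(** Coassociativity of the inverse unitor, obtained by inverting the associativity law of the
    discrete monad. *)
Lemma discrete_comul :
  sq (hassoc i i i) ∘ (sq (li ⋆ vid i) ∘ sq li) = sq (vid i ⋆ li) ∘ sq li.
Proof.
have e : gcmp (hlunit i) (gh (hlunit i) (g1 i)) =
    gcmp (gcmp (hlunit i) (gh (g1 i) (hlunit i))) (hassoc i i i).
  exact: (gm_assoc (discrete_on B)).
have : gcmp (hassoc i i i) (gcmp (gh li (g1 i)) li) = gcmp (gh (g1 i) li) li.
  apply: (giso_mono (gcmp_iso (hlunit_iso i)
    (gh_iso (g1_iso i) (hlunit_iso i)))).
  rewrite gcmpA -e -!gcmpA (gcmpA (gh _ _) (gh _ _)) -ghMl gKinv.
  rewrite (gcmpA (gh _ _) (gh _ _)) -ghMr gKinv !gh1.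
  by rewrite !gcmp1m.
by move/(congr1 (fun c => sq c)); rewrite !sq_gcmp.
Qed.

Lemma ten_ocmp_assoc (A C E F : D) (z : hmap E F) (y : hmap C E)
  (x : hmap A C) :
  sq (hassoc (z ⊠ i) (y ⊠ i) (x ⊠ i))
    ∘ (sq (ten_ocmp z y ⋆ vid (x ⊠ i)) ∘ sq (ten_ocmp (z ⊙ y) x)) =
  sq (vid (z ⊠ i) ⋆ ten_ocmp y x) ∘ sq (ten_ocmp z (y ⊙ x))
    ∘ sq (hassoc z y x ⊠c vid i).
Proof.
have e1 : sq (ten_ocmp z y ⋆ vid (x ⊠ i)) =
    sq (xi M z y i i ⋆ vid (x ⊠ i)) ∘ sq ((vid (z ⊙ y) ⊠c li) ⋆
      (vid x ⊠c vid i)).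
  rewrite -sq_hcmpM; apply: sq_hcmp; first exact: ten_ocmpE.
  rewrite sq_cmpE sq_vid cmp1m; refine (esym _).
  exact: (tmap1 (laws1 M) (HOb x) (HOb i)).
have e2 : sq (vid (z ⊠ i) ⋆ ten_ocmp y x) =
    sq (vid (z ⊠ i) ⋆ xi M y x i i) ∘ sq ((vid z ⊠c vid i) ⋆
      (vid (y ⊙ x) ⊠c li)).
  rewrite -sq_hcmpM; apply: sq_hcmp; last exact: ten_ocmpE.
  rewrite sq_cmpE sq_vid cmp1m; refine (esym _).
  exact: (tmap1 (laws1 M) (HOb z) (HOb i)).
rewrite e1 e2 !ten_ocmpE.
refine (comul_assoc (laws1 M) (h := sq (hassoc z y x))
  (u' := xi_sq (z ⊙ y) x (i ⊙ i) i)
  (w' := xi_sq z (y ⊙ x) i (i ⊙ i)) discrete_comul _ _ _).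
- by rewrite -sq_xi_nat chcmp1.
- by rewrite -sq_xi_nat chcmp1.
- exact: xi_assoc.
Qed.

Definition ten_endo : OplaxEndofunctor D.
Proof.
refine (@Build_OplaxEndofunctor D (tensr (laws0 M) B)
  (fun A C x => x ⊠ i) (fun _ _ _ _ _ _ _ _ a => a ⊠c vid i) _ _
  ten_ocmp _ (fun A => ups M A B) _ ten_ocmp_assoc _ _).
- by move=> A C x; apply: (tmap1 (laws1 M) (HOb x) (HOb i)).
- move=> A C A1 C1 A2 C2 f1 g1 f g x y z b a.
  exact: (tmapMl (laws1 M) (HOb i) (sq b) (sq a)).
- move=> A C E A' C' E' f g h y y' x x' b a.
  rewrite !ten_ocmpE; refine (comul_nat (laws1 M) (f := sq (b ⋆ a)) (sq li) _).
  by rewrite -sq_xi_nat chcmp1.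
- move=> A A' f; rewrite -[vid i]chid1; exact: ups_sq_nat.
- move=> A C x; rewrite ten_ocmpE cmpA.
  refine (comul_unit (laws1 M) (h := sq (hlunit x)) (k := sq (hlunit i)) _ _);
    first exact: xi_lunit.
  by rewrite -sq_gcmp gKinv.
- move=> A C x; rewrite ten_ocmpE cmpA.
  refine (comul_unit (laws1 M) (h := sq (hrunit x)) (k := sq (hrunit i)) _ _);
    first exact: xi_runit.
  by rewrite -hlunit_hid -sq_gcmp gKinv.
Defined.

(** Monad maps out of [X ⊠ Δ_B] and maps in the sense of [is_omap] for [ten_endo] obey the same
    laws; only the side on which the unitor of [id_B] stands differs. *)
Lemma omap_mul (X Z : Monad D) (f : Hom (mbase X ⊠0[M] B) (mbase Z))
  (a : cell f f (X ⊠ i) Z) :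
  (ten_sq a ∘ (mon_mul X ⊗m mon_mul (discrete B)) =
   mon_mul Z ∘ (sq (a ⋆ a) ∘ xi_sq X X i i)) <->
  (sq a ∘ sq (ocell ten_endo (mmu X)) =
   mon_mul Z ∘ (sq (a ⋆ a) ∘ sq (ocmp ten_endo X X))).
Proof.
have -> : sq (ocmp ten_endo X X) = sq (ten_ocmp X X) by [].
rewrite ten_ocmpE; apply: (counit_transfer (laws1 M)).
  by rewrite -sq_gcmp gKinv.
by rewrite -sq_gcmp ginvK.
Qed.

Lemma omap_one (X Z : Monad D) (f : Hom (mbase X ⊠0[M] B) (mbase Z))
  (a : cell f f (X ⊠ i) Z) :
  (ten_sq a ∘ (mon_one X ⊗m mon_one (discrete B)) =
   mon_one Z ∘ (chid_sq f ∘ ups_sq (mbase X) B)) <->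
  (sq a ∘ sq (ocell ten_endo (meta X)) =
   mon_one Z ∘ (chid_sq f ∘ sq (ounit ten_endo (mbase X)))).
Proof. by []. Qed.

Lemma ten_mon_omap (X Z : Monad D) (H : Interchanging M X (discrete B))
  (F : MonadMap (ten_mon H) Z) :
  @is_omap D ten_endo X Z (vmap F) (mcell F).
Proof.
split.
  apply/omap_mul; rewrite -(ten_mulK H) (cmpA (ten_sq _)) (cmpA (mon_mul Z)).
  exact: (congr1 (fun g => g ∘ _) (mmap_mu F)).
apply: (proj1 (omap_one _)); rewrite -(ten_oneK H) (cmpA (ten_sq _))
  (cmpA (mon_one Z)).
exact: (congr1 (fun g => g ∘ _) (mmap_eta F)).
Qed.

Definition omap_ten_mon (X Z : Monad D) (H : Interchanging M X (discrete B))
  (f : Hom (mbase X ⊠0[M] B) (mbase Z)) (a : cell f f (X ⊠ i) Z) :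
  @is_omap D ten_endo X Z f a -> MonadMap (ten_mon H) Z.
Proof.
move=> a_omap; apply: (@ten_on_map X (discrete B) H Z f a).
- exact: (proj2 (omap_mul a) (proj1 a_omap)).
- exact: (proj2 a_omap).
Defined.

Lemma box_disc_omap (X Z : Monad D) (F : MonadMap (box_disc N X B) Z)
  (f : Hom (mbase X ⊠0[M] B) (mbase Z)) : vmap F = f ->
  exists2 a : cell f f (X ⊠ i) Z, @is_omap D ten_endo X Z f a &
    mmap F = sq a.
Proof.
case: _ /; exists (mcell F); last by rewrite /mmap.
exact: (@ten_mon_omap X Z (interchanging_r N B X) F).
Qed.

Lemma omap_box_disc (X Z : Monad D) (f : Hom (mbase X ⊠0[M] B) (mbase Z))
  (a : cell f f (X ⊠ i) Z) : @is_omap D ten_endo X Z f a ->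
  exists2 F : MonadMap (box_disc N X B) Z, vmap F = f & mmap F = sq a.
Proof. by move=> a_omap; exists (omap_ten_mon (interchanging_r N B X) a_omap).
  Qed.

Lemma mmap_box_disc (X Y : Monad D) (G : MonadMap X Y) :
  mmap (box_disc_map N G (idm B)) = sq (ocell ten_endo (mcell G)).
Proof. by rewrite /mmap /= chid1. Qed.

(** The internal hom of [id_B] and the loop of [Z] in C_1 is restricted along [e] on both sides;
    evaluation after this lift is universal for [ten_endo], and creation applies. The parameter [e]
    serves two uses: the identity yields the right adjoint of [- · B], a representing object over
    [hom0] the internal hom of monads. *)
Lemma disc_hom_exists (Z : Monad D) (E : D) (e : Hom E (hom0 K B (mbase Z))) :
  exists (m : MonadOn E) (ev : MonadMap (box_disc N (MkMonad m) B) Z),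
    vmap ev = ev0 K B (mbase Z) ∘ tmap (ten0 M) e (idm B) /\
    forall (X : Monad D) (u : Hom (mbase X) E)
      (F : MonadMap (box_disc N X B) Z),
      vmap F = ev0 K B (mbase Z) ∘ tmap (ten0 M) (e ∘ u) (idm B) ->
      exists! G : MonadMap X (MkMonad m), vmap G = u /\
        @cmp (Mnd D) _ _ _ ev (box_disc_map N G (idm B)) = F.
Proof.
have [x [p p_univ]] := cell_lift fibrant (hom1 K i Z) e e.
pose c := ev1 K i Z • (p ⊠c vid i).
have c_univ : is_universal (T := ten_endo) c.
  move=> A A' y u v a.
  have [R [Ra R_uniq]] := hom1_universal (sq a : HOb y ⊗ HOb i ~> loop Z).
  (* The transpose [R] of [a] comes with unknown boundaries. Maps into [hom0] are determined by
     evaluation, which shows them to be [e ∘ u] and [e ∘ v], as the cartesian lift requires. *)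
  have Rl : lft R = e ∘ u.
    apply: hom0_inj; rewrite -[idm B]cmp1m (tmapM (laws0 M)) cmp1m cmpA.
    exact: (congr1 (@lft _ _ _ _ _ _ _) Ra).
  have Rr : rgt R = e ∘ v.
    apply: hom0_inj; rewrite -[idm B]cmp1m (tmapM (laws0 M)) cmp1m cmpA.
    exact: (congr1 (@rgt _ _ _ _ _ _ _) Ra).
  case: R Rl Rr Ra R_uniq => l r R /= Rl Rr.
  case: _ / (esym Rl) in R *; case: _ / (esym Rr) in R * => Ra R_uniq.
  have [s [sR s_uniq]] := p_univ _ _ _ _ _ R.
  have cE (t : cell u v y x) : sq c ∘ sq (ocell ten_endo t) =
      ev_sq i Z ∘ ((sq p ∘ sq t) ⊗m idm (HOb i : hcat D)).
    by rewrite (tmapMl (laws1 M)) cmpA.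
  exists s; split; first by refine (etrans (cE s) _); rewrite sR.
  move=> t et; apply: s_uniq; apply/esym/R_uniq.
  exact: (etrans (esym (cE t)) et).
have [m [ev [ev_omap ev_univ]]] := created_exists c_univ.
have [ev' ev'v ev'E] := omap_box_disc (X := MkMonad m) ev_omap.
have evE (X : Monad D) (G : MonadMap X (MkMonad m)) :
    mmap (@cmp (Mnd D) _ _ _ ev' (box_disc_map N G (idm B))) =
    sq ev ∘ sq (ocell ten_endo (mcell G)).
  by rewrite mmapM ev'E mmap_box_disc.
exists m, ev'; split=> // X u F Fu.
have [|a a_omap Fa] := @box_disc_omap _ _ F
  (ev0 K B (mbase Z) ∘ tmap (ten0 M) e (idm B) ∘ fmap ten_endo u).
  by rewrite Fu -cmpA -(tmapM (laws0 M)) cmp1m.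
have [G [[Gu GF] G_uniq]] := ev_univ X u a a_omap.
exists G; split.
  split; first exact: Gu.
  by apply: mmap_inj; rewrite Fa -GF; apply: evE.
move=> G' [G'u G'F]; apply: G_uniq; split=> //.
by rewrite -evE -Fa -G'F.
Qed.

End Endo.

(* A map of monads out of a tensor product, as a map of C_1 with its domain
   displayed as a tensor product. *)
Definition bmap (X W : Monad D) (B : D) (F : X · B → W) :
  loop X ⊗ disc B ~> loop W := mmap F.
Definition dmap (Y W : Monad D) (A : D) (F : disc_box N A Y → W) :
  disc A ⊗ loop Y ~> loop W := mmap F.
Definition bbmap (X W : Monad D) (B C : D) (F : X · B · C → W) :
  loop X ⊗ disc B ⊗ disc C ~> loop W := mmap F.
Definition bdmap (Y W : Monad D) (A C : D) (F : disc_box N A Y · C → W) :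
  disc A ⊗ loop Y ⊗ disc C ~> loop W := mmap F.
Definition dbmap (Y W : Monad D) (A C : D) (F : disc_box N A (Y · C) → W) :
  disc A ⊗ (loop Y ⊗ disc C) ~> loop W := mmap F.
Definition ddmap (Z W : Monad D) (A B : D)
  (F : disc_box N A (disc_box N B Z) → W) :
  disc A ⊗ (disc B ⊗ loop Z) ~> loop W := mmap F.

(** * Associativity and symmetry isomorphisms with discrete factors *)

Lemma ups_sq_iso (A B : D) : IsIso (ups_sq A B).
Proof. exact: sq_iso (ups_iso N A B). Qed.

(** The associator lands in [X ⊠ (Δ_B ⊠ Δ_C)], and [υ] as a monad map leads on to [X · (B ⊠ C)]. The
    interchange property of the middle term is transported along [υ]. *)
Lemma assoc_rr_exists (X : Monad D) (B C : D) :
  exists A : X · B · C → X · (B ⊠0[M] C),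
  inhabited (IsIso A) /\ forall (W : Monad D) (F : X · (B ⊠0[M] C) → W),
  bbmap (F ∘ A) =
    bmap F ∘ (idm (loop X) ⊗m ups_sq B C) ∘ α (loop X) (disc B) (disc C).
Proof.
pose H23 := interchanging_r N C (discrete_on B).
pose H2 : Interchanging M X (ten_on H23) :=
  interchanging_iso (b := ten_on H23) (b' := discrete_on (B ⊠0[M] C))
    (g1_iso X) (ups_iso N B C) (interchanging_r N (B ⊠0[M] C) X).
pose Q := @ten_mon X (@ten_mon (discrete B) (discrete C) H23) H2.
pose A1 : X · B · C → Q := @assoc_map X (discrete B) (discrete C)
  (interchanging_r N B X)
  (interchanging_r N C (X · B)) H23 H2.
pose A2 : Q → X · (B ⊠0[M] C) := @ten_map D M X X
  (ten_mon (X := discrete B) (Y := discrete C) H23)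
  (discrete (B ⊠0[M] C)) H2 (interchanging_r N (B ⊠0[M] C) X) (idm (X : Mnd D))
  (ups_map (A := B) (B := C) H23).
have A1_iso : IsIso A1.
  apply: mnd_iso; rewrite /mmap.
  exact: (tassoc_iso (laws1 M) (loop X) (disc B) (disc C)).
have A2_iso : IsIso A2.
  apply: mnd_iso; rewrite /mmap.
  exact: (tmap_iso (laws1 M) (iso_idm (loop X)) (ups_sq_iso B C)).
have A1E : mmap A1 = α (loop X) (disc B) (disc C) by [].
have A2E : mmap A2 = idm (loop X) ⊗m ups_sq B C by [].
exists (A2 ∘ A1); split; first by constructor; apply: (iso_cmp (C := Mnd D)).
move=> W F; transitivity (mmap F ∘ mmap A2 ∘ mmap A1).
  by rewrite -!mmapM -cmpA.
by rewrite A1E A2E.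
Qed.

Lemma assoc_lr_exists (Y : Monad D) (A C : D) :
  exists a : disc_box N A Y · C → disc_box N A (Y · C),
  inhabited (IsIso a) /\ forall (W : Monad D) (F : disc_box N A (Y · C) → W),
  bdmap (F ∘ a) = dbmap F ∘ α (disc A) (loop Y) (disc C).
Proof.
pose a : disc_box N A Y · C → disc_box N A (Y · C) :=
  @assoc_map (discrete A) Y (discrete C) (interchanging_l N A Y)
    (interchanging_r N C (disc_box N A Y)) (interchanging_r N C Y)
    (interchanging_l N A (Y · C)).
have a_iso : IsIso a.
  apply: mnd_iso; rewrite /mmap.
  exact: (tassoc_iso (laws1 M) (disc A) (loop Y) (disc C)).
have aE : mmap a = α (disc A) (loop Y) (disc C) by [].
exists a; split; first by constructor.
by move=> W F; transitivity (mmap F ∘ mmap a); [rewrite -mmapM | rewrite aE].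
Qed.

(** Here [υ] sits on the source, so its inverse enters the map; the formula is stated after
    precomposition with [υ] to avoid that inverse. *)
Lemma assoc_ll_exists (Z : Monad D) (A B : D) :
  exists a : disc_box N (A ⊠0[M] B) Z → disc_box N A (disc_box N B Z),
  inhabited (IsIso a) /\
  forall (W : Monad D) (F : disc_box N A (disc_box N B Z) → W),
  dmap (F ∘ a) ∘ (ups_sq A B ⊗m idm (loop Z)) =
    ddmap F ∘ α (disc A) (disc B) (loop Z).
Proof.
pose H12 := interchanging_l N A (discrete_on B).
pose H1 : Interchanging M (ten_on H12) Z :=
  interchanging_iso (a := ten_on H12) (a' := discrete_on (A ⊠0[M] B))
    (ups_iso N A B) (g1_iso Z) (interchanging_l N (A ⊠0[M] B) Z).
pose Q := @ten_mon (@ten_mon (discrete A) (discrete B) H12) Z H1.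
pose A1 : Q → disc_box N A (disc_box N B Z) :=
  @assoc_map (discrete A) (discrete B) Z H12 H1 (interchanging_l N B Z)
    (interchanging_l N A (disc_box N B Z)).
pose A2 : Q → disc_box N (A ⊠0[M] B) Z :=
  @ten_map D M (ten_mon (X := discrete A) (Y := discrete B) H12)
  (discrete (A ⊠0[M] B)) Z Z H1 (interchanging_l N (A ⊠0[M] B) Z)
  (ups_map (A := A) (B := B) H12) (idm (Z : Mnd D)).
have A1_iso : IsIso A1.
  apply: mnd_iso; rewrite /mmap.
  exact: (tassoc_iso (laws1 M) (disc A) (disc B) (loop Z)).
have A2_iso : IsIso A2.
  apply: mnd_iso; rewrite /mmap.
  exact: (tmap_iso (laws1 M) (ups_sq_iso A B) (iso_idm (loop Z))).
have A1E : mmap A1 = α (disc A) (disc B) (loop Z) by [].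
have A2E : mmap A2 = ups_sq A B ⊗m idm (loop Z) by [].
have [A2i i1 i2] := A2_iso.
exists (A1 ∘ A2i); split.
  by constructor; apply: (iso_cmp (C := Mnd D)) => //; exists A2.
move=> W F; transitivity (mmap (F ∘ (A1 ∘ A2i)) ∘ mmap A2);
  first by rewrite A2E.
by rewrite -mmapM -!cmpA i1 cmpm1 mmapM A1E.
Qed.

Definition braid_sq (X Y : hcat D) : X ⊗ Y ~> Y ⊗ X :=
  Sq (braid1 S (hm X) (hm Y)).

Lemma braid_br_exists (X : Monad D) (B : D) :
  exists b : X · B → disc_box N B X,
  inhabited (IsIso b) /\ forall (W : Monad D) (F : disc_box N B X → W),
  bmap (F ∘ b) = dmap F ∘ braid_sq (loop X) (disc B).
Proof.
pose b : X · B → disc_box N B X :=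
  @braid_map X (discrete B) (interchanging_r N B X) (interchanging_l N B X).
have b_iso : IsIso b.
  apply: mnd_iso; rewrite /mmap.
  exists (braid_sq (disc B) (loop X)).
    exact: (braid_inv (sym1 S) (loop X) (disc B)).
  exact: (braid_inv (sym1 S) (disc B) (loop X)).
have bE : mmap b = braid_sq (loop X) (disc B) by [].
exists b; split; first by constructor.
by move=> W F; transitivity (mmap F ∘ mmap b); [rewrite -mmapM | rewrite bE].
Qed.

Lemma braid_rb_exists (X : Monad D) (B : D) :
  exists b : disc_box N B X → X · B,
  inhabited (IsIso b) /\ forall (W : Monad D) (F : X · B → W),
  dmap (F ∘ b) = bmap F ∘ braid_sq (disc B) (loop X).
Proof.
pose b : disc_box N B X → X · B :=
  @braid_map (discrete B) X (interchanging_l N B X) (interchanging_r N B X).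
have b_iso : IsIso b.
  apply: mnd_iso; rewrite /mmap.
  exists (braid_sq (loop X) (disc B)).
    exact: (braid_inv (sym1 S) (disc B) (loop X)).
  exact: (braid_inv (sym1 S) (loop X) (disc B)).
have bE : mmap b = braid_sq (disc B) (loop X) by [].
exists b; split; first by constructor.
by move=> W F; transitivity (mmap F ∘ mmap b); [rewrite -mmapM | rewrite bE].
Qed.

(** * The universal property of the non-commuting tensor product *)

Definition incl (X Y : Monad D) : X · mbase Y → X □ Y := nc_inl N P X Y.
Definition incr (X Y : Monad D) : disc_box N (mbase X) Y → X □ Y :=
  nc_inr N P X Y.

Lemma vmap_incl (X Y : Monad D) : vmap (incl X Y) = idm _.
Proof. exact: (svalP (inj (nc_coproduct N P X Y) true)). Qed.

Lemma vmap_incr (X Y : Monad D) : vmap (incr X Y) = idm _.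
Proof. exact: (svalP (inj (nc_coproduct N P X Y) false)). Qed.

(** The vertical part of [H] is left implicit: the inclusions lie over identities, so
    [H ∘ incl X Y = F] determines it. *)
Lemma nc_universal (X Y Z : Monad D) (F : X · mbase Y → Z)
  (G : disc_box N (mbase X) Y → Z) : vmap F = vmap G ->
  exists! H : X □ Y → Z, H ∘ incl X Y = F /\ H ∘ incr X Y = G.
Proof.
move=> FG.
pose f (i : bool) : @Hom (Mnd D) (MkMonad (nc_summand N X Y i)) Z :=
  if i as i return @Hom (Mnd D) (MkMonad (nc_summand N X Y i)) Z
  then F else G.
have fE i : vmap (f i) = vmap F by case: i.
have [H [[Hv HE] H_uniq]] := fibre_coproduct fibrant (nc_coproduct N P X Y) fE.
exists H; split; first by split; [apply: (HE true) | apply: (HE false)].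
move=> H' [HF HG]; apply: H_uniq; split; last by case.
rewrite -HF; have -> : vmap (H' ∘ incl X Y) = vmap H' ∘ vmap (incl X Y) by [].
by rewrite vmap_incl cmpm1.
Qed.

Lemma nc_ext (X Y Z : Monad D) (H H' : X □ Y → Z) :
  H ∘ incl X Y = H' ∘ incl X Y -> H ∘ incr X Y = H' ∘ incr X Y -> H = H'.
Proof.
move=> el er.
have [|L [_ L_uniq]] := @nc_universal X Y Z (H ∘ incl X Y) (H ∘ incr X Y).
  have v (G : X · mbase Y → X □ Y) : vmap (H ∘ G) = vmap H ∘ vmap G by [].
  have v' (G : disc_box N (mbase X) Y → X □ Y) :
    vmap (H ∘ G) = vmap H ∘ vmap G by [].
  by rewrite v v' vmap_incl vmap_incr.
by rewrite -(L_uniq H) // (L_uniq H').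
Qed.

Definition i1 (X Y : Monad D) : loop X ⊗ disc (mbase Y) ~> loop (X □ Y) :=
  bmap (incl X Y).
Definition i2 (X Y : Monad D) : disc (mbase X) ⊗ loop Y ~> loop (X □ Y) :=
  dmap (incr X Y).

Lemma bmap_inj (X W : Monad D) (B : D) (F G : X · B → W) :
  bmap F = bmap G -> F = G.
Proof. by rewrite /bmap => e; apply: mmap_inj. Qed.

Lemma dmap_inj (Y W : Monad D) (A : D) (F G : disc_box N A Y → W) :
  dmap F = dmap G -> F = G.
Proof. by rewrite /dmap => e; apply: mmap_inj. Qed.

Lemma bmapM (X W W' : Monad D) (B : D) (H : W → W') (F : X · B → W) :
  bmap (H ∘ F) = mmap H ∘ bmap F.
Proof. by rewrite /bmap mmapM. Qed.

Lemma dmapM (Y W W' : Monad D) (A : D) (H : W → W') (F : disc_box N A Y → W) :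
  dmap (H ∘ F) = mmap H ∘ dmap F.
Proof. by rewrite /dmap mmapM. Qed.

Lemma bmap_box (X X' W : Monad D) (B B' : D) (F : X' · B' → W) (G : X → X')
  (g : Hom B B') :
  bmap (F ∘ box_disc_map N G g) = bmap F ∘ (mmap G ⊗m chid_sq g).
Proof. by rewrite /bmap mmapM. Qed.

Lemma dmap_box (Y Y' W : Monad D) (A A' : D) (F : disc_box N A' Y' → W)
  (f : Hom A A') (G : Y → Y') :
  dmap (F ∘ disc_box_map N f G) = dmap F ∘ (chid_sq f ⊗m mmap G).
Proof. by rewrite /dmap mmapM. Qed.

Lemma mmap_ext (X Y Z : Monad D) (H H' : X □ Y → Z) :
  mmap H ∘ i1 X Y = mmap H' ∘ i1 X Y -> mmap H ∘ i2 X Y = mmap H' ∘ i2 X Y ->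
  H = H'.
Proof.
move=> el er; apply: nc_ext.
  by apply: bmap_inj; rewrite !bmapM; apply: el.
by apply: dmap_inj; rewrite !dmapM; apply: er.
Qed.

Lemma nc_case_exists (X Y Z : Monad D) (F : X · mbase Y → Z)
  (G : disc_box N (mbase X) Y → Z) : vmap F = vmap G ->
  exists H : X □ Y → Z, mmap H ∘ i1 X Y = bmap F /\ mmap H ∘ i2 X Y = dmap G.
Proof.
move=> FG; have [H [[HF HG] _]] := nc_universal FG; exists H; split.
  by rewrite -HF bmapM.
by rewrite -HG dmapM.
Qed.

Lemma nc_map_exists (X X' Y Y' : Monad D) (F : X → X') (G : Y → Y') :
  exists H : X □ Y → X' □ Y',
  H ∘ incl X Y = incl X' Y' ∘ box_disc_map N F (vmap G) /\
  H ∘ incr X Y = incr X' Y' ∘ disc_box_map N (vmap F) G.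
Proof.
have [|H [HE _]] := @nc_universal X Y (X' □ Y')
    (incl X' Y' ∘ box_disc_map N F (vmap G))
    (incr X' Y' ∘ disc_box_map N (vmap F) G).
  have v : vmap (incl X' Y' ∘ box_disc_map N F (vmap G)) =
    vmap (incl X' Y') ∘ tmap (ten0 M) (vmap F) (vmap G) by [].
  have v' : vmap (incr X' Y' ∘ disc_box_map N (vmap F) G) =
    vmap (incr X' Y') ∘ tmap (ten0 M) (vmap F) (vmap G) by [].
  by rewrite v v' vmap_incl vmap_incr.
by exists H.
Qed.

Definition nc_map (X X' Y Y' : Mnd D) (F : X → X') (G : Y → Y') :
  X □ Y → X' □ Y' :=
  sval (constructive_indefinite_description _ (nc_map_exists F G)).

Lemma nc_map_action : @is_nc_action D M N P nc_map.
Proof.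
by move=> X X' Y Y' F G; rewrite /nc_map; case:
  constructive_indefinite_description.
Qed.

Lemma nc_map_l (X X' Y Y' : Mnd D) (F : X → X') (G : Y → Y') :
  mmap (nc_map F G) ∘ i1 X Y = i1 X' Y' ∘ (mmap F ⊗m chid_sq (vmap G)).
Proof. by rewrite /i1 -bmapM -bmap_box; congr bmap;
  case: (nc_map_action F G). Qed.

Lemma nc_map_r (X X' Y Y' : Mnd D) (F : X → X') (G : Y → Y') :
  mmap (nc_map F G) ∘ i2 X Y = i2 X' Y' ∘ (chid_sq (vmap F) ⊗m mmap G).
Proof. by rewrite /i2 -dmapM -dmap_box; congr dmap;
  case: (nc_map_action F G). Qed.

(** The right adjoint of [- · B]. The first clause serves to show that transposes of maps with equal
    vertical parts have equal vertical parts, as gluing demands. *)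
Lemma hom_disc_exists (B : D) (Z : Monad D) :
  exists (H : Monad D) (ev : H · B → Z),
  (forall (A : D) (u v : Hom A (mbase H)),
     vmap ev ∘ tmap (ten0 M) u (idm B) = vmap ev ∘ tmap (ten0 M) v (idm B) ->
     u = v) /\
  forall (X : Monad D) (F : X · B → Z),
    exists! G : X → H, ev ∘ box_disc_map N G (idm B) = F.
Proof.
have [m [ev [evv ev_univ]]] :=
  disc_hom_exists (idm (hom0 K B (mbase Z))).
have evv' : vmap ev = ev0 K B (mbase Z).
  by rewrite evv (tmap1 (laws0 M)) cmpm1.
exists (MkMonad m), ev; split.
  by move=> A u v; rewrite evv' => /hom0_inj.
move=> X F; have [u [uF _]] := hom0_universal (vmap F).
have [|G [[Gu GF] G_uniq]] := ev_univ X u F; first by rewrite cmp1m uF.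
exists G; split=> // G' G'F; apply: G_uniq; split=> //.
apply: (@hom0_inj); rewrite uF -G'F -evv'.
by [].
Qed.

Definition jointly_epic (I : Type) (X : I -> Monad D) (Y : Monad D)
    (k : forall i, X i → Y) : Prop :=
  forall (W : Monad D) (F F' : Y → W), (forall i, F ∘ k i = F' ∘ k i) -> F = F'.

Lemma box_disc_mapM (X Y Z W : Monad D) (B : D) (F : Z · B → W) (H : Y → Z)
  (G : X → Y) :
  F ∘ box_disc_map N (H ∘ G) (idm B) =
  F ∘ box_disc_map N H (idm B) ∘ box_disc_map N G (idm B).
Proof.
apply: bmap_inj; rewrite !bmap_box mmapM chid_sq1 (tmapMl (laws1 M)).
by rewrite cmpA.
Qed.

(* Tensoring with a discrete monad has a right adjoint, so that it preserves
   jointly epic families. *)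
Lemma jointly_epic_box (I : Type) (X : I -> Monad D) (Y : Monad D)
  (k : forall i, X i → Y) (B : D) : jointly_epic k ->
  jointly_epic (fun i => box_disc_map N (k i) (idm B)).
Proof.
move=> k_epic W F F' FF'; have [H [ev [_ ev_univ]]] := hom_disc_exists B W.
have [G [GF _]] := ev_univ Y F; have [G' [G'F _]] := ev_univ Y F'.
rewrite -GF -G'F; suff -> : G = G' by []; apply: k_epic => i.
have [L [_ L_uniq]] := ev_univ (X i) (F ∘ box_disc_map N (k i) (idm B)).
rewrite -(L_uniq (G ∘ k i)); last by rewrite box_disc_mapM GF.
by rewrite (L_uniq (G' ∘ k i)) // box_disc_mapM G'F FF'.
Qed.

Lemma bbmap_box (X X' W : Monad D) (B C : D) (F : X' · C → W) (G : X · B → X') :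
  bbmap (F ∘ box_disc_map N G (idm C)) = bmap F ∘ (bmap G ⊗m idm (disc C)).
Proof.
have e : bmap (F ∘ box_disc_map N G (idm C)) = bmap F
  ∘ (mmap G ⊗m idm (disc C)).
  by rewrite bmap_box chid_sq1.
by rewrite /bmap in e *; rewrite /bbmap; exact: e.
Qed.

Lemma bdmap_box (Y X' W : Monad D) (A C : D) (F : X' · C → W)
  (G : disc_box N A Y → X') :
  bdmap (F ∘ box_disc_map N G (idm C)) = bmap F ∘ (dmap G ⊗m idm (disc C)).
Proof.
have e : bmap (F ∘ box_disc_map N G (idm C)) = bmap F
  ∘ (mmap G ⊗m idm (disc C)).
  by rewrite bmap_box chid_sq1.
by rewrite /bmap in e *; rewrite /bdmap /dmap; exact: e.
Qed.

(** Both maps are transposed across [- · C], glued on [X □ Y], and the result is transposed back. *)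
Lemma box_case (X Y W : Monad D) (C : D) (F : X · mbase Y · C → W)
  (G : disc_box N (mbase X) Y · C → W) : vmap F = vmap G ->
  exists H : (X □ Y) · C → W,
    bmap H ∘ (i1 X Y ⊗m idm (disc C)) = bbmap F /\
    bmap H ∘ (i2 X Y ⊗m idm (disc C)) = bdmap G.
Proof.
move=> FG; have [H [ev [ev_inj ev_univ]]] := hom_disc_exists C W.
have [F' [F'E _]] := ev_univ _ F; have [G' [G'E _]] := ev_univ _ G.
have [|L [[LF LG] _]] := @nc_universal X Y H F' G'.
  apply: ev_inj; transitivity (vmap F); first by rewrite -F'E.
  by rewrite FG -G'E.
exists (ev ∘ box_disc_map N L (idm C)); rewrite bmap_box chid_sq1 -!cmpA.
rewrite -!(tmapMl (laws1 M)) -[mmap L ∘ i1 X Y]bmapM -[mmap L ∘ i2 X Y]dmapM LF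
  LG.
by rewrite -bbmap_box -bdmap_box F'E G'E.
Qed.

Lemma nc_jointly_epic (X Y : Monad D) :
  jointly_epic (fun b : bool =>
    if b as b return ((if b then X · mbase Y else disc_box N (mbase X) Y) →
      X □ Y)
    then incl X Y else incr X Y).
Proof.
by move=> W F F' FF'; apply: nc_ext => //; [apply: (FF' true) |
  apply: (FF' false)].
Qed.

Lemma box_ext (X Y W : Monad D) (C : D) (F F' : (X □ Y) · C → W) :
  F ∘ box_disc_map N (incl X Y) (idm C) = F' ∘ box_disc_map N (incl X Y)
    (idm C) ->
  F ∘ box_disc_map N (incr X Y) (idm C) = F' ∘ box_disc_map N (incr X Y)
    (idm C) ->
  F = F'.
Proof.
by move=> el er; apply: (jointly_epic_box (@nc_jointly_epic X Y)); case.
Qed.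

Lemma box_box_ext (X Y W : Monad D) (B C : D) (F F' : (X □ Y) · B · C → W) :
  let l := box_disc_map N (box_disc_map N (incl X Y) (idm B)) (idm C) in
  let r := box_disc_map N (box_disc_map N (incr X Y) (idm B)) (idm C) in
  F ∘ l = F' ∘ l -> F ∘ r = F' ∘ r -> F = F'.
Proof.
move=> l r el er.
by apply: (jointly_epic_box (jointly_epic_box (@nc_jointly_epic X Y))); case.
Qed.

Lemma mmap_box (X Y : Monad D) (C : D) (G : X → Y) :
  mmap (box_disc_map N G (idm C)) = mmap G ⊗m idm (disc C).
Proof. by rewrite -chid_sq1. Qed.

Lemma bbmap_inj (X W : Monad D) (B C : D) (F G : X · B · C → W) :
  bbmap F = bbmap G -> F = G.
Proof. by rewrite /bbmap => e; apply: mmap_inj. Qed.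

Lemma bdmap_inj (Y W : Monad D) (A C : D) (F G : disc_box N A Y · C → W) :
  bdmap F = bdmap G -> F = G.
Proof. by rewrite /bdmap => e; apply: mmap_inj. Qed.

(** In each component exactly one factor carries its own loop. The third passes through [υ], because
    [i2] sees the discrete monad on the tensor product of the bases while the associator of C_1 sees
    two identity loops. *)
Definition in1 (X Y Z : Monad D) :
  loop X ⊗ disc (mbase Y) ⊗ disc (mbase Z) ~> loop (X □ Y □ Z) :=
  i1 (X □ Y) Z ∘ (i1 X Y ⊗m idm (disc (mbase Z))).
Definition in2 (X Y Z : Monad D) :
  disc (mbase X) ⊗ loop Y ⊗ disc (mbase Z) ~> loop (X □ Y □ Z) :=
  i1 (X □ Y) Z ∘ (i2 X Y ⊗m idm (disc (mbase Z))).
Definition in3 (X Y Z : Monad D) :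
  disc (mbase X) ⊗ disc (mbase Y) ⊗ loop Z ~> loop (X □ Y □ Z) :=
  i2 (X □ Y) Z ∘ (ups_sq (mbase X) (mbase Y) ⊗m idm (loop Z)).

Lemma ext3 (X Y Z W : Monad D) (F F' : X □ Y □ Z → W) :
  mmap F ∘ in1 X Y Z = mmap F' ∘ in1 X Y Z ->
  mmap F ∘ in2 X Y Z = mmap F' ∘ in2 X Y Z ->
  mmap F ∘ in3 X Y Z = mmap F' ∘ in3 X Y Z -> F = F'.
Proof.
rewrite /in1 /in2 /in3 => e1 e2 e3; apply: mmap_ext => //.
  suff : F ∘ incl (X □ Y) Z = F' ∘ incl (X □ Y) Z.
    by move/(congr1 (fun G : X □ Y · mbase Z → W => bmap G)); rewrite !bmapM.
  apply: box_ext; apply: mmap_inj; rewrite !mmapM mmap_box -!cmpA.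
    exact: e1.
  exact: e2.
apply: (iso_epi (tmap_iso (laws1 M) (ups_sq_iso _ _) (iso_idm (loop Z)))).
by rewrite -!cmpA; exact: e3.
Qed.

(** The first three components are those of [X □ Y □ Z] tensored with the discrete monad on the base
    of [V], still jointly epic by the adjunction; the fourth carries the loop of [V]. *)
Lemma ext4 (X Y Z V W : Monad D) (F F' : X □ Y □ Z □ V → W) :
  let j := i1 (X □ Y □ Z) V in let d := idm (disc (mbase V)) in
  mmap F ∘ (j ∘ (in1 X Y Z ⊗m d)) = mmap F' ∘ (j ∘ (in1 X Y Z ⊗m d)) ->
  mmap F ∘ (j ∘ (in2 X Y Z ⊗m d)) = mmap F' ∘ (j ∘ (in2 X Y Z ⊗m d)) ->
  mmap F ∘ (j ∘ (in3 X Y Z ⊗m d)) = mmap F' ∘ (j ∘ (in3 X Y Z ⊗m d)) ->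
  mmap F ∘ (i2 (X □ Y □ Z) V ∘ ((ups_sq (mbase X ⊠0[M] mbase Y) (mbase Z)
    ∘ (ups_sq (mbase X) (mbase Y) ⊗m idm (disc (mbase Z)))) ⊗m idm (loop V))) =
  mmap F' ∘ (i2 (X □ Y □ Z) V ∘ ((ups_sq (mbase X ⊠0[M] mbase Y) (mbase Z)
    ∘ (ups_sq (mbase X) (mbase Y) ⊗m idm (disc (mbase Z)))) ⊗m idm (loop V))) ->
  F = F'.
Proof.
rewrite /in1 /in2 /in3 !(tmapMl (laws1 M)) => e1 e2 e3 e4.
apply: mmap_ext => //.
  suff : F ∘ incl (X □ Y □ Z) V = F' ∘ incl (X □ Y □ Z) V.
    move/(congr1 (fun G : X □ Y □ Z · mbase V → W => bmap G)).
    by rewrite !bmapM.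
  apply: box_ext.
    apply: box_box_ext; apply: mmap_inj; rewrite !mmapM !mmap_box -!cmpA.
      exact: e1.
    exact: e2.
  apply: mmap_inj; rewrite !mmapM mmap_box.
  apply: (iso_epi (tmap_iso (laws1 M) (tmap_iso (laws1 M)
    (ups_sq_iso _ _) (iso_idm (loop Z))) (iso_idm (disc (mbase V))))).
  by rewrite -!cmpA; exact: e3.
apply: (iso_epi (tmap_iso (laws1 M) (iso_cmp (ups_sq_iso _ _)
  (tmap_iso (laws1 M) (ups_sq_iso _ _) (iso_idm (disc (mbase Z)))))
  (iso_idm (loop V)))).
by rewrite (tmapMl (laws1 M)) -!cmpA; exact: e4.
Qed.

Definition out1 (X Y Z : Monad D) :
  loop X ⊗ (disc (mbase Y) ⊗ disc (mbase Z)) ~> loop (X □ (Y □ Z)) :=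
  i1 X (Y □ Z) ∘ (idm (loop X) ⊗m ups_sq (mbase Y) (mbase Z)).
Definition out2 (X Y Z : Monad D) :
  disc (mbase X) ⊗ (loop Y ⊗ disc (mbase Z)) ~> loop (X □ (Y □ Z)) :=
  i2 X (Y □ Z) ∘ (idm (disc (mbase X)) ⊗m i1 Y Z).
Definition out3 (X Y Z : Monad D) :
  disc (mbase X) ⊗ (disc (mbase Y) ⊗ loop Z) ~> loop (X □ (Y □ Z)) :=
  i2 X (Y □ Z) ∘ (idm (disc (mbase X)) ⊗m i2 Y Z).

Lemma braid_sq_nat (X X' Y Y' : hcat D) (F : X ~> X') (G : Y ~> Y') :
  braid_sq X' Y' ∘ (F ⊗m G) = (G ⊗m F) ∘ braid_sq X Y.
Proof. exact: (braid_nat (sym1 S) F G). Qed.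

Lemma braid_sqK (X Y : hcat D) : braid_sq Y X ∘ braid_sq X Y = idm (X ⊗ Y).
Proof. exact: (braid_inv (sym1 S) X Y). Qed.

(** The adjunction was established for [- ⊠ Δ_A]; the braiding carries its consequences over to
    [Δ_A ⊠ -], here and in [disc_case]. *)
Lemma disc_ext (Y Z W : Monad D) (A : D) (F F' : disc_box N A (Y □ Z) → W) :
  dmap F ∘ (idm (disc A) ⊗m i1 Y Z) = dmap F' ∘ (idm (disc A) ⊗m i1 Y Z) ->
  dmap F ∘ (idm (disc A) ⊗m i2 Y Z) = dmap F' ∘ (idm (disc A) ⊗m i2 Y Z) ->
  F = F'.
Proof.
move=> e1 e2.
have [b [[b_iso] bE]] := braid_br_exists (Y □ Z) A.
apply: (iso_epi (C := Mnd D) b_iso); apply: box_ext.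
  apply: bbmap_inj; rewrite !bbmap_box !bE -!cmpA.
  rewrite [braid_sq _ _ ∘ _]braid_sq_nat.
  by rewrite !cmpA; congr (_ ∘ _); exact: e1.
apply: bdmap_inj; rewrite !bdmap_box !bE -!cmpA.
rewrite [braid_sq _ _ ∘ _]braid_sq_nat.
by rewrite !cmpA; congr (_ ∘ _); exact: e2.
Qed.

Lemma disc_case (Y Z W : Monad D) (A : D)
  (F : disc_box N A (Y · mbase Z) → W)
  (G : disc_box N A (disc_box N (mbase Y) Z) → W) : vmap F = vmap G ->
  exists H : disc_box N A (Y □ Z) → W,
    dmap H ∘ (idm (disc A) ⊗m i1 Y Z) = dbmap F /\
    dmap H ∘ (idm (disc A) ⊗m i2 Y Z) = ddmap G.
Proof.
move=> FG.
have [b [_ bE]] := braid_br_exists (Y · mbase Z) A.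
have [c [_ cE]] := braid_br_exists (disc_box N (mbase Y) Z) A.
have [d [_ dE]] := braid_rb_exists (Y □ Z) A.
have [|H [HF HG]] := @box_case Y Z W A (F ∘ b) (G ∘ c).
  have l := congr1 (@lft _ _ _ _ _ _ _) (bE W F).
  have r := congr1 (@lft _ _ _ _ _ _ _) (cE W G).
  transitivity (vmap F ∘ braid0 S (mbase Y ⊠0[M] mbase Z) A); first exact: l.
  by rewrite FG; apply: esym; exact: r.
have HF' : bmap H ∘ (i1 Y Z ⊗m idm (disc A)) =
    dbmap F ∘ braid_sq (loop Y ⊗ disc (mbase Z)) (disc A).
  by refine (etrans HF _); exact: bE.
have HG' : bmap H ∘ (i2 Y Z ⊗m idm (disc A)) =
    ddmap G ∘ braid_sq (disc (mbase Y) ⊗ loop Z) (disc A).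
  by refine (etrans HG _); exact: cE.
exists (H ∘ d); rewrite dE -!cmpA !braid_sq_nat !cmpA HF' HG' -!cmpA !braid_sqK.
by rewrite !cmpm1.
Qed.

Lemma out_ext3 (X Y Z W : Monad D) (F F' : X □ (Y □ Z) → W) :
  mmap F ∘ out1 X Y Z = mmap F' ∘ out1 X Y Z ->
  mmap F ∘ out2 X Y Z = mmap F' ∘ out2 X Y Z ->
  mmap F ∘ out3 X Y Z = mmap F' ∘ out3 X Y Z -> F = F'.
Proof.
rewrite /out1 /out2 /out3 => e1 e2 e3; apply: mmap_ext => //.
  apply: (iso_epi (tmap_iso (laws1 M) (iso_idm (loop X)) (ups_sq_iso _ _))).
  by rewrite -!cmpA; exact: e1.
suff : F ∘ incr X (Y □ Z) = F' ∘ incr X (Y □ Z).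
  by move/(congr1 (fun G : disc_box N (mbase X) (Y □ Z) → W => dmap G));
    rewrite !dmapM.
by apply: disc_ext; rewrite !dmapM -!cmpA.
Qed.

(** * Symmetric monoidal structure *)

(** The left boundary of an equation in C_1 gives the vertical part of an induced monad map. These
    lemmas make the inclusions drop out of that computation. *)
Lemma lft_i1 (X Y : Monad D) : lft (i1 X Y) = idm _.
Proof. exact: vmap_incl. Qed.

Lemma lft_i2 (X Y : Monad D) : lft (i2 X Y) = idm _.
Proof. exact: vmap_incr. Qed.

Lemma lft_in1 (X Y Z : Monad D) : lft (in1 X Y Z) = idm _.
Proof.
transitivity (lft (i1 (X □ Y) Z) ∘ tmap (ten0 M) (lft (i1 X Y))
  (idm (mbase Z))).
  by [].
by rewrite !lft_i1 (tmap1 (laws0 M)) cmp1m.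
Qed.

Lemma lft_in2 (X Y Z : Monad D) : lft (in2 X Y Z) = idm _.
Proof.
transitivity (lft (i1 (X □ Y) Z) ∘ tmap (ten0 M) (lft (i2 X Y))
  (idm (mbase Z))).
  by [].
by rewrite !lft_i1 lft_i2 (tmap1 (laws0 M)) cmp1m.
Qed.

Lemma lft_in3 (X Y Z : Monad D) : lft (in3 X Y Z) = idm _.
Proof.
transitivity (lft (i2 (X □ Y) Z)
  ∘ tmap (ten0 M) (idm (mbase X ⊠0[M] mbase Y)) (idm (mbase Z))).
  by [].
by rewrite lft_i2 (tmap1 (laws0 M)) cmp1m.
Qed.

Lemma lft_out1 (X Y Z : Monad D) : lft (out1 X Y Z) = idm _.
Proof.
transitivity (lft (i1 X (Y □ Z))
  ∘ tmap (ten0 M) (idm (mbase X)) (idm (mbase Y ⊠0[M] mbase Z))).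
  by [].
by rewrite lft_i1 (tmap1 (laws0 M)) cmp1m.
Qed.

Lemma lft_out2 (X Y Z : Monad D) : lft (out2 X Y Z) = idm _.
Proof.
transitivity (lft (i2 X (Y □ Z)) ∘ tmap (ten0 M) (idm (mbase X))
  (lft (i1 Y Z))).
  by [].
by rewrite lft_i2 lft_i1 (tmap1 (laws0 M)) cmp1m.
Qed.

Lemma lft_out3 (X Y Z : Monad D) : lft (out3 X Y Z) = idm _.
Proof.
transitivity (lft (i2 X (Y □ Z)) ∘ tmap (ten0 M) (idm (mbase X))
  (lft (i2 Y Z))).
  by [].
by rewrite !lft_i2 (tmap1 (laws0 M)) cmp1m.
Qed.

Lemma dbmap_box (Y Y' W : Monad D) (A C : D) (F : disc_box N A Y' → W)
  (G : Y · C → Y') :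
  dbmap (F ∘ disc_box_map N (idm A) G) = dmap F ∘ (idm (disc A) ⊗m bmap G).
Proof.
have e : dmap (F ∘ disc_box_map N (idm A) G) = dmap F
  ∘ (idm (disc A) ⊗m mmap G).
  by rewrite dmap_box chid_sq1.
by rewrite /dmap in e *; rewrite /dbmap /bmap; exact: e.
Qed.

Lemma ddmap_box (Z Y' W : Monad D) (A B : D) (F : disc_box N A Y' → W)
  (G : disc_box N B Z → Y') :
  ddmap (F ∘ disc_box_map N (idm A) G) = dmap F ∘ (idm (disc A) ⊗m dmap G).
Proof.
have e : dmap (F ∘ disc_box_map N (idm A) G) = dmap F
  ∘ (idm (disc A) ⊗m mmap G).
  by rewrite dmap_box chid_sq1.
by rewrite /dmap in e *; rewrite /ddmap; exact: e.
Qed.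

Lemma nc_assoc_exists (X Y Z : Monad D) :
  exists a : X □ Y □ Z → X □ (Y □ Z),
  [/\ vmap a = α0 _ _ _, mmap a ∘ in1 X Y Z = out1 X Y Z ∘ α _ _ _,
    mmap a ∘ in2 X Y Z = out2 X Y Z ∘ α _ _ _ &
    mmap a ∘ in3 X Y Z = out3 X Y Z ∘ α _ _ _].
Proof.
pose A := mbase X; pose B := mbase Y; pose C := mbase Z.
have [a1 [_ a1E]] := assoc_rr_exists X B C.
have [a2 [_ a2E]] := assoc_lr_exists Y A C.
have [a3 [_ a3E]] := assoc_ll_exists Z A B.
pose F1 : X · B · C → X □ (Y □ Z) := incl X (Y □ Z) ∘ a1.
pose F2 : disc_box N A Y · C → X □ (Y □ Z) :=
  incr X (Y □ Z) ∘ disc_box_map N (idm A) (incl Y Z) ∘ a2.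
pose F3 : disc_box N (A ⊠0[M] B) Z → X □ (Y □ Z) :=
  incr X (Y □ Z) ∘ disc_box_map N (idm A) (incr Y Z) ∘ a3.
have F1E : bbmap F1 = out1 X Y Z ∘ α _ _ _ by exact: a1E.
have F2E : bdmap F2 = out2 X Y Z ∘ α _ _ _ by rewrite a2E dbmap_box.
have F3E : dmap F3 ∘ (ups_sq A B ⊗m idm (loop Z)) = out3 X Y Z ∘ α _ _ _.
  by rewrite a3E ddmap_box.
(* The three pieces can be glued because each lies over the associator of C_0. *)
have v1 : vmap F1 = α0 A B C.
  transitivity (lft (out1 X Y Z) ∘ α0 A B C).
    exact: (congr1 (@lft _ _ _ _ _ _ _) F1E).
  by rewrite lft_out1 cmp1m.
have v2 : vmap F2 = α0 A B C.
  transitivity (lft (out2 X Y Z) ∘ α0 A B C).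
    exact: (congr1 (@lft _ _ _ _ _ _ _) F2E).
  by rewrite lft_out2 cmp1m.
have v3 : vmap F3 = α0 A B C.
  rewrite -[LHS]cmpm1 -(tmap1 (laws0 M)).
  transitivity (lft (out3 X Y Z) ∘ α0 A B C).
    exact: (congr1 (@lft _ _ _ _ _ _ _) F3E).
  by rewrite lft_out3 cmp1m.
have [H [H1 H2]] := box_case (etrans v1 (esym v2)).
have vH : vmap H = α0 A B C.
  rewrite -[LHS]cmpm1 -(tmap1 (laws0 M)) -(lft_i1 X Y) -v1.
  exact: (congr1 (@lft _ _ _ _ _ _ _) H1).
have [a [Ha1 Ha2]] := nc_case_exists (X := X □ Y) (Y := Z)
  (etrans vH (esym v3)).
exists a; split.
- rewrite -[LHS]cmpm1 -(lft_i1 (X □ Y) Z) -vH.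
  exact: (congr1 (@lft _ _ _ _ _ _ _) Ha1).
- by rewrite -F1E -H1 -Ha1 -cmpA.
- by rewrite -F2E -H2 -Ha1 -cmpA.
- by rewrite -F3E -Ha2 -cmpA.
Qed.

Definition nc_assoc (X Y Z : Monad D) : X □ Y □ Z → X □ (Y □ Z) :=
  sval (constructive_indefinite_description _ (nc_assoc_exists X Y Z)).

Lemma nc_assocP (X Y Z : Monad D) :
  [/\ vmap (nc_assoc X Y Z) = α0 _ _ _,
    mmap (nc_assoc X Y Z) ∘ in1 X Y Z = out1 X Y Z ∘ α _ _ _,
    mmap (nc_assoc X Y Z) ∘ in2 X Y Z = out2 X Y Z ∘ α _ _ _ &
    mmap (nc_assoc X Y Z) ∘ in3 X Y Z = out3 X Y Z ∘ α _ _ _].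
Proof. by rewrite /nc_assoc; case: constructive_indefinite_description. Qed.

(** The other bracketing is glued in the opposite order: [disc_case] joins the second and third
    pieces, then the first is added. *)
Lemma nc_assoc_inverse_exists (X Y Z : Monad D) :
  exists b : X □ (Y □ Z) → X □ Y □ Z,
  [/\ mmap b ∘ out1 X Y Z ∘ α _ _ _ = in1 X Y Z,
    mmap b ∘ out2 X Y Z ∘ α _ _ _ = in2 X Y Z &
    mmap b ∘ out3 X Y Z ∘ α _ _ _ = in3 X Y Z].
Proof.
pose A := mbase X; pose B := mbase Y; pose C := mbase Z.
have [a1 [[[b1 b1a1 _]] a1E]] := assoc_rr_exists X B C.
have [a2 [[[b2 b2a2 _]] a2E]] := assoc_lr_exists Y A C.
have [a3 [[[b3 b3a3 _]] a3E]] := assoc_ll_exists Z A B.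
have αi E F G : IsIso (α E F G) := tassoc_iso (laws1 M) E F G.
have αv : lft (inv (αi (disc A) (disc B) (disc C))) ∘ α0 A B C = idm _.
  exact: (congr1 (@lft _ _ _ _ _ _ _) (inv_cmp
    (αi (disc A) (disc B) (disc C)))).
(* The vertical parts of the pieces are compared after the invertible [α0], where each becomes an
   identity. *)
have base (f g : Hom (A ⊠0[M] (B ⊠0[M] C)) (A ⊠0[M] B ⊠0[M] C)) :
    f ∘ α0 A B C = g ∘ α0 A B C -> f = g.
  exact: (iso_epi (tassoc_iso (laws0 M) A B C)).
pose F1 : X · (B ⊠0[M] C) → X □ Y □ Z :=
  incl (X □ Y) Z ∘ box_disc_map N (incl X Y) (idm C) ∘ b1.
pose F2 : disc_box N A (Y · C) → X □ Y □ Z :=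
  incl (X □ Y) Z ∘ box_disc_map N (incr X Y) (idm C) ∘ b2.
pose F3 : disc_box N A (disc_box N B Z) → X □ Y □ Z := incr (X □ Y) Z ∘ b3.
have F1E : bmap F1 ∘ (idm (loop X) ⊗m ups_sq B C) ∘ α _ _ _ = in1 X Y Z.
  by rewrite -a1E -cmpA b1a1 cmpm1 bbmap_box.
have F2E : dbmap F2 ∘ α _ _ _ = in2 X Y Z.
  by rewrite -a2E -cmpA b2a2 cmpm1 bdmap_box.
have F3E : ddmap F3 ∘ α _ _ _ = in3 X Y Z.
  by rewrite -a3E -cmpA b3a3 cmpm1.
have v1 : vmap F1 ∘ α0 A B C = idm _.
  rewrite -(lft_in1 X Y Z) -[vmap F1]cmpm1 -(tmap1 (laws0 M)).
  exact: (congr1 (@lft _ _ _ _ _ _ _) F1E).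
have v2 : vmap F2 ∘ α0 A B C = idm _.
  rewrite -(lft_in2 X Y Z).
  exact: (congr1 (@lft _ _ _ _ _ _ _) F2E).
have v3 : vmap F3 ∘ α0 A B C = idm _.
  rewrite -(lft_in3 X Y Z).
  exact: (congr1 (@lft _ _ _ _ _ _ _) F3E).
have v23 : vmap F2 = vmap F3 by apply: base; rewrite v2 v3.
have [H [H2 H3]] := disc_case v23.
have vH : vmap H = vmap F2.
  rewrite -[LHS]cmpm1 -(tmap1 (laws0 M)) -(lft_i1 Y Z).
  exact: (congr1 (@lft _ _ _ _ _ _ _) H2).
have v1H : vmap F1 = vmap H by rewrite vH; apply: base; rewrite v1 v2.
have [b [Hb1 Hb2]] := nc_case_exists (X := X) (Y := Y □ Z) v1H.
exists b; split.
- by rewrite -F1E -Hb1 (cmpA (mmap b)).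
- by rewrite -F2E -H2 -Hb2 (cmpA (mmap b)).
- by rewrite -F3E -H3 -Hb2 (cmpA (mmap b)).
Qed.

Lemma nc_assoc_iso (X Y Z : Monad D) : IsIso (nc_assoc X Y Z :
  @Hom (Mnd D) _ _).
Proof.
have [b [b1 b2 b3]] :=
  constructive_indefinite_description _ (nc_assoc_inverse_exists X Y Z).
have [_ a1 a2 a3] := nc_assocP X Y Z.
have αi E F G : IsIso (α E F G) := tassoc_iso (laws1 M) E F G.
exists b.
  by apply: ext3; rewrite mmapM -cmpA ?a1 ?a2 ?a3 cmpA ?b1 ?b2 ?b3 mmap1 cmp1m.
apply: (out_ext3).
- by apply: (iso_epi (αi _ _ _)); rewrite mmapM -(cmpA _ (mmap b))
  -(cmpA _ (mmap b ∘ _)) b1 a1 mmap1 cmp1m.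
- by apply: (iso_epi (αi _ _ _)); rewrite mmapM -(cmpA _ (mmap b))
  -(cmpA _ (mmap b ∘ _)) b2 a2 mmap1 cmp1m.
- by apply: (iso_epi (αi _ _ _)); rewrite mmapM -(cmpA _ (mmap b))
  -(cmpA _ (mmap b ∘ _)) b3 a3 mmap1 cmp1m.
Qed.

(** * Braiding and unit constraints *)

Lemma nc_braid_exists (X Y : Monad D) :
  exists b : X □ Y → Y □ X,
  [/\ vmap b = braid0 S _ _, mmap b ∘ i1 X Y = i2 Y X ∘ braid_sq _ _ &
    mmap b ∘ i2 X Y = i1 Y X ∘ braid_sq _ _].
Proof.
have [b [_ bE]] := braid_br_exists X (mbase Y).
have [c [_ cE]] := braid_rb_exists Y (mbase X).
have F1E : bmap (incr Y X ∘ b) = i2 Y X ∘ braid_sq _ _ by exact: bE.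
have F2E : dmap (incl Y X ∘ c) = i1 Y X ∘ braid_sq _ _ by exact: cE.
have v1 : vmap (incr Y X ∘ b) = braid0 S (mbase X) (mbase Y).
  transitivity (lft (i2 Y X) ∘ braid0 S (mbase X) (mbase Y)).
    exact: (congr1 (@lft _ _ _ _ _ _ _) F1E).
  by rewrite lft_i2 cmp1m.
have v2 : vmap (incl Y X ∘ c) = braid0 S (mbase X) (mbase Y).
  transitivity (lft (i1 Y X) ∘ braid0 S (mbase X) (mbase Y)).
    exact: (congr1 (@lft _ _ _ _ _ _ _) F2E).
  by rewrite lft_i1 cmp1m.
have [H [H1 H2]] := nc_case_exists (etrans v1 (esym v2)).
exists H; split.
- rewrite -[LHS]cmpm1 -(lft_i1 X Y) -v1.
  exact: (congr1 (@lft _ _ _ _ _ _ _) H1).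
- by rewrite H1 F1E.
- by rewrite H2 F2E.
Qed.

Definition nc_braid (X Y : Monad D) : X □ Y → Y □ X :=
  sval (constructive_indefinite_description _ (nc_braid_exists X Y)).

Lemma nc_braidP (X Y : Monad D) :
  [/\ vmap (nc_braid X Y) = braid0 S _ _,
    mmap (nc_braid X Y) ∘ i1 X Y = i2 Y X ∘ braid_sq _ _ &
    mmap (nc_braid X Y) ∘ i2 X Y = i1 Y X ∘ braid_sq _ _].
Proof. by rewrite /nc_braid; case: constructive_indefinite_description. Qed.

(** The existence half of initiality of a discrete monad in its fibre; multiplicativity comes from
    the left unit law of [X]. *)
Definition eta_map (X : Monad D) : discrete (mbase X) → X.
Proof.
apply: (@mk_mmap D (discrete (mbase X)) X (idm _) (meta X)).
  have e : sq (meta X ⋆ meta X) =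
      sq (meta X ⋆ vid X) ∘ sq (chid (idm _) ⋆ meta X).
    rewrite chid1 -sq_hcmpM; apply: sq_hcmp; symmetry.
      exact: vcmpm1.
    exact: vcmp1m.
  rewrite e cmpA mon_unitl; exact: (esym (sq_hlunit_nat _)).
by rewrite chid_sq1.
Defined.

(* A tensor product of discrete monads is discrete, hence initial in its fibre:
   maps out of it carry no data besides the vertical map. *)
Lemma bmap_discrete (A B : D) (W : Monad D) (F : discrete A · B → W) :
  bmap F = mon_one W ∘ (chid_sq (vmap F) ∘ ups_sq A B).
Proof.
have o : mon_one (discrete A · B) ∘ ups_sq A B = idm (disc A ⊗ disc B).
  refine (etrans (ten_oneK (X := discrete A) (Y := discrete B)
    (interchanging_r N B (discrete A))) _).
  exact: (tmap1 (laws1 M) (disc A) (disc B)).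
rewrite cmpA; transitivity (bmap F ∘ (mon_one (discrete A · B) ∘ ups_sq A B)).
  by rewrite o cmpm1.
by rewrite cmpA; exact: (congr1 (fun g => g ∘ ups_sq A B) (mmap_eta F)).
Qed.

Lemma dmap_discrete (A B : D) (W : Monad D) (F :
  disc_box N A (discrete B) → W) :
  dmap F = mon_one W ∘ (chid_sq (vmap F) ∘ ups_sq A B).
Proof.
have o : mon_one (disc_box N A (discrete B)) ∘ ups_sq A B =
  idm (disc A ⊗ disc B).
  refine (etrans (ten_oneK (X := discrete A) (Y := discrete B)
    (interchanging_l N A (discrete B))) _).
  exact: (tmap1 (laws1 M) (disc A) (disc B)).
rewrite cmpA.
transitivity (dmap F ∘ (mon_one (disc_box N A (discrete B)) ∘ ups_sq A B)).
  by rewrite o cmpm1.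
by rewrite cmpA; exact: (congr1 (fun g => g ∘ ups_sq A B) (mmap_eta F)).
Qed.

Lemma discrete_box_exists (A B : D) (W : Monad D)
  (f : Hom (A ⊠0[M] B) (mbase W)) :
  exists F : discrete A · B → W, vmap F = f.
Proof.
pose u : discrete A · B → discrete (A ⊠0[M] B) :=
  ups_map (A := A) (B := B) (interchanging_r N B (discrete A)).
pose g : discrete (A ⊠0[M] B) → discrete (mbase W) := discrete_map f.
exists (eta_map W ∘ (g ∘ u)).
transitivity (idm (mbase W) ∘ (f ∘ idm (A ⊠0[M] B))); first by [].
by rewrite cmp1m cmpm1.
Qed.

Lemma discrete_disc_box_exists (A B : D) (W : Monad D)
  (f : Hom (A ⊠0[M] B) (mbase W)) :
  exists F : disc_box N A (discrete B) → W, vmap F = f.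
Proof.
pose u : disc_box N A (discrete B) → discrete (A ⊠0[M] B) :=
  ups_map (A := A) (B := B) (interchanging_l N A (discrete B)).
pose g : discrete (A ⊠0[M] B) → discrete (mbase W) := discrete_map f.
exists (eta_map W ∘ (g ∘ u)).
transitivity (idm (mbase W) ∘ (f ∘ idm (A ⊠0[M] B))); first by [].
by rewrite cmp1m cmpm1.
Qed.

(** The summand [incl ΔI X] has a discrete source, so a map out of it is fixed by its vertical part,
    which the other summand shares. *)
Lemma unit_ext_l (X W : Monad D) (F F' : ΔI □ X → W) :
  F ∘ incr ΔI X = F' ∘ incr ΔI X -> F = F'.
Proof.
move=> e; apply: nc_ext => //; apply: bmap_inj; rewrite !bmap_discrete.
have v : vmap (F ∘ incl ΔI X) = vmap (F ∘ incr ΔI X).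
  transitivity (vmap F ∘ vmap (incl ΔI X)); first by [].
  by rewrite vmap_incl -(vmap_incr ΔI X).
have v' : vmap (F' ∘ incl ΔI X) = vmap (F' ∘ incr ΔI X).
  transitivity (vmap F' ∘ vmap (incl ΔI X)); first by [].
  by rewrite vmap_incl -(vmap_incr ΔI X).
by rewrite v v' e.
Qed.

Lemma unit_ext_r (X W : Monad D) (F F' : X □ ΔI → W) :
  F ∘ incl X ΔI = F' ∘ incl X ΔI -> F = F'.
Proof.
move=> e; apply: nc_ext => //; apply: dmap_inj; rewrite !dmap_discrete.
have v : vmap (F ∘ incr X ΔI) = vmap (F ∘ incl X ΔI).
  transitivity (vmap F ∘ vmap (incr X ΔI)); first by [].
  by rewrite vmap_incr -(vmap_incl X ΔI).
have v' : vmap (F' ∘ incr X ΔI) = vmap (F' ∘ incl X ΔI).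
  transitivity (vmap F' ∘ vmap (incr X ΔI)); first by [].
  by rewrite vmap_incr -(vmap_incl X ΔI).
by rewrite v v' e.
Qed.

Lemma lunit_exists (X : Monad D) :
  exists l : disc_box N I0 X → X, [/\ inhabited (IsIso l),
    vmap l = tlunit (con0 (dcon M)) (mbase X) &
    dmap l ∘ (iot_sq ⊗m idm (loop X)) = tlunit (con1 (dcon M)) (loop X)].
Proof.
pose l : disc_box N I0 X → X := lunit_map (X := X) (interchanging_l N I0 X).
have lE : dmap l ∘ (iot_sq ⊗m idm (loop X)) = tlunit (con1 (dcon M)) (loop X).
  exact: lunit_cellK X.
exists l; split=> //.
  have d_iso : IsIso (dmap l).
    apply: (iso_cancel_r lE); last exact: (tlunit_iso (laws1 M) (loop X)).
    exact: (tmap_iso (laws1 M) (iot_sq_iso) (iso_idm (loop X))).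
  by constructor; apply: mnd_iso; exact: d_iso.
rewrite -[LHS]cmpm1 -(tmap1 (laws0 M)).
exact: (congr1 (@lft _ _ _ _ _ _ _) lE).
Qed.

Lemma runit_exists (X : Monad D) :
  exists r : X · I0 → X, [/\ inhabited (IsIso r),
    vmap r = trunit (con0 (dcon M)) (mbase X) &
    bmap r ∘ (idm (loop X) ⊗m iot_sq) = trunit (con1 (dcon M)) (loop X)].
Proof.
pose r : X · I0 → X := runit_map (X := X) (interchanging_r N I0 X).
have rE : bmap r ∘ (idm (loop X) ⊗m iot_sq) = trunit (con1 (dcon M)) (loop X).
  exact: runit_cellK X.
exists r; split=> //.
  have b_iso : IsIso (bmap r).
    apply: (iso_cancel_r rE); last exact: (trunit_iso (laws1 M) (loop X)).
    exact: (tmap_iso (laws1 M) (iso_idm (loop X)) (iot_sq_iso)).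
  by constructor; apply: mnd_iso; exact: b_iso.
rewrite -[LHS]cmpm1 -(tmap1 (laws0 M)).
exact: (congr1 (@lft _ _ _ _ _ _ _) rE).
Qed.

(** The discrete summand contributes nothing new, so [incr ΔI X] followed by the extension of [l] is
    [l], and [incr ΔI X] after the inverse of [l] inverts that extension. *)
Lemma nc_lunit_exists (X : Monad D) :
  exists l : ΔI □ X → X, [/\ inhabited (IsIso l),
    vmap l = tlunit (con0 (dcon M)) (mbase X) &
    mmap l ∘ (i2 ΔI X ∘ (iot_sq ⊗m idm (loop X))) =
      tlunit (con1 (dcon M)) (loop X)].
Proof.
have [l [[[k kl lk]] lv lE]] := lunit_exists X.
have [F Fv] := discrete_box_exists (vmap l).
have [L [[LF Ll] _]] := @nc_universal ΔI X X F l Fv.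
exists L; split.
- constructor; exists (incr ΔI X ∘ k).
    by apply: unit_ext_l; rewrite -!cmpA Ll kl cmp1m cmpm1.
  by rewrite cmpA Ll lk.
- rewrite -lv -Ll; transitivity (vmap L ∘ vmap (incr ΔI X)); last by [].
  by rewrite vmap_incr cmpm1.
- by rewrite cmpA -dmapM Ll lE.
Qed.

Lemma nc_runit_exists (X : Monad D) :
  exists r : X □ ΔI → X, [/\ inhabited (IsIso r),
    vmap r = trunit (con0 (dcon M)) (mbase X) &
    mmap r ∘ (i1 X ΔI ∘ (idm (loop X) ⊗m iot_sq)) =
      trunit (con1 (dcon M)) (loop X)].
Proof.
have [r [[[k kr rk]] rv rE]] := runit_exists X.
have [F Fv] := discrete_disc_box_exists (vmap r).
have [R [[Rr RF] _]] := @nc_universal X ΔI X r F (esym Fv).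
exists R; split.
- constructor; exists (incl X ΔI ∘ k).
    by apply: unit_ext_r; rewrite -!cmpA Rr kr cmp1m cmpm1.
  by rewrite cmpA Rr rk.
- rewrite -rv -Rr; transitivity (vmap R ∘ vmap (incl X ΔI)); last by [].
  by rewrite vmap_incl cmpm1.
- by rewrite cmpA -bmapM Rr rE.
Qed.

(** The component with three identity loops, where only the vertical part of the associator is
    visible. It occurs in the pentagon when the factor carrying a loop lies outside an inner
    associator. *)
Lemma nc_assoc0 (X Y Z : Monad D) :
  chid_sq (vmap (nc_assoc X Y Z))
    ∘ (ups_sq (mbase X ⊠0[M] mbase Y) (mbase Z)
      ∘ (ups_sq (mbase X) (mbase Y) ⊗m idm (disc (mbase Z)))) =
  ups_sq (mbase X) (mbase Y ⊠0[M] mbase Z)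
    ∘ (idm (disc (mbase X)) ⊗m ups_sq (mbase Y) (mbase Z)) ∘ α _ _ _.
Proof. by have [-> _ _ _] := nc_assocP X Y Z; apply: sq_assoc_ups. Qed.

Lemma nc_assoc1 (X Y Z : Monad D) :
  mmap (nc_assoc X Y Z)
    ∘ (i1 (X □ Y) Z ∘ (i1 X Y ⊗m idm (disc (mbase Z)))) =
  i1 X (Y □ Z) ∘ (idm (loop X) ⊗m ups_sq (mbase Y) (mbase Z)) ∘ α _ _ _.
Proof. by have [] := nc_assocP X Y Z. Qed.

Lemma nc_assoc2 (X Y Z : Monad D) :
  mmap (nc_assoc X Y Z)
    ∘ (i1 (X □ Y) Z ∘ (i2 X Y ⊗m idm (disc (mbase Z)))) =
  i2 X (Y □ Z) ∘ (idm (disc (mbase X)) ⊗m i1 Y Z) ∘ α _ _ _.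
Proof. by have [] := nc_assocP X Y Z. Qed.

Lemma nc_assoc3 (X Y Z : Monad D) :
  mmap (nc_assoc X Y Z)
    ∘ (i2 (X □ Y) Z ∘ (ups_sq (mbase X) (mbase Y) ⊗m idm (loop Z))) =
  i2 X (Y □ Z) ∘ (idm (disc (mbase X)) ⊗m i2 Y Z) ∘ α _ _ _.
Proof. by have [] := nc_assocP X Y Z. Qed.

(** * Functoriality of [□] and coherence of its constraints *)

Lemma nc_map_vmap (X X' Y Y' : Mnd D) (F : X → X') (G : Y → Y') :
  vmap (nc_map F G) = tmap (ten0 M) (vmap F) (vmap G).
Proof.
rewrite -[LHS]cmpm1 -[RHS]cmp1m -(lft_i1 X Y) -(lft_i1 X' Y').
exact: (congr1 (@lft _ _ _ _ _ _ _) (nc_map_l F G)).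
Qed.

Lemma nc_map_ups (X X' Y Y' : Mnd D) (F : X → X') (G : Y → Y') :
  chid_sq (vmap (nc_map F G)) ∘ ups_sq (mbase X) (mbase Y) =
  ups_sq (mbase X') (mbase Y') ∘ (chid_sq (vmap F) ⊗m chid_sq (vmap G)).
Proof. by rewrite nc_map_vmap ups_sq_nat. Qed.

Lemma nc_map_1 (X X' Y : Mnd D) (F : X → X') :
  mmap (nc_map F (idm Y)) ∘ i1 X Y = i1 X' Y ∘ (mmap F ⊗m idm (disc (mbase Y))).
Proof. by rewrite nc_map_l -chid_sq1. Qed.

Lemma nc_map_2 (X X' Y : Mnd D) (F : X → X') :
  mmap (nc_map F (idm Y)) ∘ i2 X Y = i2 X' Y ∘ (chid_sq (vmap F) ⊗m idm
    (loop Y)).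
Proof. by rewrite nc_map_r. Qed.

Lemma nc_map_3 (X Y Y' : Mnd D) (G : Y → Y') :
  mmap (nc_map (idm X) G) ∘ i1 X Y = i1 X Y' ∘ (idm (loop X) ⊗m chid_sq
    (vmap G)).
Proof. by rewrite nc_map_l. Qed.

Lemma nc_map_4 (X Y Y' : Mnd D) (G : Y → Y') :
  mmap (nc_map (idm X) G) ∘ i2 X Y = i2 X Y' ∘ (idm (disc (mbase X)) ⊗m mmap G).
Proof. by rewrite nc_map_r -chid_sq1. Qed.

Lemma nc_map_id (X Y : Mnd D) : nc_map (idm X) (idm Y) = idm (X □ Y : Mnd D).
Proof.
apply: mmap_ext => //; rewrite mmap1 cmp1m.
  by rewrite nc_map_1 mmap1 (tmap1 (laws1 M)) cmpm1.
by rewrite nc_map_4 mmap1 (tmap1 (laws1 M)) cmpm1.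
Qed.

Lemma nc_mapM (X X' X'' Y Y' Y'' : Mnd D) (F' : X' → X'') (F : X → X')
  (G' : Y' → Y'') (G : Y → Y') :
  nc_map (F' ∘ F) (G' ∘ G) = nc_map F' G' ∘ nc_map F G.
Proof.
apply: mmap_ext => //; rewrite mmapM -!cmpA.
  rewrite !nc_map_l cmpA nc_map_l -cmpA -(tmapM (laws1 M)) -chid_sqM.
  by rewrite mmapM.
rewrite !nc_map_r cmpA nc_map_r -cmpA -(tmapM (laws1 M)) -chid_sqM.
by rewrite mmapM.
Qed.

Lemma nc_assoc_nat (X X' Y Y' Z Z' : Mnd D) (F : X → X') (G : Y → Y')
  (H : Z → Z') :
  nc_assoc X' Y' Z' ∘ nc_map (nc_map F G) H =
  nc_map F (nc_map G H) ∘ nc_assoc X Y Z.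
Proof.
apply: ext3; rewrite !mmapM.
- exact: (assoc_nat_on (laws1 M) (nc_assoc1 X Y Z) (nc_assoc1 X' Y' Z')
    (nc_map_l F G) (nc_map_l (nc_map F G) H)
    (nc_map_ups G H) (nc_map_l F (nc_map G H))).
- exact: (assoc_nat_on (laws1 M) (nc_assoc2 X Y Z) (nc_assoc2 X' Y' Z')
    (nc_map_r F G) (nc_map_l (nc_map F G) H)
    (nc_map_l G H) (nc_map_r F (nc_map G H))).
- exact: (assoc_nat_on (laws1 M) (nc_assoc3 X Y Z) (nc_assoc3 X' Y' Z')
    (nc_map_ups F G) (nc_map_r (nc_map F G) H)
    (nc_map_r G H) (nc_map_r F (nc_map G H))).
Qed.

Lemma nc_pentagon (X Y Z V : Mnd D) :
  nc_assoc X Y (Z □ V) ∘ nc_assoc (X □ Y) Z V =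
  nc_map (idm X) (nc_assoc Y Z V) ∘ nc_assoc X (Y □ Z) V
    ∘ nc_map (nc_assoc X Y Z) (idm V).
Proof.
apply: (ext4); rewrite !mmapM.
- exact: (pentagon_on (laws1 M) (nc_assoc1 X Y Z) (nc_assoc0 Y Z V)
    (nc_assoc1 (X □ Y) Z V) (nc_assoc1 X Y (Z □ V)) (nc_assoc1 X (Y □ Z) V)
    (nc_map_1 _ _) (nc_map_3 _ _)).
- exact: (pentagon_on (laws1 M) (nc_assoc2 X Y Z) (nc_assoc1 Y Z V)
    (nc_assoc1 (X □ Y) Z V) (nc_assoc2 X Y (Z □ V)) (nc_assoc2 X (Y □ Z) V)
    (nc_map_1 _ _) (nc_map_4 _ _)).
- exact: (pentagon_on (laws1 M) (nc_assoc3 X Y Z) (nc_assoc2 Y Z V)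
    (nc_assoc2 (X □ Y) Z V) (nc_assoc3 X Y (Z □ V)) (nc_assoc2 X (Y □ Z) V)
    (nc_map_1 _ _) (nc_map_4 _ _)).
- exact: (pentagon_on (laws1 M) (nc_assoc0 X Y Z) (nc_assoc3 Y Z V)
    (nc_assoc3 (X □ Y) Z V) (nc_assoc3 X Y (Z □ V)) (nc_assoc3 X (Y □ Z) V)
    (nc_map_2 _ _) (nc_map_4 _ _)).
Qed.

Lemma nc_braid_0 (X Y : Mnd D) :
  chid_sq (vmap (nc_braid X Y)) ∘ ups_sq (mbase X) (mbase Y) =
  ups_sq (mbase Y) (mbase X) ∘ braid_sq _ _.
Proof. have [-> _ _] := nc_braidP X Y; exact: braid_ups. Qed.

Lemma nc_braid_1 (X Y : Mnd D) :
  mmap (nc_braid X Y) ∘ i1 X Y = i2 Y X ∘ braid_sq _ _.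
Proof. by have [] := nc_braidP X Y. Qed.

Lemma nc_braid_2 (X Y : Mnd D) :
  mmap (nc_braid X Y) ∘ i2 X Y = i1 Y X ∘ braid_sq _ _.
Proof. by have [] := nc_braidP X Y. Qed.

Lemma nc_braid_nat (X X' Y Y' : Mnd D) (F : X → X') (G : Y → Y') :
  nc_braid X' Y' ∘ nc_map F G = nc_map G F ∘ nc_braid X Y.
Proof.
apply: mmap_ext => //; rewrite !mmapM -!cmpA.
  rewrite nc_map_l nc_braid_1 !cmpA nc_map_r nc_braid_1 -!cmpA.
  by rewrite braid_sq_nat.
rewrite nc_map_r nc_braid_2 !cmpA nc_map_l nc_braid_2 -!cmpA.
by rewrite braid_sq_nat.
Qed.

Lemma nc_braidK (X Y : Mnd D) : nc_braid Y X ∘ nc_braid X Y =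
  idm (X □ Y : Mnd D).
Proof.
apply: mmap_ext => //; rewrite !mmapM mmap1 cmp1m -!cmpA.
  by rewrite nc_braid_1 cmpA nc_braid_2 -cmpA braid_sqK cmpm1.
by rewrite nc_braid_2 cmpA nc_braid_1 -cmpA braid_sqK cmpm1.
Qed.

Lemma nc_hexagon (X Y Z : Mnd D) :
  nc_assoc Y Z X ∘ nc_braid X (Y □ Z) ∘ nc_assoc X Y Z =
  nc_map (idm Y) (nc_braid X Z) ∘ nc_assoc Y X Z
    ∘ nc_map (nc_braid X Y) (idm Z).
Proof.
apply: ext3; rewrite !mmapM.
- exact: (hexagon_on (laws1 M) (sym1 S) (nc_assoc1 X Y Z) (nc_braid_1 X (Y □ Z))
    (nc_assoc3 Y Z X) (nc_braid_1 X Y) (nc_map_1 _ _) (nc_assoc2 Y X Z)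
    (nc_braid_1 X Z) (nc_map_4 _ _)).
- exact: (hexagon_on (laws1 M) (sym1 S) (nc_assoc2 X Y Z) (nc_braid_2 X (Y □ Z))
    (nc_assoc1 Y Z X) (nc_braid_2 X Y) (nc_map_1 _ _) (nc_assoc1 Y X Z)
    (nc_braid_0 X Z) (nc_map_3 _ _)).
- exact: (hexagon_on (laws1 M) (sym1 S) (nc_assoc3 X Y Z) (nc_braid_2 X (Y □ Z))
    (nc_assoc2 Y Z X) (nc_braid_0 X Y) (nc_map_2 _ _) (nc_assoc3 Y X Z)
    (nc_braid_2 X Z) (nc_map_4 _ _)).
Qed.

Definition nc_lunit (X : Monad D) : ΔI □ X → X :=
  sval (constructive_indefinite_description _ (nc_lunit_exists X)).

Lemma nc_lunitP (X : Monad D) :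
  [/\ inhabited (IsIso (nc_lunit X)),
    vmap (nc_lunit X) = tlunit (con0 (dcon M)) (mbase X) &
    mmap (nc_lunit X) ∘ (i2 ΔI X ∘ (iot_sq ⊗m idm (loop X))) =
      tlunit (con1 (dcon M)) (loop X)].
Proof. by rewrite /nc_lunit; case: constructive_indefinite_description. Qed.

Definition nc_runit (X : Monad D) : X □ ΔI → X :=
  sval (constructive_indefinite_description _ (nc_runit_exists X)).

Lemma nc_runitP (X : Monad D) :
  [/\ inhabited (IsIso (nc_runit X)),
    vmap (nc_runit X) = trunit (con0 (dcon M)) (mbase X) &
    mmap (nc_runit X) ∘ (i1 X ΔI ∘ (idm (loop X) ⊗m iot_sq)) =
      trunit (con1 (dcon M)) (loop X)].
Proof. by rewrite /nc_runit; case: constructive_indefinite_description. Qed.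

Lemma nc_lunit_nat (X X' : Mnd D) (F : X → X') :
  nc_lunit X' ∘ nc_map (idm (ΔI : Mnd D)) F = F ∘ nc_lunit X.
Proof.
have [_ _ lE] := nc_lunitP X; have [_ _ lE'] := nc_lunitP X'.
apply: (unit_ext_l); apply: dmap_inj; rewrite !dmapM.
apply: (iso_epi (tmap_iso (laws1 M) (iot_sq_iso) (iso_idm (loop X)))).
transitivity (mmap F ∘ tlunit (con1 (dcon M)) (loop X)).
  rewrite mmapM -(cmpA (mmap (nc_lunit X'))) [mmap _ ∘ dmap _]nc_map_4.
  rewrite -!cmpA -(tmapM (laws1 M)) cmp1m cmpm1.
  rewrite -[iot_sq in LHS]cmpm1 -[mmap F in LHS]cmp1m (tmapM (laws1 M)).
  by rewrite (cmpA (i2 ΔI X')) cmpA lE' (tlunit_nat (laws1 M)).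
by rewrite mmapM -!cmpA -lE.
Qed.

Lemma nc_runit_nat (X X' : Mnd D) (F : X → X') :
  nc_runit X' ∘ nc_map F (idm (ΔI : Mnd D)) = F ∘ nc_runit X.
Proof.
have [_ _ rE] := nc_runitP X; have [_ _ rE'] := nc_runitP X'.
apply: (unit_ext_r); apply: bmap_inj; rewrite !bmapM.
apply: (iso_epi (tmap_iso (laws1 M) (iso_idm (loop X)) (iot_sq_iso))).
transitivity (mmap F ∘ trunit (con1 (dcon M)) (loop X)).
  rewrite mmapM -(cmpA (mmap (nc_runit X'))) [mmap _ ∘ bmap _]nc_map_1.
  rewrite -!cmpA -(tmapM (laws1 M)) cmp1m cmpm1.
  rewrite -[iot_sq in LHS]cmpm1 -[mmap F in LHS]cmp1m (tmapM (laws1 M)).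
  by rewrite (cmpA (i1 X' ΔI)) cmpA rE' (trunit_nat (laws1 M)).
by rewrite mmapM -!cmpA -rE.
Qed.

(** The middle component consists of identity loops and is forced by the others: [incl X ΔI] alone
    is epic, and this survives tensoring with a discrete monad. *)
Lemma unit_ext3 (X Y W : Monad D) (F F' : X □ ΔI □ Y → W) :
  mmap F ∘ in1 X ΔI Y = mmap F' ∘ in1 X ΔI Y ->
  mmap F ∘ in3 X ΔI Y = mmap F' ∘ in3 X ΔI Y -> F = F'.
Proof.
rewrite /in1 /in3 => e1 e3; apply: (mmap_ext).
  suff : F ∘ incl (X □ ΔI) Y = F' ∘ incl (X □ ΔI) Y.
    by move/(congr1 (fun G : X □ ΔI · mbase Y → W => bmap G)); rewrite !bmapM.
  have k_epic : jointly_epic (fun _ : unit => incl X ΔI).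
    by move=> V G G' /(_ tt); apply: (unit_ext_r).
  apply: (jointly_epic_box k_epic) => _.
  by apply: mmap_inj; rewrite !mmapM mmap_box -!cmpA; exact: e1.
apply: (iso_epi (tmap_iso (laws1 M) (ups_sq_iso _ _) (iso_idm (loop Y)))).
by rewrite -!cmpA; exact: e3.
Qed.

Lemma clunit_ups_sq (A : D) :
  chid_sq (tlunit (con0 (dcon M)) A) ∘ (ups_sq I0 A
    ∘ (iot_sq ⊗m idm (disc A))) =
  tlunit (con1 (dcon M)) (disc A).
Proof. by rewrite cmpA; exact: clunit_ups. Qed.

Lemma crunit_ups_sq (A : D) :
  chid_sq (trunit (con0 (dcon M)) A) ∘ (ups_sq A I0
    ∘ (idm (disc A) ⊗m iot_sq)) =
  trunit (con1 (dcon M)) (disc A).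
Proof. by rewrite cmpA; exact: crunit_ups. Qed.

Lemma nc_triangle (X Y : Mnd D) :
  nc_map (idm X) (nc_lunit Y) ∘ nc_assoc X ΔI Y = nc_map (nc_runit X) (idm Y).
Proof.
have [_ lv lE] := nc_lunitP Y; have [_ rv rE] := nc_runitP X.
(* On each component one of the two factors [X], [Y] is discrete; there the unit law of [υ] and [ι]
   takes the place of the law for the unit constraint of [□]. *)
have l0 := clunit_ups_sq (mbase Y); rewrite -lv in l0.
have r0 := crunit_ups_sq (mbase X); rewrite -rv in r0.
have iX := tmap_iso (laws1 M) (iso_idm (loop X)) (iot_sq_iso).
have iA := tmap_iso (laws1 M) (iso_idm (disc (mbase X))) (iot_sq_iso).
apply: unit_ext3; rewrite mmapM.
- apply: (iso_epi (tmap_iso (laws1 M) iX (iso_idm (disc (mbase Y))))).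
  have e := triangle_on (laws1 M) (nc_assoc1 X ΔI Y) rE l0
    (nc_map_1 Y (nc_runit X))
    (nc_map_3 X (nc_lunit Y)).
  by rewrite (tmapMl (laws1 M)) !cmpA in e; rewrite /in1 !cmpA; exact: e.
- apply: (iso_epi (tmap_iso (laws1 M) iA (iso_idm (loop Y)))).
  have e := triangle_on (laws1 M) (nc_assoc3 X ΔI Y) r0 lE
    (nc_map_2 Y (nc_runit X))
    (nc_map_4 X (nc_lunit Y)).
  by rewrite (tmapMl (laws1 M)) !cmpA in e; rewrite /in3 !cmpA; exact: e.
Qed.

Definition nc_ten : Tensor (Mnd D) :=
  @MkTensor (Mnd D) (nc_tensor N P) nc_map ΔI.

Definition nc_constraints : Constraints nc_ten :=
  @MkConstraints (Mnd D) nc_ten nc_assoc nc_lunit nc_runit.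

(** [IsIso] carries its inverse as data; choosing an element under the trivial predicate extracts it
    from a proof that one exists. *)
Lemma iso_inhabited (C : Category) (A B : C) (f : Hom A B) :
  inhabited (IsIso f) -> IsIso f.
Proof.
move=> i; apply: (proj1_sig (constructive_indefinite_description (fun _ => True)
  _)).
by case: i => i; exists i.
Qed.

Definition nc_laws : MonoidalLaws nc_constraints.
Proof.
split.
- exact: nc_map_id.
- by move=> *; apply: nc_mapM.
- exact: nc_assoc_iso.
- by move=> *; apply: nc_assoc_nat.
- by move=> X; apply: iso_inhabited; have [] := nc_lunitP X.
- exact: nc_lunit_nat.
- by move=> X; apply: iso_inhabited; have [] := nc_runitP X.
- exact: nc_runit_nat.
- exact: nc_pentagon.
- exact: nc_triangle.
Qed.

Definition nc_symmetry : @SymmetryLaws _ _ nc_constraints nc_braid.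
Proof.
split.
- by move=> *; apply: nc_braid_nat.
- exact: nc_braidK.
- exact: nc_hexagon.
Qed.

(** * Internal homs *)

(* Maps of C_1 out of [id_A ⊠ y], for varying A, are represented by the tabulator
   of the internal hom of C_1. *)
Lemma disc_representable (B B' C C' : D) (y : hmap B B') (z : hmap C C') :
  exists (T : D) (t : disc T ⊗ HOb y ~> HOb z),
  forall (A : D) (F : disc A ⊗ HOb y ~> HOb z),
    exists! h : Hom A T, t ∘ (chid_sq h ⊗m idm (HOb y : hcat D)) = F.
Proof.
case: tabulators => G [eps [R]].
have eps_univ : has_counit (eps (HOb (hom1 K y z))) by exact: adjoint_counit R
  _.
exists (G (HOb (hom1 K y z))), (ev_sq y z ∘ (eps (HOb (hom1 K y z)) ⊗m idm _)).
move=> A F; have [U [UF U_uniq]] := hom1_universal F.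
have [h [hU h_uniq]] := eps_univ A U.
have tE (k : Hom A (G (HOb (hom1 K y z)))) :
    ev_sq y z ∘ (eps (HOb (hom1 K y z)) ⊗m idm _)
      ∘ (chid_sq k ⊗m idm (HOb y : hcat D)) =
    ev_sq y z ∘ ((eps (HOb (hom1 K y z)) ∘ chid_sq k) ⊗m idm _).
  by rewrite (tmapMl (laws1 M)) cmpA.
exists h; split; first by rewrite tE -UF -hU.
by move=> k; rewrite tE => /U_uniq kU; apply: h_uniq; rewrite -kU.
Qed.

Section MonadMaps.
Variables (Y Z : Monad D).
Local Notation B := (mbase Y).
Local Notation C := (mbase Z).
Local Notation li A := (sq (ginv (hlunit_iso (hid A)))).

Lemma comul_disc_nat (A A' : D) (h : Hom A' A) :
  li A ∘ chid_sq h = sq (chid h ⋆ chid h) ∘ li A'.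
Proof.
apply: (iso_mono (sq_iso (hlunit_iso (hid A)))).
rewrite cmpA -sq_gcmp gKinv [RHS]cmpA sq_hlunit_nat -cmpA -sq_gcmp gKinv.
by rewrite !sq_vid cmpm1 cmp1m.
Qed.

Section Cell.
Variables (A : D) (f : Hom (A ⊠0[M] B) C) (g : cell f f (hid A ⊠ Y) Z).

(** The two sides of each monad map law are written as maps out of [id_A ⊠ -], the unitor of [id_A]
    being moved to the right. In this shape [disc_representable] turns each side into a vertical map
    out of [A], and the law into an equation for an equaliser. *)
Definition cell_mul_l : disc A ⊗ HOb (Y ⊙ Y) ~> loop Z :=
  ten_sq g ∘ (idm (disc A) ⊗m mon_mul Y).
Definition cell_mul_r : disc A ⊗ HOb (Y ⊙ Y) ~> loop Z :=
  mon_mul Z ∘ (sq (g ⋆ g)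
    ∘ (xi_sq (hid A) (hid A) Y Y ∘ (li A ⊗m idm (HOb (Y ⊙ Y) : hcat D)))).
Definition cell_one_l : disc A ⊗ disc B ~> loop Z :=
  ten_sq g ∘ (idm (disc A) ⊗m mon_one Y).
Definition cell_one_r : disc A ⊗ disc B ~> loop Z :=
  mon_one Z ∘ (chid_sq f ∘ ups_sq A B).

Lemma cell_mulP :
  ten_sq g ∘ (mon_mul (discrete A) ⊗m mon_mul Y) =
    mon_mul Z ∘ (sq (g ⋆ g) ∘ xi_sq (hid A) (hid A) Y Y) <->
  cell_mul_l = cell_mul_r.
Proof.
apply: (counit_transfer_l (laws1 M)); first by rewrite -sq_gcmp gKinv.
by rewrite -sq_gcmp ginvK.
Qed.

Lemma cell_disc_box : cell_mul_l = cell_mul_r -> cell_one_l = cell_one_r ->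
  exists G : disc_box N A Y → Z, dmap G = ten_sq g.
Proof.
move=> /cell_mulP mu eta.
by exists (@ten_on_map (discrete A) Y (interchanging_l N A Y) Z f g mu eta).
Qed.

End Cell.

Section CellNaturality.
Variables (A A' : D) (h : Hom A' A).
Variables (f : Hom (A ⊠0[M] B) C) (g : cell f f (hid A ⊠ Y) Z).
Variables (f' : Hom (A' ⊠0[M] B) C) (g' : cell f' f' (hid A' ⊠ Y) Z).
Hypothesis g'E : ten_sq g' = ten_sq g ∘ (chid_sq h ⊗m idm (loop Y)).

Lemma cell_base : f' = f ∘ tmap (ten0 M) h (idm B).
Proof. exact: (congr1 (@lft _ _ _ _ _ _ _) g'E). Qed.

(** Both sides of the laws are natural in [A]. Hence the sides for a cell restricted from a generic
    one along [h] are represented by the generic sides composed with [h]. *)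
Lemma cell_mul_l_nat :
  cell_mul_l g' = cell_mul_l g ∘ (chid_sq h ⊗m idm (HOb (Y ⊙ Y) : hcat D)).
Proof.
by rewrite /cell_mul_l g'E -!cmpA -!(tmapM (laws1 M)) !cmp1m !cmpm1.
Qed.

Lemma cell_one_l_nat :
  cell_one_l g' = cell_one_l g ∘ (chid_sq h ⊗m idm (disc B)).
Proof.
by rewrite /cell_one_l g'E -!cmpA -!(tmapM (laws1 M)) !cmp1m !cmpm1.
Qed.

Lemma cell_mul_r_nat :
  cell_mul_r g' = cell_mul_r g ∘ (chid_sq h ⊗m idm (HOb (Y ⊙ Y) : hcat D)).
Proof.
have e : sq g' = sq (g • (chid h ⊠c vid Y)) by exact: g'E.
rewrite /cell_mul_r (sq_hcmp e e) sq_hcmpM -!cmpA; do 2!congr (_ ∘ _).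
rewrite (cmpA (sq (_ ⋆ _))) -sq_xi_nat chcmp1 -!cmpA; congr (_ ∘ _).
by rewrite -!(tmapM (laws1 M)) !cmpm1 comul_disc_nat.
Qed.

Lemma cell_one_r_nat :
  cell_one_r f' = cell_one_r f ∘ (chid_sq h ⊗m idm (disc B)).
Proof.
rewrite /cell_one_r cell_base chid_sqM -!cmpA; do 2!congr (_ ∘ _).
by rewrite -ups_sq_nat chid_sq1.
Qed.

End CellNaturality.

Lemma disc_box_cell (A : D) (G : disc_box N A Y → Z) :
  exists (f : Hom (A ⊠0[M] B) C) (g : cell f f (hid A ⊠ Y) Z),
  [/\ dmap G = ten_sq g, cell_mul_l g = cell_mul_r g &
    cell_one_l g = cell_one_r f].
Proof.
exists (vmap G), (mcell G); split; first by rewrite /dmap.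
  apply/cell_mulP.
  rewrite -(ten_mulK (X := discrete A) (interchanging_l N A Y)).
  rewrite (cmpA (ten_sq _)) (cmpA (mon_mul Z)).
  exact: (congr1 (fun g => g ∘ _) (mmap_mu G)).
have o : ten_one (X := discrete A) (interchanging_l N A Y) ∘ ups_sq A B =
    idm (disc A) ⊗m mon_one Y by exact: (ten_oneK (X := discrete A)
      (interchanging_l N A Y)).
rewrite /cell_one_l -o (cmpA (ten_sq _)) /cell_one_r (cmpA (mon_one Z)).
exact: (congr1 (fun g => g ∘ _) (mmap_eta G)).
Qed.

Lemma equaliser_factor (A E T : D) (a b : Hom A T) (e : Hom E A) :
  (forall (W : D) (w : Hom W A), a ∘ w = b ∘ w -> exists! h, e ∘ h = w) ->
  a ∘ e = b ∘ e -> forall (W : D) (h k : Hom W E), e ∘ h = e ∘ k -> h = k.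
Proof.
move=> e_univ ab W h k hk.
have [|l [_ l_uniq]] := e_univ W (e ∘ k); first by rewrite !cmpA ab.
by rewrite -(l_uniq h) // (l_uniq k).
Qed.

Lemma chid_ten (A A' A'' : D) (W : hcat D) (h : Hom A' A) (k : Hom A'' A') :
  chid_sq (h ∘ k) ⊗m idm W = (chid_sq h ⊗m idm W) ∘ (chid_sq k ⊗m idm W).
Proof. by rewrite chid_sqM (tmapMl (laws1 M)). Qed.

Lemma representable_inj (T : D) (V W : hcat D) (t : disc T ⊗ V ~> W) :
  (forall (A : D) (F : disc A ⊗ V ~> W),
    exists! h : Hom A T, t ∘ (chid_sq h ⊗m idm V) = F) ->
  forall (A : D) (h k : Hom A T),
  t ∘ (chid_sq h ⊗m idm V) = t ∘ (chid_sq k ⊗m idm V) -> h = k.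
Proof.
move=> t_univ A h k hk.
have [l [_ l_uniq]] := t_univ A (t ∘ (chid_sq k ⊗m idm V)).
by rewrite -(l_uniq h) // (l_uniq k).
Qed.

(* The monad maps are cut out of the representing object of [disc_representable]
   by three equalisers: equality of the two boundaries, compatibility with the
   multiplication and compatibility with the unit. *)
Lemma disc_box_representable :
  exists (E : D) (G0 : disc_box N E Y → Z),
  forall (A : D) (G : disc_box N A Y → Z),
    exists! h : Hom A E, G0 ∘ disc_box_map N h (idm (Y : Mnd D)) = G.
Proof.
have [T [t t_univ]] := disc_representable (mloop Y) (mloop Z).
have [l [lE _]] := hom0_universal (lft t : Hom (T ⊠0[M] B) C).
have [r [rE _]] := hom0_universal (rgt t : Hom (T ⊠0[M] B) C).
have [E0 [e0 [lr e0_univ]]] := equalisers l r.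
have [f [g gE]] : exists (f : Hom (E0 ⊠0[M] B) C) (g : cell f f (hid E0 ⊠ Y) Z),
    ten_sq g = t ∘ (chid_sq e0 ⊗m idm (loop Y)).
  apply: (@sq_diagonal D (E0 ⊠0[M] B) C (hid E0 ⊠ Y) Z).
  transitivity (lft t ∘ tmap (ten0 M) e0 (idm B)); first by [].
  rewrite -lE -cmpA -(tmapM (laws0 M)) lr (tmapM (laws0 M)) cmpA rE.
  by [].
have [T1' [t1 t1_univ]] := disc_representable (Y ⊙ Y) (mloop Z).
have [a1 [a1E _]] := t1_univ _ (cell_mul_l g).
have [b1 [b1E _]] := t1_univ _ (cell_mul_r g).
have [E1 [e1 [ab1 e1_univ]]] := equalisers a1 b1.
have [T2 [t2 t2_univ]] := disc_representable (hid B) (mloop Z).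
have [a2 [a2E _]] := t2_univ _ (cell_one_l g).
have [b2 [b2E _]] := t2_univ _ (cell_one_r f).
have [E2 [e2 [ab2 e2_univ]]] := equalisers (a2 ∘ e1) (b2 ∘ e1).
have boundaries (A : D) (h : Hom A T) :
    lft (t ∘ (chid_sq h ⊗m idm (loop Y))) =
      rgt (t ∘ (chid_sq h ⊗m idm (loop Y))) -> l ∘ h = r ∘ h.
  move=> lrh; apply: (@hom0_inj).
  rewrite -[idm B]cmp1m !(tmapM (laws0 M)) !cmpA lE rE; exact: lrh.
have [f2 [g2 g2E]] : exists (f2 : Hom (E2 ⊠0[M] B) C)
    (g2 : cell f2 f2 (hid E2 ⊠ Y) Z),
    ten_sq g2 = ten_sq g ∘ (chid_sq (e1 ∘ e2) ⊗m idm (loop Y)).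
  exact: (@sq_diagonal D (E2 ⊠0[M] B) C (hid E2 ⊠ Y) Z
    (ten_sq g ∘ (chid_sq (e1 ∘ e2) ⊗m idm (loop Y))) erefl).
have [G0 G0E] : exists G0 : disc_box N E2 Y → Z, dmap G0 = ten_sq g2.
  apply: cell_disc_box.
    rewrite (cell_mul_l_nat g2E) (cell_mul_r_nat g2E) -a1E -b1E -!cmpA
      -!chid_ten.
    by rewrite !cmpA ab1.
  rewrite (cell_one_l_nat g2E) (cell_one_r_nat g2E) -a2E -b2E -!cmpA -!chid_ten.
  by rewrite !cmpA ab2.
have G0h (A : D) (h : Hom A E2) :
    dmap (G0 ∘ disc_box_map N h (idm (Y : Mnd D))) =
    t ∘ (chid_sq (e0 ∘ (e1 ∘ (e2 ∘ h))) ⊗m idm (loop Y)).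
  by rewrite dmap_box mmap1 G0E g2E gE -!cmpA -!chid_ten !cmpA.
exists E2, G0 => A G.
have [f' [g' [GE mul_g' one_g']]] := disc_box_cell G.
have [h0 [h0E _]] := t_univ _ (ten_sq g').
have [|h1 [h1E _]] := e0_univ _ h0; first by apply: boundaries; rewrite h0E.
have g'E : ten_sq g' = ten_sq g ∘ (chid_sq h1 ⊗m idm (loop Y)).
  by rewrite gE -cmpA -chid_ten h1E h0E.
have [|h2 [h2E _]] := e1_univ _ h1.
  apply: (representable_inj t1_univ); rewrite !chid_ten !cmpA a1E b1E.
  by rewrite -(cell_mul_l_nat g'E) -(cell_mul_r_nat g'E).
have [|h3 [h3E _]] := e2_univ _ h2.
  rewrite -!cmpA h2E.
  apply: (representable_inj t2_univ); rewrite !chid_ten !cmpA a2E b2E.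
  by rewrite -(cell_one_l_nat g'E) -(cell_one_r_nat g'E).
exists h3; split.
  by apply: dmap_inj; rewrite G0h h3E h2E h1E h0E GE.
move=> k kE; apply: (equaliser_factor e2_univ ab2).
apply: (equaliser_factor e1_univ ab1).
apply: (equaliser_factor e0_univ lr).
by apply: (representable_inj t_univ); rewrite -(G0h A k) kE h3E h2E h1E h0E GE.
Qed.

End MonadMaps.

(** The component of a map [X □ Y → Z] on [incr] amounts to a vertical map [h] into [E]. Its
    component on [incl] then lies over the evaluation of [e ∘ h], so it is a monad map [G] into [H]
    with [vmap G = h]. Thus [G] alone records both components. *)
Lemma nc_hom_exists (Y Z : Mnd D) :
  exists p : {H : Mnd D & @Hom (Mnd D) (H □ Y) Z},
    has_counit (F := tensr nc_laws Y) (projT2 p).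
Proof.
have [E [G0 G0_univ]] := disc_box_representable Y Z.
have [e [eE _]] := hom0_universal (vmap G0).
have [m [ev [evv ev_univ]]] := disc_hom_exists e.
pose H : Mnd D := MkMonad m.
have [|EV [[EVl EVr] _]] := @nc_universal H Y Z ev G0.
  by rewrite evv eE.
have EVmap (X : Mnd D) (G : X → H) :
    EV ∘ nc_map G (idm Y) ∘ incl X Y =
      @cmp (Mnd D) _ _ _ ev (box_disc_map N G (idm (mbase Y))) /\
    EV ∘ nc_map G (idm Y) ∘ incr X Y = G0 ∘ disc_box_map N (vmap G) (idm Y).
  have [al ar] := nc_map_action G (idm Y).
  split; rewrite -cmpA.
    by rewrite [nc_map _ _ ∘ _]al cmpA EVl.
  by rewrite [nc_map _ _ ∘ _]ar cmpA EVr.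
exists (existT _ H EV) => X F.
have [h [hF h_uniq]] := G0_univ _ (F ∘ incr X Y).
have Fv : vmap (F ∘ incl X Y) =
    ev0 K (mbase Y) (mbase Z) ∘ tmap (ten0 M) (e ∘ h) (idm (mbase Y)).
  transitivity (vmap (F ∘ incr X Y)).
    transitivity (vmap F ∘ vmap (incl X Y)); first by [].
    by rewrite vmap_incl -(vmap_incr X Y).
  rewrite -hF; transitivity (vmap G0 ∘ tmap (ten0 M) h (idm (mbase Y)));
    first by [].
  by rewrite -eE -cmpA -(tmapM (laws0 M)) cmp1m.
have [G [[Gh GF] G_uniq]] := ev_univ X h _ Fv.
exists G; split.
  have [El Er] := EVmap X G.
  apply: (nc_ext); first by rewrite -GF; exact: El.
  by rewrite -hF -Gh; exact: Er.
move=> G' G'F; have [El Er] := EVmap X G'.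
apply: G_uniq; split.
  by apply/esym/h_uniq; rewrite -Er; congr (_ ∘ _).
by rewrite -El; congr (_ ∘ _).
Qed.

Definition nc_closed : SymmetricMonoidalClosed (nc_ten).
Proof.
pose hom Y Z := constructive_indefinite_description _ (nc_hom_exists Y Z).
apply: (@Build_SymmetricMonoidalClosed (Mnd D) (nc_ten)
  (nc_constraints) nc_laws (nc_braid)
  (nc_symmetry) (fun Y Z => projT1 (sval (hom Y Z)))
  (fun Y Z => projT2 (sval (hom Y Z)))).
by move=> Y; apply: counit_adjoint => Z; apply: (svalP (hom Y Z)).
Defined.

End MonoidalClosedDoubleCategory.

Theorem theorem3p3p11 (D : DoubleCategory) (M : OplaxMonoidal D)
  (N : Normal M) (S : Symmetric M) (K : Closed M)
  (fibrant : is_fibrant D)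
  (P : forall A : D, FiniteCoproducts (MndOn A))
  (equalisers : has_equalisers D)
  (tabulators : has_1_tabulators D) :
  exists T : forall X X' Y Y' : Mnd D,
      Hom X X' -> Hom Y Y' ->
      @Hom (Mnd D) (nc_tensor N P X Y) (nc_tensor N P X' Y'),
    is_nc_action T /\
    inhabited (SymmetricMonoidalClosed
      (@MkTensor (Mnd D) (nc_tensor N P) T (discrete (tunit (ten0 M))))).
Proof.
exists (@nc_map D M N fibrant P); split; first exact: nc_map_action.
by constructor; exact: nc_closed.
Qed.
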